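(* Let $f\in L^\infty(\mathbb R;\mathbb C)$ with $f\ge 0$ satisfy: (i) $f(x)=f(|x|)$ for a.e. $x\in\mathbb R$; (ii) there exist $\rho>1$ and $C>0$ such that $|f(x)|\le C\langle x\rangle^{-\rho}$ for a.e. $x\in\mathbb R$; (iii) there exists $\delta>0$ such that $f=1$ on $(-\delta,\delta)$. Let $H_0:=Q$ and let $H$ be a selfadjoint operator in $\mathcal H=L^2(\mathbb R)$ such that the wave operators $W_\pm:=\mathrm{s\text{-}}\lim_{t\to\pm\infty}\mathrm e^{itH}\mathrm e^{-itH_0}$ exist and are complete, and such that every operator $T\in\mathscr B(\mathcal H^{-s'},\mathcal H)$ with $s'>1/2$ is locally $H$-smooth on $\mathbb R\setminus\sigma_{\rm pp}(H)$. Let $s>1$ and let $\varphi\in\mathscr D_s$ be such that $S\varphi\in\mathscr D_s$ and $$\int_{-\infty}^0\mathrm dt\,\|(W_--1)\mathrm e^{-itH_0}\varphi\|<\infty,\qquad \int_0^{\infty}\mathrm dt\,\|(W_+-1)\mathrm e^{-itH_0}S\varphi\|<\infty .$$ If the scattering matrix $x\mapsto S(x)$ is continuously differentiable on the support of $\varphi$, then the identity $\lim_{r\to\infty}\tau_r^{\rm in}(\varphi)=\langle\varphi,S^*[P,S]\varphi\rangle$ (which holds under the preceding hypotheses) can be rewritten as $$\lim_{r\to\infty}\tau^{\rm in}_r(\varphi)=-i\int_{\mathbb R}\mathrm dx\,|\varphi(x)|^2\,\overline{S(x)}\,S'(x).$$ In particular, if $\|\varphi\|=1$ and $f=\chi_J$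 with $J\subset\mathbb R$ bounded, $J=-J$, and $J\supset(-\delta,\delta)$ for some $\delta>0$, then $T^0_r(\varphi)$ and $T_r(\varphi)$ can be interpreted as sojourn times, and this formula expresses the identity of the global time delay and the Eisenbud-Wigner time delay for the Friedrichs model.
   Context: $\mathcal H:=L^2(\mathbb R)$ with scalar product $\langle\cdot,\cdot\rangle$ (antilinear in the first argument) and norm $\|\cdot\|$; $Q$ is the operator of multiplication by $x$, $P=-i\,\mathrm d/\mathrm dx$, $\langle x\rangle:=(1+|x|^2)^{1/2}$. For $s\in\mathbb R$, $\mathcal H^s$ is the usual Sobolev space on $\mathbb R$, i.e. the completion of the Schwartz space for the norm $\|\langle P\rangle^s\varphi\|$. $\mathscr B(\mathcal H_1,\mathcal H_2)$ is the set of bounded operators from $\mathcal H_1$ to $\mathcal H_2$. $\chi_J$ is the characteristic function of $J$. Completeness of $W_\pm$ means that their ranges equal the absolutely continuous subspace of $H$; then the scattering operator $S:=W_+^*W_-$ is unitary. $S$ commutes with $H_0=Q$, hence it is multiplication by a function $x\mapsto S(x)\in\mathbb C$ defined for a.e. $x$, the scattering matrix ($S(x)$ is its component at energy $x$). The expression $\langle\varphi,S^*[P,S]\varphi\rangle$ means $\langle S\varphi,PS\varphi\rangle-\langle\varphi,P\varphi\rangle$. $\sigma_{\rm pp}(H)$ is the set of eigenvalues of $H$. An operator $T$ is locally $H$-smooth on a set $\Omega\subset\mathbb R$ if for each compact $K\subset\Omega$ there is $C_K>0$ such that $\int_{\mathbb R}\mathrm dt\,\|T\mathrm e^{-itH}E^H(K)\psi\|^2\le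 C_K\|\psi\|^2$ for all $\psi\in\mathcal H$, where $E^H$ is the spectral measure of $H$. For $s\ge 0$, $$\mathscr D_s:=\{\varphi\in\mathcal H^s\mid \chi_J(Q)\varphi=\varphi\text{ for some compact set }J\subset\mathbb R\setminus\sigma_{\rm pp}(H)\}.$$ For $r>0$, $$T^0_r(\varphi):=\int_{\mathbb R}\mathrm dt\,\langle \mathrm e^{-itH_0}\varphi,f(P/r)\mathrm e^{-itH_0}\varphi\rangle,\qquad T_r(\varphi):=\int_{\mathbb R}\mathrm dt\,\langle \mathrm e^{-itH}W_-\varphi,f(P/r)\mathrm e^{-itH}W_-\varphi\rangle,$$ $$\tau_r^{\rm in}(\varphi):=T_r(\varphi)-T_r^0(\varphi).$$ *)

(* Defs.v *)
From HB Require Import structures.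
From mathcomp Require Import all_boot all_order all_algebra.
From mathcomp Require Export complex.
From mathcomp Require Import all_classical all_reals all_analysis.

Set Implicit Arguments.
Unset Strict Implicit.
Unset Printing Implicit Defensive.

Import Order.TTheory GRing.Theory Num.Theory.
Import numFieldNormedType.Exports.

Local Open Scope classical_set_scope.
Local Open Scope ring_scope.
Local Open Scope complex_scope.

(* Vectors of L^2(R) are represented by Borel functions R -> C, and equality of
   vectors by equality almost everywhere [aeq].  An operator is a map on
   functions; bounded operators respect [aeq] automatically, because
   A u - A v = A (u - v) a.e. and |A (u - v)| <= c |u - v|. *)
Definition fn (R : realType) := R -> R[i].
Definition op (R : realType) := fn R -> fn R.

Definition aeq (R : realType) (u v : fn R) : Prop :=
  {ae @lebesgue_measure R, forall x, u x = v x}.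

Definition measurable_cplx (R : realType) (u : fn R) : Prop :=
  measurable_fun setT (fun x => complex.Re (u x)) /\
  measurable_fun setT (fun x => complex.Im (u x)).

Definition integrable_cplx (R : realType) (u : fn R) : Prop :=
  (@lebesgue_measure R).-integrable setT (fun x => (complex.Re (u x))%:E) /\
  (@lebesgue_measure R).-integrable setT (fun x => (complex.Im (u x))%:E).

Definition integral_cplx (R : realType) (D : set R) (u : fn R) : R[i] :=
  (\int[@lebesgue_measure R]_(x in D) complex.Re (u x)) +i*
  (\int[@lebesgue_measure R]_(x in D) complex.Im (u x)).

Definition L2 (R : realType) : set (fn R) := [set u | measurable_cplx u /\
  (\int[@lebesgue_measure R]_x ((ComplexField.Normc.normc (u x)) ^+ 2)%:E < +oo)%E].

Definition inner_prod (R : realType) (u v : fn R) : R[i] :=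
  integral_cplx setT (fun x => (u x)^* * v x).

Definition norm2 (R : realType) (u : fn R) : R :=
  Num.sqrt (\int[@lebesgue_measure R]_x (ComplexField.Normc.normc (u x)) ^+ 2).

Definition expi (R : realType) (a : R) : R[i] := cos a +i* sin a.

Definition japanese (R : realType) (x : R) : R := Num.sqrt (1 + x ^+ 2).

(* Bounded operators into L^2(R) from a space X of functions normed by N. *)
Definition bounded_from (R : realType) (X : set (fn R)) (N : fn R -> R)
    (A : op R) : Prop :=
  [/\ forall u, X u -> L2 (A u),
      forall (a : R[i]) u v, X u -> X v ->
        aeq (A (fun x => a * u x + v x)) (fun x => a * A u x + A v x) &
      exists c : R, forall u, X u -> norm2 (A u) <= c * N u].

Definition bounded_op (R : realType) (A : op R) : Prop :=
  bounded_from (@L2 R) (@norm2 R) A.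

Definition unitary_op (R : realType) (A : op R) : Prop :=
  [/\ bounded_op A,
      forall u, L2 u -> norm2 (A u) = norm2 u &
      forall v, L2 v -> exists2 u, L2 u & aeq (A u) v].

(* The values of [op_adjoint A] and [op_inverse A] are vectors determined up to
   [aeq]; the default value 0 is only used where no such vector exists. *)
Definition op_adjoint (R : realType) (A : op R) : op R := fun v =>
  xget (fun=> 0) [set w : fn R | L2 w /\
    forall u, L2 u -> inner_prod (A u) v = inner_prod u w].

Definition op_inverse (R : realType) (A : op R) : op R := fun v =>
  xget (fun=> 0) [set u : fn R | L2 u /\ aeq (A u) v].

(* The unitary Fourier transform of L^2(R), i.e. the unique continuous extension
   of (F u)(k) = (2 pi)^(-1/2) \int e^(-ikx) u(x) dx from L^1 \cap L^2. *)
Definition fourier_transform (R : realType) (F : op R) : Prop :=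
  unitary_op F /\ forall u, L2 u -> integrable_cplx u ->
    aeq (F u) (fun k => ((Num.sqrt (2 * pi))^-1)%:C *
                        integral_cplx setT (fun x => expi (- (k * x)) * u x)).

(* [momentum u v] means that u lies in the domain of P = -i d/dx and P u = v:
   u has an absolutely continuous representative with derivative i v. *)
Definition momentum (R : realType) (u v : fn R) : Prop :=
  [/\ L2 u, L2 v & exists2 w, aeq w u & forall a b : R, a <= b ->
     w b - w a = integral_cplx `]a, b] (fun x => 'i * v x)].

(* g(P/r), the function g(./r) of P, which F diagonalizes. *)
Definition fun_momentum (R : realType) (F : op R) (g : R -> R[i]) (r : R) :
  op R := fun u => op_inverse F (fun k => g (k / r) * F u k).

(* An element of the Sobolev space H^s, s of any sign, is represented by its
   Fourier transform, an element of the weighted space L^2(<k>^(2s) dk);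
   a vector u of L^2(R) is thus represented by F u. *)
Definition sobolev_weight (R : realType) (s : R) (g : fn R) : fn R :=
  fun k => (japanese k `^ s)%:C * g k.

Definition sobolev (R : realType) (s : R) : set (fn R) :=
  [set g | L2 (sobolev_weight s g)].

Definition sobolev_norm (R : realType) (s : R) (g : fn R) : R :=
  norm2 (sobolev_weight s g).

(* Unbounded operators are pairs of a domain D and a map H, significant on D
   only.  The last clause says that H and its adjoint have the same graph. *)
Definition self_adjoint (R : realType) (D : set (fn R)) (H : op R) : Prop :=
  [/\ D `<=` @L2 R,
      forall u, D u -> L2 (H u),
      forall u (e : R), L2 u -> 0 < e ->
        exists2 v, D v & norm2 (fun x => u x - v x) < e &
      forall v w, L2 v -> L2 w ->
        (D v /\ aeq (H v) w <-> forall u, D u -> inner_prod (H u) v = inner_prod u w)].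

(* U t = e^(-itH): the strongly continuous unitary group whose generator,
   domain included, is -iH. *)
Definition evolution_group (R : realType) (D : set (fn R)) (H : op R)
    (U : R -> op R) : Prop :=
  [/\ forall t, unitary_op (U t),
      forall t t' u, L2 u -> aeq (U (t + t') u) (U t (U t' u)),
      forall u, L2 u -> norm2 (fun x => U t u x - u x) @[t --> (0 : R)] --> (0 : R) &
      forall u v, L2 u -> L2 v ->
        (D u /\ aeq (H u) v <->
         norm2 (fun x => (U t u x - u x) / t%:C + 'i * v x) @[t --> (0 : R)^'] -->
           (0 : R))].

(* E is the projection-valued measure of H: each E B is an orthogonal
   projection, each B |-> <u, E B u> = |E B u|^2 is a measure m, u is in the
   domain of H iff \int l^2 dm < oo, and then <u, H u> = \int l dm. *)
Definition spectral_measure (R : realType) (D : set (fn R)) (H : op R)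
    (E : set R -> op R) : Prop :=
  [/\ forall B, measurable B ->
        [/\ bounded_op (E B),
            forall u, L2 u -> aeq (E B (E B u)) (E B u) &
            forall u v, L2 u -> L2 v -> inner_prod (E B u) v = inner_prod u (E B v)],
      forall u, L2 u -> aeq (E setT u) u &
      forall u, L2 u -> exists m : {measure set (measurableTypeR R) -> \bar R},
        [/\ forall B, measurable B -> m B = (norm2 (E B u) ^+ 2)%:E,
            D u <-> (\int[m]_l (l ^+ 2)%:E < +oo)%E &
            D u -> inner_prod u (H u) = (\int[m]_l l)%:C]].

Definition eigenvalues (R : realType) (D : set (fn R)) (H : op R) : set R :=
  [set l | exists u, [/\ D u, ~ aeq u (fun=> 0) &
                         aeq (H u) (fun x => l%:C * u x)]].

Definition abs_cont_subspace (R : realType) (E : set R -> op R) : set (fn R) :=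
  [set u | L2 u /\ forall B, measurable B -> @lebesgue_measure R B = 0%E ->
                             aeq (E B u) (fun=> 0)].

(* e^(-it H_0) with H_0 = Q. *)
Definition free_evolution (R : realType) (t : R) : op R :=
  fun u x => expi (- (t * x)) * u x.

(* W is the strong limit of e^(itH) e^(-it H_0) as t tends to infinity along
   the filter T. *)
Definition wave_operator (R : realType) (U : R -> op R) (T : set_system R)
    (W : op R) : Prop :=
  bounded_op W /\ forall u, L2 u ->
    norm2 (fun x => U (- t) (free_evolution t u) x - W u x) @[t --> T] --> (0 : R).

Definition complete_wave_operator (R : realType) (E : set R -> op R)
    (W : op R) : Prop :=
  forall v, L2 v -> (exists2 u, L2 u & aeq (W u) v) <-> abs_cont_subspace E v.

Definition scattering_operator (R : realType) (Wp Wm : op R) : op R :=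
  fun u => op_adjoint Wp (Wm u).

(* T acts on vectors of L^2(R) through their Fourier transforms, being an
   operator on the negative order Sobolev space H^(-s') as represented above. *)
Definition locally_smooth (R : realType) (F : op R) (U : R -> op R)
    (E : set R -> op R) (Omega : set R) (T : op R) : Prop :=
  forall K : set R, compact K -> K `<=` Omega ->
    exists2 c : R, 0 < c & forall u, L2 u ->
      (\int[@lebesgue_measure R]_t ((norm2 (T (F (U t (E K u))))) ^+ 2)%:E
         <= (c * norm2 u ^+ 2)%:E)%E.

(* The set D_s, with sigma in the role of the point spectrum. *)
Definition regular_vectors (R : realType) (F : op R) (sigma : set R) (s : R) :
  set (fn R) :=
  [set u | [/\ L2 u, sobolev s (F u) &
     exists J : set R, [/\ compact J, J `<=` ~` sigma &
                           aeq (fun x => (\1_J x)%:C * u x) u]]].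

Definition free_time (R : realType) (F : op R) (f : R -> R[i]) (u : fn R)
    (r t : R) : R[i] :=
  inner_prod (free_evolution t u) (fun_momentum F f r (free_evolution t u)).

Definition full_time (R : realType) (F : op R) (f : R -> R[i]) (U : R -> op R)
    (Wm : op R) (u : fn R) (r t : R) : R[i] :=
  inner_prod (U t (Wm u)) (fun_momentum F f r (U t (Wm u))).

(* T^0_r(u), T_r(u) and tau^in_r(u). *)
Definition T_free (R : realType) (F : op R) f (u : fn R) (r : R) : R[i] :=
  integral_cplx setT (free_time F f u r).

Definition T_full (R : realType) (F : op R) f (U : R -> op R) (Wm : op R)
    (u : fn R) (r : R) : R[i] :=
  integral_cplx setT (full_time F f U Wm u r).

Definition tau_in (R : realType) (F : op R) f (U : R -> op R) (Wm : op R)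
    (u : fn R) (r : R) : R[i] :=
  T_full F f U Wm u r - T_free F f u r.

(* Time spent by the state t |-> psi t in the region |P| \in r J. *)
Definition sojourn_time (R : realType) (F : op R) (J : set R)
    (psi : R -> fn R) (r : R) : R :=
  \int[@lebesgue_measure R]_t
    (norm2 (fun_momentum F (fun k => (\1_J k)%:C) r (psi t)) ^+ 2).

Definition ess_supp (R : realType) (u : fn R) : set R :=
  ~` [set x | exists2 V : set R, nbhs x V &
        {ae @lebesgue_measure R, forall y, V y -> u y = 0}].

(* S is multiplication by the function sm. *)
Definition scattering_matrix (R : realType) (S : op R) (sm : R -> R[i]) : Prop :=
  measurable_cplx sm /\ forall u, L2 u -> aeq (S u) (fun x => sm x * u x).

(* g is continuously differentiable on the set K, with derivative g'; limits
   are taken within K, so values outside K play no role. *)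
Definition C1_on (R : realType) (K : set R) (g g' : R -> R[i]) : Prop :=
  forall x, K x ->
    ComplexField.Normc.normc ((g y - g x) / (y - x)%:C - g' x)
      @[y --> within K (x^')] --> (0 : R) /\
    ComplexField.Normc.normc (g' y - g' x) @[y --> within K (nbhs x)] --> (0 : R).

Definition eisenbud_wigner (R : realType) (u : fn R) (sm sm' : R -> R[i]) : R[i] :=
  - 'i * integral_cplx setT
           (fun x => (ComplexField.Normc.normc (u x) ^+ 2)%:C * (sm x)^* * sm' x).

Definition cvg_cplx (R : realType) (g : R -> R[i]) (T : set_system R) (l : R[i]) :
  Prop := ComplexField.Normc.normc (g r - l) @[r --> T] --> (0 : R).

(* Main.v *)
Require Import Defs.
From HB Require Import structures.
From mathcomp Require Import all_boot all_order all_algebra.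
From mathcomp Require Import all_classical all_reals all_analysis.
From mathcomp Require Import measurable_realfun ring lra.

Set Implicit Arguments.
Unset Strict Implicit.
Unset Printing Implicit Defensive.

Import Order.TTheory GRing.Theory Num.Theory.
Import numFieldNormedType.Exports.

Local Open Scope classical_set_scope.
Local Open Scope ring_scope.
Local Open Scope complex_scope.

Local Notation mu := lebesgue_measure.
Local Notation Re := complex.Re.
Local Notation Im := complex.Im.
Local Notation normc := ComplexField.Normc.normc.
Local Notation intg f := (mu.-integrable setT (EFin \o f)).

(* Since W+- intertwine H and Q, the orbit e^(-itH) W- phi equals both
   W- e^(-itQ) phi and W+ e^(-itQ) S phi.  For t < 0 it is compared with
   e^(-itQ) phi and for t > 0 with e^(-itQ) S phi; the two errors are integrable
   in t, uniformly in r, and disappear as r -> oo because f(P/r) -> 1 and W+- are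
   isometric.  What remains is the integral over t > 0 of the difference of the
   free expectations of f(P/r) in S phi and phi.  As e^(itQ) f(P/r) e^(-itQ) =
   f((P - t)/r), it equals the integral of |F S phi|^2 - |F phi|^2 against
     G_r(k) = \int_(u <= k) f(u/r) du,
   where G_r(k) - G_r(0) is bounded by C |k| and equals k once r is large; the
   constant G_r(0) drops out because S is isometric.  The limit is therefore
   <S phi, P S phi> - <phi, P phi>.  Finally S phi = S(x) phi(x) with
   |S(x)| = 1, and the product rule, applied at almost every point by Lebesgue's
   differentiation theorem, gives the Eisenbud-Wigner expression. *)

(** * Complex numbers and integrals *)

(** Neither time has a finite limit by itself: T^0_r(phi) = r ||phi||^2 \int f grows with r, so the
    free time of phi is subtracted under the integral before r tends to infinity. The errors are
    controlled uniformly in r by |q_r(u) - q_r(v)| <= M ||u - v|| (||u|| + ||v||), where q_r(u) =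
    <u, f(P/r) u> and M bounds f. Completeness gives W+ and W- the same range, and this makes S
    isometric: W- phi = W+ w forces w = S phi. Functions of P are obtained by choosing preimages
    under F, and f is controlled only almost everywhere; f is therefore replaced by a real profile
    with bounds at every point, and expectations by real integrals on the Fourier side. Compact
    support makes phi and S phi integrable, so that F is given on them by its integral and e^(-itQ)
    acts as a translation. Sobolev regularity makes k F phi square-integrable and F phi integrable,
    likewise for S phi; both vectors then have absolutely continuous representatives. The derivative
    of S phi thus exists on its own, and the product rule only has to identify it. *)

Section ComplexComponents.
Context {R : realType}.
Implicit Types (z w : R[i]) (a : R).

Lemma Re_add z w : Re (z + w) = Re z + Re w. Proof. by case: z; case: w. Qed.
Lemma Im_add z w : Im (z + w) = Im z + Im w. Proof. by case: z; case: w. Qed.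
Lemma Re_opp z : Re (- z) = - Re z. Proof. by case: z. Qed.
Lemma Im_opp z : Im (- z) = - Im z. Proof. by case: z. Qed.
Lemma Re_mul z w : Re (z * w) = Re z * Re w - Im z * Im w.
Proof. by case: z; case: w. Qed.
Lemma Im_mul z w : Im (z * w) = Re z * Im w + Im z * Re w.
Proof. by case: z; case: w. Qed.
Lemma Re_conj z : Re z^* = Re z. Proof. by case: z. Qed.
Lemma Im_conj z : Im z^* = - Im z. Proof. by case: z. Qed.
Lemma Re_real a : Re a%:C = a. Proof. by []. Qed.
Lemma Im_real a : Im a%:C = 0. Proof. by []. Qed.

Definition reimE := (Re_add, Im_add, Re_opp, Im_opp, Re_mul, Im_mul,
  Re_conj, Im_conj, Re_real, Im_real).

Lemma complex_ext z w : Re z = Re w -> Im z = Im w -> z = w.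
Proof. by case: z; case: w => a b c d /= -> ->. Qed.

Lemma normc_ge0 z : 0 <= normc z.
Proof. by case: z => a b; rewrite /normc sqrtr_ge0. Qed.

Lemma normc_sq z : normc z ^+ 2 = Re z ^+ 2 + Im z ^+ 2.
Proof. by case: z => a b; rewrite /normc sqr_sqrtr// addr_ge0// sqr_ge0. Qed.

Lemma mulc_conj z : z^* * z = (normc z ^+ 2)%:C.
Proof. by apply: complex_ext; rewrite !reimE ?normc_sq; ring. Qed.

Lemma normc_real a : normc a%:C = `|a|.
Proof. by rewrite /normc/= expr0n addr0 sqrtr_sqr. Qed.

Lemma Re_le_normc z : `|Re z| <= normc z.
Proof.
by rewrite -(@ler_pXn2r _ 2%N)// ?nnegrE ?normc_ge0// normc_sq real_normK ?num_real// lerDl sqr_ge0.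
Qed.

Lemma Im_le_normc z : `|Im z| <= normc z.
Proof.
by rewrite -(@ler_pXn2r _ 2%N)// ?nnegrE ?normc_ge0// normc_sq real_normK ?num_real// lerDr sqr_ge0.
Qed.

Lemma normc_le_add z : normc z <= `|Re z| + `|Im z|.
Proof.
rewrite -(@ler_pXn2r _ 2%N)// ?nnegrE ?normc_ge0 ?addr_ge0// normc_sq.
rewrite sqrrD !real_normK ?num_real// lerD2r lerDl mulrn_wge0// mulr_ge0//.
Qed.

Lemma Re_i : Re ('i : R[i])%R = 0. Proof. by rewrite -complexiE. Qed.
Lemma Im_i : Im ('i : R[i])%R = 1. Proof. by rewrite -complexiE. Qed.

Lemma conj_mul (z w : R[i]) : ((z * w)^* = z^* * w^*)%R.
Proof. by apply: complex_ext; rewrite !reimE; ring. Qed.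

Lemma normc_opp (z : R[i]) : normc (- z) = normc z.
Proof. by case: z => a b; rewrite /normc/= !sqrrN. Qed.

Lemma normc_triangle (a b : R[i]) : normc (a + b) <= normc a + normc b.
Proof.
have := ler_normD a b; rewrite !normc_def -rmorphD lecR.
by case: a; case: b.
Qed.

End ComplexComponents.

Section RealIntegrals.
Context {R : realType}.
Implicit Types (f g h : R -> R) (c : R).
Local Notation mfun f := (measurable_fun [set: R] f).

Lemma ae_mono (P Q : R -> Prop) : (forall x, P x -> Q x) ->
  {ae (@mu R), forall x, P x} -> {ae (@mu R), forall x, Q x}.
Proof. by move=> PQ; apply: (@filterS _ _ (ae_filter_ringOfSetsType mu)). Qed.

Lemma ae_mono2 (P Q S : R -> Prop) : (forall x, P x -> Q x -> S x) ->
  {ae (@mu R), forall x, P x} -> {ae (@mu R), forall x, Q x} ->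
  {ae (@mu R), forall x, S x}.
Proof. by move=> PQ; apply: (@filterS2 _ _ (ae_filter_ringOfSetsType mu)). Qed.

Lemma ae_mono3 (P Q S T : R -> Prop) : (forall x, P x -> Q x -> S x -> T x) ->
  {ae (@mu R), forall x, P x} -> {ae (@mu R), forall x, Q x} ->
  {ae (@mu R), forall x, S x} -> {ae (@mu R), forall x, T x}.
Proof. by move=> PQ; apply: (@filterS3 _ _ (ae_filter_ringOfSetsType mu)). Qed.

Lemma ae_all (P : R -> Prop) : (forall x, P x) -> {ae (@mu R), forall x, P x}.
Proof. by move=> p; apply: (@filterE _ _ (ae_filter_ringOfSetsType mu)). Qed.

Lemma intg_measurable f : intg f -> mfun f.
Proof. by move/measurable_int/measurable_EFinP. Qed.

Lemma intgD f g : intg f -> intg g -> intg (fun x => f x + g x).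
Proof. by move=> fi gi; have := integrableD measurableT fi gi; exact: eq_integrable. Qed.

Lemma intgN f : intg f -> intg (fun x => - f x).
Proof. by move=> fi; have := integrableN fi; exact: eq_integrable. Qed.

Lemma intgB f g : intg f -> intg g -> intg (fun x => f x - g x).
Proof. by move=> fi gi; apply: intgD => //; exact: intgN. Qed.

Lemma intgZ c f : intg f -> intg (fun x => c * f x).
Proof. by move=> fi; have := integrableZl measurableT c fi; exact: eq_integrable. Qed.

Lemma intg0 : intg (fun _ : R => 0 : R).
Proof. exact: integrable0. Qed.

Lemma intg_abs f : intg f -> intg (fun x => `|f x|).
Proof. exact: integrable_norm. Qed.

Lemma intg_le f g : mfun f -> (forall x, `|f x| <= g x) -> intg g -> intg f.
Proof.
move=> mf fg gi; apply: (le_integrable measurableT _ _ gi); first exact/measurable_EFinP.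
by move=> x _ /=; rewrite lee_fin (le_trans (fg x))// ler_norm.
Qed.

Lemma intg_ae f g : mfun f -> {ae (@mu R), forall x, f x = g x} -> intg g -> intg f.
Proof.
move=> mf fg /[dup] gi /integrableP[mg gfin]; apply/integrableP; split.
  exact/measurable_EFinP.
suff <- : (\int[mu]_x `|(EFin \o g) x|)%E = (\int[mu]_x `|(EFin \o f) x|)%E by [].
apply: ae_eq_integral => //.
- by apply: measurableT_comp.
- by apply: measurableT_comp => //; exact/measurable_EFinP.
- by apply: ae_mono fg => x /= -> _.
Qed.

Lemma RI_ae f g : mfun f -> mfun g -> {ae (@mu R), forall x, f x = g x} ->
  \int[mu]_x f x = \int[mu]_x g x.
Proof.
move=> mf mg fg; rewrite /Rintegral; congr fine.
apply: ae_eq_integral => //; try exact/measurable_EFinP.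
by apply: ae_mono fg => x /= -> _.
Qed.

Lemma RI_ext f g : f =1 g -> \int[mu]_x f x = \int[mu]_x g x.
Proof. by move=> fg; apply: eq_Rintegral => x _. Qed.

Lemma RID f g : intg f -> intg g ->
  \int[mu]_x (f x + g x) = \int[mu]_x f x + \int[mu]_x g x.
Proof. by move=> fi gi; rewrite RintegralD. Qed.

Lemma RIZ c f : intg f -> \int[mu]_x (c * f x) = c * \int[mu]_x f x.
Proof. by move=> fi; rewrite RintegralZl. Qed.

Lemma RIN f : intg f -> \int[mu]_x (- f x) = - \int[mu]_x f x.
Proof.
move=> fi; rewrite -mulN1r -RIZ//; apply: RI_ext => x.
by rewrite mulN1r.
Qed.

Lemma RIB f g : intg f -> intg g ->
  \int[mu]_x (f x - g x) = \int[mu]_x f x - \int[mu]_x g x.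
Proof. by move=> fi gi; rewrite RID ?RIN//; exact: intgN. Qed.

Lemma RI_le f g : intg f -> intg g -> (forall x, f x <= g x) ->
  \int[mu]_x f x <= \int[mu]_x g x.
Proof. by move=> fi gi fg; apply: le_Rintegral. Qed.

Lemma RI_abs f : intg f -> `|\int[mu]_x f x| <= \int[mu]_x `|f x|.
Proof. by move=> fi; apply: le_normr_Rintegral. Qed.

Lemma RI_ge0_lty f : mfun f -> (forall x, 0 <= f x) ->
  (\int[mu]_x (f x)%:E < +oo)%E -> intg f.
Proof.
move=> mf f0 fi; apply/integrableP; split; first exact/measurable_EFinP.
under eq_integral do rewrite /= ger0_norm//.
exact: fi.
Qed.

Lemma RI_indic_itv (a b : R) : a <= b -> \int[mu]_x \1_`]a, b] x = b - a.
Proof.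
move=> ab; have -> : \int[mu]_x \1_`]a, b] x = fine (@mu R `]a, b]%classic).
  by rewrite /Rintegral integral_indic// setIT.
rewrite lebesgue_measure_itv /= lte_fin; have [//|ba] := ltP a b.
by rewrite (@le_anti _ _ a b) ?ab ?ba// subrr.
Qed.

Definition sqint f := mfun f /\ intg (fun x => f x ^+ 2).

Lemma sqint_mul f g : sqint f -> sqint g -> intg (fun x => f x * g x).
Proof.
move=> [mf fi] [mg gi]; apply: (@intg_le _ (fun x => f x ^+ 2 + g x ^+ 2)).
- exact: measurable_funM.
- move=> x; rewrite normrM -[f x ^+ 2]real_normK ?num_real//.
  rewrite -[g x ^+ 2]real_normK ?num_real//.
  have := sqr_ge0 (`|f x| - `|g x|).
  have : 0 <= `|f x| * `|g x| by rewrite mulr_ge0.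
  by nra.
- exact: intgD.
Qed.

Lemma sqint_add f g : sqint f -> sqint g -> sqint (fun x => f x + g x).
Proof.
move=> sf sg; have [mf fi] := sf; have [mg gi] := sg.
split; first exact: measurable_funD.
have -> : (fun x => (f x + g x) ^+ 2) =
   (fun x => f x ^+ 2 + (2 * (f x * g x) + g x ^+ 2)) by apply/funext => x; ring.
by apply: intgD => //; apply: intgD => //; apply: intgZ; exact: sqint_mul.
Qed.

Lemma sqint_scale c f : sqint f -> sqint (fun x => c * f x).
Proof.
move=> [mf fi]; split; first exact: measurable_funM.
by under eq_fun do rewrite exprMn; apply: intgZ.
Qed.

Lemma sqint_opp f : sqint f -> sqint (fun x => - f x).
Proof.
by move=> /(sqint_scale (-1)); under eq_fun do rewrite mulN1r.
Qed.

Lemma RI_eq0_ae f : intg f -> (forall x, 0 <= f x) -> \int[mu]_x f x = 0 ->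
  {ae (@mu R), forall x, f x = 0}.
Proof.
move=> fi f0 If0.
have : (\int[mu]_x `|(f x)%:E| = 0)%E.
  under eq_integral do rewrite /= ger0_norm//.
  have /= fin := integrable_fin_num measurableT fi.
  by move: If0; rewrite /Rintegral => If; rewrite -(fineK fin) If.
move/ae_eq_integral_abs => -/(_ measurableT (measurable_int _ fi)).
by apply: ae_mono => x /(_ I) []; rewrite /cst => -[].
Qed.

End RealIntegrals.

Section ComplexIntegrals.
Context {R : realType}.
Implicit Types (u v w : fn R) (a : R[i]).

Lemma measurable_cplx_add u v : measurable_cplx u -> measurable_cplx v ->
  measurable_cplx (fun x => u x + v x).
Proof.
move=> [mu1 mu2] [mv1 mv2]; split; under eq_fun do rewrite reimE;
  exact: measurable_funD.
Qed.

Lemma measurable_cplx_opp u : measurable_cplx u -> measurable_cplx (fun x => - u x).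
Proof.
by move=> [mu1 mu2]; split; under eq_fun do rewrite reimE; exact: measurable_funN.
Qed.

Lemma measurable_cplx_mul u v : measurable_cplx u -> measurable_cplx v ->
  measurable_cplx (fun x => u x * v x).
Proof.
move=> [mu1 mu2] [mv1 mv2]; split; under eq_fun do rewrite reimE.
  by apply: measurable_funB; exact: measurable_funM.
by apply: measurable_funD; exact: measurable_funM.
Qed.

Lemma measurable_cplx_cst a : measurable_cplx (fun _ : R => a).
Proof. by split; exact: measurable_cst. Qed.

Lemma measurable_cplx_conj u : measurable_cplx u -> measurable_cplx (fun x => (u x)^*).
Proof.
by move=> [mu1 mu2]; split; under eq_fun do rewrite reimE; [|exact: measurable_funN].
Qed.

Lemma measurable_cplx_real (g : R -> R) : measurable_fun setT g ->
  measurable_cplx (fun x => (g x)%:C).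
Proof. by move=> mg; split => //; exact: measurable_cst. Qed.

Lemma measurable_normc2 u : measurable_cplx u ->
  measurable_fun setT (fun x => normc (u x) ^+ 2).
Proof.
move=> [m1 m2]; under eq_fun do rewrite normc_sq.
by apply: measurable_funD; exact: measurable_funX.
Qed.

Lemma measurable_normc u : measurable_cplx u ->
  measurable_fun setT (fun x => normc (u x)).
Proof.
move=> mu_; have -> : (fun x => normc (u x)) = (fun x => Num.sqrt (normc (u x) ^+ 2)).
  by apply/funext => x; rewrite sqrtr_sqr ger0_norm// normc_ge0.
apply: measurableT_comp; last exact: measurable_normc2.
by apply: continuous_measurable_fun; exact: sqrt_continuous.
Qed.

Lemma aeq_refl u : aeq u u. Proof. exact: ae_all. Qed.
Lemma aeq_sym u v : aeq u v -> aeq v u.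
Proof. by apply: ae_mono. Qed.
Lemma aeq_trans v u w : aeq u v -> aeq v w -> aeq u w.
Proof. by apply: ae_mono2 => x ->. Qed.

Lemma integrable_cplx_measurable u : integrable_cplx u -> measurable_cplx u.
Proof. by move=> [/intg_measurable ? /intg_measurable ?]. Qed.

Lemma integrable_cplx_lin a u v : integrable_cplx u -> integrable_cplx v ->
  integrable_cplx (fun x => a * u x + v x).
Proof.
move=> [u1 u2] [v1 v2]; split; under eq_fun do rewrite !reimE.
  apply: (@intgD _ (fun x => Re a * Re (u x) - Im a * Im (u x))) => //.
  by apply: intgB; exact: intgZ.
apply: (@intgD _ (fun x => Re a * Im (u x) + Im a * Re (u x))) => //.
by apply: intgD; exact: intgZ.
Qed.

Lemma integral_cplx_lin a u v : integrable_cplx u -> integrable_cplx v ->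
  integral_cplx setT (fun x => a * u x + v x) =
  a * integral_cplx setT u + integral_cplx setT v.
Proof.
move=> [u1 u2] [v1 v2]; apply: complex_ext; rewrite !reimE /=;
    under [LHS]RI_ext do rewrite !reimE.
  rewrite (@RID _ (fun x => Re a * Re (u x) - Im a * Im (u x)))//; last first.
    by apply: intgB; exact: intgZ.
  by rewrite RIB ?RIZ//; exact: intgZ.
rewrite (@RID _ (fun x => Re a * Im (u x) + Im a * Re (u x)))//; last first.
  by apply: intgD; exact: intgZ.
by rewrite RID ?RIZ//; exact: intgZ.
Qed.

Lemma integrable_cplx0 : integrable_cplx (fun _ : R => 0).
Proof. by split; exact: intg0. Qed.

Lemma integral_cplx0 : integral_cplx setT (fun _ : R => 0) = 0.
Proof. by apply: complex_ext => /=; rewrite Rintegral_cst ?mul0r. Qed.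

Lemma integrable_cplxZ a u : integrable_cplx u ->
  integrable_cplx (fun x => a * u x).
Proof.
move=> iu; have := integrable_cplx_lin a iu integrable_cplx0.
by under eq_fun do rewrite addr0.
Qed.

Lemma integrable_cplxB u v : integrable_cplx u -> integrable_cplx v ->
  integrable_cplx (fun x => u x - v x).
Proof.
move=> iu iv; have := integrable_cplx_lin (-1) iv iu.
by under eq_fun do rewrite mulN1r addrC.
Qed.

Lemma integral_cplxZ a u : integrable_cplx u ->
  integral_cplx setT (fun x => a * u x) = a * integral_cplx setT u.
Proof.
move=> iu; rewrite -[RHS]addr0 -integral_cplx0 -integral_cplx_lin//; last exact: integrable_cplx0.
by under [in RHS]eq_fun do rewrite addr0.
Qed.

Lemma integral_cplxB u v : integrable_cplx u -> integrable_cplx v ->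
  integral_cplx setT (fun x => u x - v x) =
  integral_cplx setT u - integral_cplx setT v.
Proof.
move=> iu iv; rewrite addrC -mulN1r -integral_cplx_lin//.
by under [in RHS]eq_fun do rewrite mulN1r addrC.
Qed.

Lemma integrable_cplx_ae u v : measurable_cplx u -> aeq u v -> integrable_cplx v ->
  integrable_cplx u.
Proof.
move=> [m1 m2] uv [i1 i2]; split.
  by apply: (@intg_ae _ _ _ m1 _ i1); apply: ae_mono uv => x ->.
by apply: (@intg_ae _ _ _ m2 _ i2); apply: ae_mono uv => x ->.
Qed.

Lemma integral_cplx_ae u v : measurable_cplx u -> measurable_cplx v -> aeq u v ->
  integral_cplx setT u = integral_cplx setT v.
Proof.
move=> [m1 m2] [n1 n2] uv; apply: complex_ext; apply: RI_ae => //;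
 by apply: ae_mono uv => x ->.
Qed.

Lemma integrable_cplx_le u (g : R -> R) : measurable_cplx u ->
  (forall x, normc (u x) <= g x) -> intg g -> integrable_cplx u.
Proof.
move=> [m1 m2] ug gi; split; apply: (intg_le _ _ gi) => // x.
  exact: le_trans (Re_le_normc _) (ug x).
exact: le_trans (Im_le_normc _) (ug x).
Qed.

Lemma intg_normc u : integrable_cplx u -> intg (fun x => normc (u x)).
Proof.
move=> /[dup] /integrable_cplx_measurable mu_ [i1 i2].
apply: (intg_le _ _ (intgD (intg_abs i1) (intg_abs i2))).
  exact: measurable_normc.
by move=> x; rewrite ger0_norm ?normc_ge0//; exact: normc_le_add.
Qed.

Lemma integrable_cplx_real (h : R -> R) : intg h -> integrable_cplx (fun x => (h x)%:C).
Proof. by move=> ih; split=> //; exact: intg0. Qed.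

Lemma integral_cplx_real (h : R -> R) :
  integral_cplx setT (fun x => (h x)%:C) = (\int[mu]_x h x)%:C.
Proof. by apply: complex_ext => //=; rewrite Rintegral_cst ?mul0r. Qed.

Lemma integral_cplx_conj (u : fn R) : integrable_cplx u ->
  (integral_cplx setT u)^*%R = integral_cplx setT (fun x => (u x)^*%R).
Proof.
move=> [i1 i2]; apply: complex_ext; rewrite !reimE /=.
  by apply: RI_ext => x; rewrite reimE.
by rewrite -RIN//; apply: RI_ext => x; rewrite reimE.
Qed.

End ComplexIntegrals.

(** * The Hilbert space L^2 *)

Section L2.
Context {R : realType}.
Implicit Types (u v w : fn R) (a : R[i]).

Lemma L2_sqint u :
  L2 u <-> sqint (fun x => Re (u x)) /\ sqint (fun x => Im (u x)).
Proof.
split=> [[/[dup] mu_ [m1 m2] uoo]|[[m1 i1] [m2 i2]]].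
  have iu : intg (fun x => normc (u x) ^+ 2).
    apply: RI_ge0_lty => //; first exact: measurable_normc2.
    by move=> x; exact: sqr_ge0.
  split; split=> //; apply: (intg_le _ _ iu) => //; try exact: measurable_funX.
    by move=> x; rewrite ger0_norm ?sqr_ge0// normc_sq lerDl sqr_ge0.
  by move=> x; rewrite ger0_norm ?sqr_ge0// normc_sq lerDr sqr_ge0.
split=> //; have := integrable_lty measurableT (intgD i1 i2).
by under eq_integral do rewrite /= -normc_sq.
Qed.

Lemma L2_measurable u : L2 u -> measurable_cplx u. Proof. by case. Qed.

Lemma L2_normc2 u : L2 u -> intg (fun x => normc (u x) ^+ 2).
Proof.
move=> [mu_ uoo]; apply: RI_ge0_lty => //; first exact: measurable_normc2.
by move=> x; exact: sqr_ge0.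
Qed.

Lemma L2_of_intg u : measurable_cplx u -> intg (fun x => normc (u x) ^+ 2) -> L2 u.
Proof. by move=> mu_ iu; split=> //; exact: (integrable_lty measurableT iu). Qed.

Lemma L2_le u v : measurable_cplx u -> (forall x, normc (u x) <= normc (v x)) ->
  L2 v -> L2 u.
Proof.
move=> mu_ uv /L2_normc2 iv; apply: L2_of_intg => //.
apply: (intg_le _ _ iv); first exact: measurable_normc2.
by move=> x; rewrite ger0_norm ?sqr_ge0// lerXn2r// nnegrE normc_ge0.
Qed.

Lemma L2_lin a u v : L2 u -> L2 v -> L2 (fun x => a * u x + v x).
Proof.
move=> /L2_sqint[u1 u2] /L2_sqint[v1 v2]; apply/L2_sqint.
split; under eq_fun do rewrite !reimE.
  apply: (@sqint_add _ (fun x => Re a * Re (u x) - Im a * Im (u x))) => //.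
  by apply: sqint_add; [|apply: sqint_opp]; exact: sqint_scale.
apply: (@sqint_add _ (fun x => Re a * Im (u x) + Im a * Re (u x))) => //.
by apply: sqint_add; exact: sqint_scale.
Qed.

Lemma L2_0 : L2 (fun _ : R => 0).
Proof.
apply/L2_sqint; split; (split; first exact: measurable_cst);
 by under eq_fun do rewrite expr0n; exact: intg0.
Qed.

Lemma L2Z a u : L2 u -> L2 (fun x => a * u x).
Proof. by move=> lu; have := L2_lin a lu L2_0; under eq_fun do rewrite addr0. Qed.

Lemma L2B u v : L2 u -> L2 v -> L2 (fun x => u x - v x).
Proof.
by move=> lu lv; have := L2_lin (-1) lv lu; under eq_fun do rewrite mulN1r addrC.
Qed.

Lemma L2_ae u v : measurable_cplx u -> aeq u v -> L2 v -> L2 u.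
Proof.
move=> mu_ uv /L2_normc2 iv; apply: L2_of_intg => //.
apply: (intg_ae _ _ iv); first exact: measurable_normc2.
by apply: ae_mono uv => x ->.
Qed.

Lemma inner_integrable u v : L2 u -> L2 v ->
  integrable_cplx (fun x => (u x)^* * v x).
Proof.
move=> /L2_sqint[u1 u2] /L2_sqint[v1 v2]; split; under eq_fun do rewrite !reimE.
  apply: intgB; first exact: sqint_mul.
  by under eq_fun do rewrite mulNr; apply: intgN; exact: sqint_mul.
apply: intgD; first exact: sqint_mul.
by under eq_fun do rewrite mulNr; apply: intgN; exact: sqint_mul.
Qed.

Lemma inner_measurable u v : measurable_cplx u -> measurable_cplx v ->
  measurable_cplx (fun x => (u x)^* * v x).
Proof. by move=> ? ?; apply: measurable_cplx_mul => //; exact: measurable_cplx_conj. Qed.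

Lemma inner_lin a u v w : L2 u -> L2 v -> L2 w ->
  inner_prod u (fun x => a * v x + w x) = a * inner_prod u v + inner_prod u w.
Proof.
move=> lu lv lw; rewrite -integral_cplx_lin; try exact: inner_integrable.
by congr integral_cplx; apply/funext => x; ring.
Qed.

Lemma inner_conj u v : L2 u -> L2 v -> inner_prod v u = (inner_prod u v)^*.
Proof.
move=> /L2_sqint[u1 u2] /L2_sqint[v1 v2]; apply: complex_ext; rewrite !reimE /=.
  by apply: RI_ext => x; rewrite !reimE; ring.
rewrite -RIN; last first.
  under eq_fun do rewrite !reimE; apply: intgD; first exact: sqint_mul.
  by under eq_fun do rewrite mulNr; apply: intgN; exact: sqint_mul.
by apply: RI_ext => x; rewrite !reimE; ring.
Qed.

Lemma inner_ae u u' v v' : measurable_cplx u -> measurable_cplx u' ->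
  measurable_cplx v -> measurable_cplx v' -> aeq u u' -> aeq v v' ->
  inner_prod u v = inner_prod u' v'.
Proof.
move=> ? ? ? ? uu' vv'; apply: integral_cplx_ae; try exact: inner_measurable.
by move: uu' vv'; apply: ae_mono2 => x -> ->.
Qed.

Lemma norm2_ge0 u : 0 <= norm2 u. Proof. exact: sqrtr_ge0. Qed.

Lemma norm2_sq u : norm2 u ^+ 2 = \int[mu]_x (normc (u x) ^+ 2).
Proof. by rewrite sqr_sqrtr// Rintegral_ge0// => x _; exact: sqr_ge0. Qed.

Lemma inner_self u : inner_prod u u = (norm2 u ^+ 2)%:C.
Proof.
apply: complex_ext; rewrite !reimE ?norm2_sq /=.
  by apply: RI_ext => x; rewrite mulc_conj.
by under RI_ext do rewrite mulc_conj; rewrite Rintegral_cst ?mul0r.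
Qed.

Lemma norm2_ae u v : measurable_cplx u -> measurable_cplx v -> aeq u v ->
  norm2 u = norm2 v.
Proof.
move=> mu_ mv uv; rewrite /norm2; congr Num.sqrt.
apply: RI_ae; try exact: measurable_normc2.
by apply: ae_mono uv => x ->.
Qed.

(** The free complex coefficient serves twice: one choice yields Cauchy-Schwarz, others yield
    polarization for isometries. *)
Lemma norm2_lin a u v : L2 u -> L2 v -> norm2 (fun x => a * u x + v x) ^+ 2 =
  normc a ^+ 2 * norm2 u ^+ 2 + 2 * Re (a^* * inner_prod u v) + norm2 v ^+ 2.
Proof.
move=> lu lv; have lw := L2_lin a lu lv; apply: complexI; rewrite -inner_self.
rewrite inner_lin// (inner_conj lu lw) (inner_conj lv lw) !inner_lin//.
rewrite (inner_conj lu lv) !inner_self.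
by apply: complex_ext; rewrite !reimE ?normc_sq; ring.
Qed.

(** With z = <u, v>, the squared norm of v - t z u is a nonnegative quadratic polynomial in the real
    variable t. *)
Lemma cauchy_schwarz u v : L2 u -> L2 v ->
  normc (inner_prod u v) <= norm2 u * norm2 v.
Proof.
move=> lu lv; set z := inner_prod u v.
have key (t : R) : 0 <= t ^+ 2 * normc z ^+ 2 * norm2 u ^+ 2 - 2 * t * normc z ^+ 2 + norm2 v ^+ 2.
  have := sqr_ge0 (norm2 (fun x => (- t%:C * z) * u x + v x)).
  rewrite norm2_lin// -/z; congr (_ <= _).
  by rewrite !normc_sq !reimE; ring.
rewrite -(@ler_pXn2r _ 2%N)// ?nnegrE ?mulr_ge0 ?norm2_ge0 ?normc_ge0// exprMn.
move: (normc z) key => N key.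
have [u0|u0] := eqVneq (norm2 u) 0.
  rewrite u0 expr0n /= mul0r.
  (* For ||u|| = 0 the polynomial is affine in t; this t would give it the value -1 unless N = 0. *)
  have := key ((norm2 v ^+ 2 + 1) / (2 * N ^+ 2)).
  rewrite u0 expr0n /= mulr0 add0r.
  have [->|z0] := eqVneq N 0; first by rewrite expr0n.
  rewrite (_ : 2 * _ * _ = norm2 v ^+ 2 + 1); last by field.
  by rewrite opprD addrAC addNr add0r ler0N1.
(* The minimum of the polynomial is attained at t = ||u||^(-2). *)
have := key (norm2 u ^+ 2)^-1; rewrite (_ : _ + _ =
  norm2 v ^+ 2 - N ^+ 2 / norm2 u ^+ 2); last by field.
rewrite subr_ge0 ler_pdivrMr; first by rewrite mulrC.
by rewrite exprn_even_gt0.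
Qed.

Lemma norm2_triangle u v : L2 u -> L2 v ->
  norm2 (fun x => u x + v x) <= norm2 u + norm2 v.
Proof.
move=> lu lv; rewrite -(@ler_pXn2r _ 2%N)// ?nnegrE ?addr_ge0 ?norm2_ge0//.
have := norm2_lin 1 lu lv; under eq_fun do rewrite mul1r.
move=> ->; have : Re (inner_prod u v) <= norm2 u * norm2 v.
  by apply: le_trans (cauchy_schwarz lu lv); apply: le_trans (ler_norm _) (Re_le_normc _).
by rewrite normc_sq !reimE /= sqrrD => h; lra.
Qed.

Lemma norm2_opp u : norm2 (fun x => - u x) = norm2 u.
Proof.
by rewrite /norm2; congr Num.sqrt; apply: RI_ext => x; rewrite !normc_sq !reimE !sqrrN.
Qed.

Lemma norm2_sym u v : norm2 (fun x => u x - v x) = norm2 (fun x => v x - u x).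
Proof. by rewrite -norm2_opp; congr norm2; apply/funext => x; rewrite opprB. Qed.

Lemma norm2_triangle3 v u w : L2 u -> L2 v -> L2 w ->
  norm2 (fun x => u x - w x) <=
  norm2 (fun x => u x - v x) + norm2 (fun x => v x - w x).
Proof.
move=> lu lv lw; have := norm2_triangle (L2B lu lv) (L2B lv lw).
by under [X in norm2 X <= _]eq_fun do rewrite addrA subrK.
Qed.

Lemma norm2_dist u v : L2 u -> L2 v ->
  `|norm2 u - norm2 v| <= norm2 (fun x => u x - v x).
Proof.
move=> lu lv; have h (f g : fn R) : L2 f -> L2 g -> norm2 f <= norm2 (fun x => f x - g x) + norm2 g.
  move=> lf lg; have := norm2_triangle (L2B lf lg) lg.
  by under [X in norm2 X <= _]eq_fun do rewrite subrK.
by rewrite ler_norml lerBlDr h// andbT -opprB lerNl opprK lerBlDr norm2_sym h.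
Qed.

Lemma norm2_eq0 u : L2 u -> norm2 u = 0 -> aeq u (fun=> 0).
Proof.
move=> lu u0; have := norm2_sq u; rewrite u0 expr0n => /esym h.
have := RI_eq0_ae (L2_normc2 lu) (fun x => sqr_ge0 _) h.
by apply: ae_mono => x /eqP; rewrite sqrf_eq0 => /eqP/ComplexField.Normc.eq0_normc.
Qed.

Lemma norm2_diff_ae u v : L2 u -> L2 v -> norm2 (fun x => u x - v x) = 0 -> aeq u v.
Proof.
move=> lu lv /(norm2_eq0 (L2B lu lv)).
by apply: ae_mono => x /eqP; rewrite subr_eq0 => /eqP.
Qed.

Lemma norm2_ae0 u v : measurable_cplx u -> measurable_cplx v -> aeq u v ->
  norm2 (fun x => u x - v x) = 0.
Proof.
move=> mu_ mv uv; rewrite (@norm2_ae _ (fun=> 0)).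
- rewrite /norm2 -[RHS]sqrtr0; congr Num.sqrt.
  by under RI_ext do rewrite ComplexField.Normc.normc0 expr0n; rewrite Rintegral_cst ?mul0r.
- by apply: measurable_cplx_add => //; exact: measurable_cplx_opp.
- exact: measurable_cplx_cst.
- by apply: ae_mono uv => x ->; rewrite subrr.
Qed.

End L2.

(** * Isometries, wave operators and the scattering operator *)

Section Operators.
Context {R : realType}.
Implicit Types (u v w : fn R) (a : R[i]) (A : op R).

(** Serves to prove equalities: a distance independent of the parameter is bounded by a quantity
    that tends to 0. *)
Lemma near_le0_of_cvg0 {T : Type} {G : set_system T} {FG : ProperFilter G} (c : R)
  (g : T -> R) : (\forall x \near G, c <= g x) -> g x @[x --> G] --> 0 -> c <= 0.
Proof.
move=> cg /cvgr0Pnorm_lt g0; rewrite leNgt; apply/negP => c0.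
have [x [cx gx]] := filter_ex (filterI cg (g0 c c0)).
by move: gx; rewrite ltNge (le_trans cx)// ler_norm.
Qed.

Lemma le0_of_cvg0 {T : Type} {G : set_system T} {FG : ProperFilter G} (c : R)
  (g : T -> R) : (forall x, c <= g x) -> g x @[x --> G] --> 0 -> c <= 0.
Proof. by move=> cg; apply: near_le0_of_cvg0; exact: nearW. Qed.

Lemma cvg0_squeeze {T : Type} {G : set_system T} {FG : Filter G} (g h : T -> R) :
  (forall x, `|g x| <= h x) -> h x @[x --> G] --> 0 -> g x @[x --> G] --> 0.
Proof.
move=> gh /cvgr0Pnorm_lt h0; apply/cvgr0Pnorm_lt => e e0.
near=> x; apply: le_lt_trans (gh x) _.
by apply: le_lt_trans (ler_norm _) _; near: x; exact: h0.
Unshelve. all: by end_near. Qed.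

Lemma cvg0D {T : Type} {G : set_system T} {FG : Filter G} (g h : T -> R) :
  g x @[x --> G] --> 0 -> h x @[x --> G] --> 0 -> (g x + h x) @[x --> G] --> 0.
Proof. by move=> g0 h0; rewrite -[0]addr0; exact: cvgD. Qed.

Lemma bounded_L2 A u : bounded_op A -> L2 u -> L2 (A u).
Proof. by case=> h _ _; exact: h. Qed.

Lemma bounded_B A u v : bounded_op A -> L2 u -> L2 v ->
  aeq (A (fun x => u x - v x)) (fun x => A u x - A v x).
Proof.
move=> [h1 h2 _] lu lv; have := h2 (-1) v u lv lu.
have -> : (fun x => u x - v x) = (fun x => -1 * v x + u x).
  by apply/funext => x; rewrite mulN1r addrC.
by apply: ae_mono => x ->; rewrite mulN1r addrC.
Qed.

Lemma bounded_aeq A u v : bounded_op A -> L2 u -> L2 v -> aeq u v ->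
  aeq (A u) (A v).
Proof.
move=> bA lu lv uv; have [h1 h2 [c hc]] := bA.
apply: norm2_diff_ae; try exact: h1.
rewrite -(norm2_ae _ _ (bounded_B bA lu lv)).
- by apply/eqP; rewrite eq_le norm2_ge0 andbT (le_trans (hc _ (L2B lu lv)))//
    norm2_ae0 ?mulr0//; apply: L2_measurable.
- by apply: L2_measurable; apply: h1; exact: L2B.
- by apply: L2_measurable; apply: L2B; exact: h1.
Qed.

(** Surjectivity is left out, as the wave operators need not be onto. *)
Definition isometric_op A := bounded_op A /\ forall u, L2 u -> norm2 (A u) = norm2 u.

Lemma unitary_isometric A : unitary_op A -> isometric_op A.
Proof. by case. Qed.

Lemma isometric_dist A u v : isometric_op A -> L2 u -> L2 v ->
  norm2 (fun x => A u x - A v x) = norm2 (fun x => u x - v x).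
Proof.
move=> [bA iA] lu lv; rewrite -(iA _ (L2B lu lv)); apply/esym/norm2_ae.
- by apply/L2_measurable/bounded_L2 => //; exact: L2B.
- by apply/L2_measurable/L2B; exact: bounded_L2.
- exact: bounded_B.
Qed.

(** Polarization: the norm of a u + v determines the real part of a^* <u, v>, for every complex
    a. *)
Lemma isometric_inner A u v : isometric_op A -> L2 u -> L2 v ->
  inner_prod (A u) (A v) = inner_prod u v.
Proof.
move=> [bA iA] lu lv; have lAu := bounded_L2 bA lu; have lAv := bounded_L2 bA lv.
have key a : Re (a^* * inner_prod (A u) (A v)) = Re (a^* * inner_prod u v).
  have := norm2_lin a lu lv; rewrite -(iA _ (L2_lin a lu lv)).
  rewrite (norm2_ae _ _ (_ : aeq _ (fun x => a * A u x + A v x))).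
  - by rewrite norm2_lin// !iA// => h; lra.
  - by apply/L2_measurable/bounded_L2 => //; exact: L2_lin.
  - by apply/L2_measurable/L2_lin.
  - by case: bA => _ /(_ a u v lu lv).
move: (inner_prod (A u) (A v)) (inner_prod u v) key => z w key.
(* The coefficients a = 1 and a = i give the real and the imaginary part. *)
apply: complex_ext; first by have := key 1; rewrite !reimE /=; lra.
by have := key (0 +i* 1); rewrite !reimE /= !mul0r; lra.
Qed.

Lemma normc_expi (x : R) : normc (expi x) = 1.
Proof. by rewrite /normc /= cos2Dsin2 sqrtr1. Qed.

Lemma expiD (x y : R) : expi (x + y) = expi x * expi y.
Proof. by apply: complex_ext; rewrite !reimE /= ?cosD ?sinD; ring. Qed.

Lemma measurable_expi (g : R -> R) : measurable_fun setT g ->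
  measurable_cplx (fun x => expi (g x)).
Proof.
move=> mg; split => /=.
  by apply: (measurableT_comp _ mg); apply: continuous_measurable_fun; exact: continuous_cos.
by apply: (measurableT_comp _ mg); apply: continuous_measurable_fun; exact: continuous_sin.
Qed.

Lemma L2_free_evolution t u : L2 u -> L2 (free_evolution t u).
Proof.
move=> lu; apply: (L2_le _ _ lu).
  apply: measurable_cplx_mul; last exact: L2_measurable.
  by apply: measurable_expi; apply: measurable_funN; exact: measurable_funM.
by move=> x; rewrite /free_evolution ComplexField.Normc.normcM normc_expi mul1r.
Qed.

Lemma norm2_free_evolution t u : norm2 (free_evolution t u) = norm2 u.
Proof.
rewrite /norm2; congr Num.sqrt; apply: RI_ext => x.
by rewrite /free_evolution ComplexField.Normc.normcM normc_expi mul1r.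
Qed.

Lemma free_evolutionD s t u : free_evolution (s + t) u = free_evolution s (free_evolution t u).
Proof.
apply/funext => x; rewrite /free_evolution mulrA -expiD.
by congr (expi _ * _); ring.
Qed.

End Operators.

Lemma pinfty_shift {R : realType} (c : R) : (fun x => x + c) @ +oo --> +oo.
Proof.
move=> P [M [_ MP]]; exists (M - c); split; first exact: num_real.
by move=> x xM; apply: MP; rewrite -ltrBlDr.
Qed.

Lemma ninfty_shift {R : realType} (c : R) : (fun x => x + c) @ -oo --> -oo.
Proof.
move=> P [M [_ MP]]; exists (M - c); split; first exact: num_real.
by move=> x xM; apply: MP; rewrite -ltrBrDr.
Qed.

(** * Wave operators: isometry, intertwining, scattering operator *)

Section WaveOperators.
Context {R : realType}.
Variables (D : set (fn R)) (H : op R) (U : R -> op R).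
Hypothesis hU : evolution_group D H U.
Implicit Types (u v w : fn R) (W : op R).

Let isoU t : isometric_op (U t).
Proof. by apply: unitary_isometric; case: hU. Qed.

(** The difference of the norms of W u and u does not depend on t, and is at most the distance from
    W u to e^(itH) e^(-itQ) u, which tends to 0. *)
Lemma wave_isometric (T : set_system R) {FT : ProperFilter T} W :
  wave_operator U T W -> isometric_op W.
Proof.
move=> [bW hW]; split => // u lu.
have lWu := bounded_L2 bW lu.
apply/eqP; rewrite -subr_eq0 -normr_le0.
apply: (le0_of_cvg0 _ (hW u lu)) => t.
have [bU iU] := isoU (- t).
rewrite -(norm2_free_evolution t u) -(iU _ (L2_free_evolution t lu)) distrC.
by apply: norm2_dist => //; apply: bounded_L2 => //; exact: L2_free_evolution.
Qed.

(** Inserting the limit, e^(-itH) W u = lim_s e^(i(s-t)H) e^(-i(s-t)Q) e^(-itQ) u. The filter [T] is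
    invariant under translations, so s - t may replace s in the limit, which is then W e^(-itQ)
    u. *)
Lemma wave_intertwine (T : set_system R) {FT : ProperFilter T} W t u :
  (forall c : R, (fun x => x + c) @ T --> T) ->
  wave_operator U T W -> L2 u ->
  aeq (U t (W u)) (W (free_evolution t u)).
Proof.
move=> sT [bW hW] lu; have [bU iU] := isoU t.
have lW := bounded_L2 bW lu; have lf := L2_free_evolution t lu.
apply: norm2_diff_ae; [exact: bounded_L2|exact: bounded_L2|].
apply/eqP; rewrite eq_le norm2_ge0 andbT.
have h1 := hW u lu.
have h2 : norm2 (fun x => U (- (s - t)) (free_evolution (s - t) (free_evolution t u)) x -
    W (free_evolution t u) x) @[s --> T] --> (0 : R).
  exact: (cvg_comp _ _ (sT (- t)) (hW _ lf)).
have FF : Filter T by typeclasses eauto.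
have h := @cvg0D _ _ _ FF _ _ h1 h2.
apply: (le0_of_cvg0 _ h) => s /=.
have [bs _] := isoU (- s); have [bst _] := isoU (- (s - t)).
have ls : L2 (U (- s) (free_evolution s u)).
  by apply: bounded_L2 => //; exact: L2_free_evolution.
rewrite [X in _ <= X + _]norm2_sym -(isometric_dist (isoU t) lW ls).
have E : aeq (U t (U (- s) (free_evolution s u)))
   (U (- (s - t)) (free_evolution (s - t) (free_evolution t u))).
  rewrite -free_evolutionD subrK; apply: aeq_sym.
  have -> : - (s - t) = t + - s by ring.
  by case: hU => _ + _ _; apply; exact: L2_free_evolution.
have lst : L2 (U (- (s - t)) (free_evolution (s - t) (free_evolution t u))).
  by apply: bounded_L2 => //; exact: L2_free_evolution.
have lts : L2 (U t (U (- s) (free_evolution s u))) by exact: bounded_L2.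
rewrite [X in _ <= X + _](@norm2_ae _ _ (fun x => U t (W u) x -
   U (- (s - t)) (free_evolution (s - t) (free_evolution t u)) x)).
- by apply: norm2_triangle3 => //; exact: bounded_L2.
- by apply/L2_measurable/L2B => //; exact: bounded_L2.
- by apply/L2_measurable/L2B => //; exact: bounded_L2.
- by apply: ae_mono E => x ->.
Qed.

(** Continuity at 0 is carried to t by U s - U t = U t (U (s - t) - 1), with U t isometric. *)
Lemma strongly_continuous u : L2 u -> forall t,
  norm2 (fun x => U s u x - U t u x) @[s --> t] --> (0 : R).
Proof.
move=> lu t; have [_ h1 h2 _] := hU.
have h : norm2 (fun x => U (s - t) u x - u x) @[s --> t] --> (0 : R).
  have st : (s - t) @[s --> t] --> (0 : R).
    by rewrite -(subrr t); apply: cvgB; [exact: cvg_id|exact: cvg_cst].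
  exact: (cvg_comp _ _ st (h2 u lu)).
apply: cvg0_squeeze h => s; rewrite ger0_norm ?norm2_ge0//.
have l1 s' v : L2 v -> L2 (U s' v) by move=> lv; apply: bounded_L2 => //; case: (isoU s').
rewrite -(isometric_dist (isoU t) (l1 _ _ lu) lu).
rewrite (@norm2_ae _ _ (fun x => U t (U (s - t) u) x - U t u x))//.
- by apply/L2_measurable/L2B; exact: l1.
- by apply/L2_measurable/L2B; apply: (l1) => //; exact: l1.
- by have := h1 t (s - t) u lu; rewrite addrC subrK; apply: ae_mono => x ->.
Qed.

Variable E : set R -> op R.

(** By completeness the wave operators have the same range, so W- u = W+ w for some w. As W+ is
    isometric, <W+ u', W- u> = <u', w> for all u', so w is the vector that the adjoint of W+ assigns
    to W- u. *)
Lemma scattering_spec Wp Wm u : isometric_op Wp -> isometric_op Wm ->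
  complete_wave_operator E Wp -> complete_wave_operator E Wm -> L2 u ->
  let S := scattering_operator Wp Wm in
  [/\ L2 (S u), aeq (Wp (S u)) (Wm u) & norm2 (S u) = norm2 u].
Proof.
move=> [bp ip] [bm im] cp cm lu S.
have lWm := bounded_L2 bm lu.
have [w lw Ew] : exists2 w, L2 w & aeq (Wp w) (Wm u).
  by apply/(cp _ lWm)/(cm _ lWm); exists u => //; exact: aeq_refl.
pose P := [set w : fn R | L2 w /\
    forall u', L2 u' -> inner_prod (Wp u') (Wm u) = inner_prod u' w].
have Pw : P w.
  split => // u' lu'; rewrite -(isometric_inner (conj bp ip) lu' lw).
  apply: inner_ae (aeq_refl _) (aeq_sym Ew); apply: L2_measurable => //;
  exact: bounded_L2.
(* The witness [w] ensures that the choice in [op_adjoint] is not the default value 0. *)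
have [lS hS] : P (S u) by apply: xgetI Pw.
(* Both vectors represent the same functional; testing it on their difference gives ||S u - w||^2 =
   0. *)
have SW : aeq (S u) w.
  apply: norm2_diff_ae => //; have lB := L2B lS lw.
  apply/eqP; rewrite -sqrf_eq0; apply/eqP/complexI; rewrite -inner_self.
  have := hS _ lB; rewrite (Pw.2 _ lB) => E0.
  have -> : (fun x => S u x - w x) = (fun x => -1 * w x + S u x).
    by apply/funext => x; rewrite mulN1r addrC.
  rewrite inner_lin//; last by apply: L2_lin.
  move: E0; have -> : (fun x => S u x - w x) = (fun x => -1 * w x + S u x).
    by apply/funext => x; rewrite mulN1r addrC.
  by move=> <-; rewrite mulN1r addNr.
have SWm : aeq (Wp (S u)) (Wm u).
  by apply: aeq_trans Ew; exact: bounded_aeq.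
split=> //; rewrite -(ip _ lS) -(im _ lu); apply: norm2_ae => //;
  apply: L2_measurable => //; exact: bounded_L2.
Qed.

End WaveOperators.

(** * Functions of the momentum *)

Section FunMomentum.
Context {R : realType}.
Variable F : op R.
Hypothesis uF : unitary_op F.
Implicit Types (u v w h : fn R).

(** [F] is onto, so [h] has a preimage and the choice in [op_inverse] is not the default value. *)
Lemma fun_momentum_spec (g : R -> R[i]) r u h :
  aeq (fun k => g (k / r) * F u k) h -> L2 h ->
  L2 (fun_momentum F g r u) /\ aeq (F (fun_momentum F g r u)) h.
Proof.
move=> gh lh; have [_ _ /(_ _ lh) [w lw Fw]] := uF.
pose P := [set w : fn R | L2 w /\ aeq (F w) (fun k => g (k / r) * F u k)].
have : P (fun_momentum F g r u).
  have Pw : P w by split => //; apply: aeq_trans Fw (aeq_sym gh).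
  exact: xgetI Pw.
by case=> ? hh; split => //; exact: aeq_trans gh.
Qed.

(** Both choices are made in the same set, so the resulting functions are identical and not merely
    equal almost everywhere. *)
Lemma fun_momentum_ext (g1 g2 : R -> R[i]) r u :
  {ae (@mu R), forall k, g1 (k / r) = g2 (k / r)} ->
  fun_momentum F g1 r u = fun_momentum F g2 r u.
Proof.
move=> gg; rewrite /fun_momentum /op_inverse; congr xget.
apply/seteqP; split => w [lw ae_w]; split => //; apply: aeq_trans ae_w _;
by apply: ae_mono gg => x ->.
Qed.

End FunMomentum.

(** * Averages over dilated profiles *)

Section AffineChange.
Context {R : realType}.

Lemma lebesgue_measure_translate (c : R) (A : set R) : measurable A ->
  pushforward mu ((fun x => x + c) : _ -> measurableTypeR R) A = mu A.
Proof.
move=> mA; apply/esym/lebesgue_measure_unique => //=.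
  exact: measurable_funD.
move=> _ _ [[a b]] _ <-; rewrite /pushforward /=.
have -> : (fun x : R => x + c) @^-1` `]a, b] = `]a - c, b - c]%classic.
  by apply/seteqP; split => x /=; rewrite !in_itv /= ltrBlDr lerBrDr.
rewrite !lebesgue_measure_itv/= !lte_fin ltrD2r.
by case: ifP => // _; rewrite -!EFinB; congr EFin; ring.
Qed.

(** The preimage of an interval under x -> x c is shorter by the factor c, which the coefficient
    compensates; half-open intervals determine the measure. *)
Lemma lebesgue_measure_scale (c : R) (A : set R) : 0 < c -> measurable A ->
  (c%:E * pushforward mu ((fun x => (x * c)%R) : R -> measurableTypeR R) A)%E = mu A.
Proof.
move=> c0 mA; have mp : measurable_fun setT ((fun x : R => x * c) : _ -> measurableTypeR R).
  exact: measurable_funM.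
pose m : {measure set _ -> \bar R} :=
  measure_function_pushforward__canonical__measure_function_Measure mu mp.
apply/esym; rewrite -[RHS]/(mscale (NngNum (ltW c0)) m A).
apply: lebesgue_measure_unique => //= _ [[a b]] _ <-.
rewrite /mscale /= /pushforward /=.
have -> : (fun x : R => x * c) @^-1` `]a, b] = `]a / c, b / c]%classic.
  by apply/seteqP; split => x /=; rewrite !in_itv /= ltr_pdivrMr// ler_pdivlMr.
rewrite !lebesgue_measure_itv/= !lte_fin ltr_pM2r ?invr_gt0//.
case: ifP => // _; last by rewrite mule0.
by rewrite -!EFinB -EFinM; congr EFin; field; rewrite gt_eqF.
Qed.

Lemma ae_translate (c : R) (P : R -> Prop) : {ae (@mu R), forall x, P x} ->
  {ae (@mu R), forall x, P (x + c)}.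
Proof.
move=> [A [mA A0 PA]]; exists ((fun x => x + c) @^-1` A); split.
- rewrite -[X in measurable X]setTI.
  have mp : measurable_fun setT (fun x : R => x + c) by exact: measurable_funD.
  exact: mp.
- by move: A0; rewrite -(lebesgue_measure_translate c mA).
- by move=> x /= nP; apply: PA.
Qed.

Lemma ae_scale (r : R) (P : R -> Prop) : 0 < r -> {ae (@mu R), forall x, P x} ->
  {ae (@mu R), forall x, P (x / r)}.
Proof.
move=> r0 [A [mA A0 PA]]; exists ((fun x => x / r) @^-1` A); split.
- rewrite -[X in measurable X]setTI.
  have mp : measurable_fun setT (fun x : R => x / r) by exact: measurable_funM.
  exact: mp.
- have c0 : 0 < r^-1 by rewrite invr_gt0.
  move: A0; rewrite -(lebesgue_measure_scale c0 mA) /pushforward /=.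
  by move/eqP; rewrite mule_eq0 eqe invr_eq0 gt_eqF//= => /eqP.
- by move=> x /= nP; apply: PA.
Qed.

Lemma ge0_integral_translate (c : R) (f : R -> \bar R) : measurable_fun setT f ->
  (forall x, 0 <= f x)%E -> (\int[@mu R]_x f (x + c)%R = \int[@mu R]_x f x)%E.
Proof.
move=> mf f0.
have mp : measurable_fun setT ((fun x : R => x + c) : _ -> measurableTypeR R).
  exact: measurable_funD.
have := @ge0_integral_pushforward _ _ (measurableTypeR R) (measurableTypeR R) R _ mp
  (@mu R) setT f.
rewrite preimage_setT => <-//.
by apply: eq_measure_integral => A mA _; exact: lebesgue_measure_translate.
Qed.

Lemma ge0_integral_reflect (f : R -> \bar R) : measurable_fun setT f ->
  (forall x, 0 <= f x)%E -> (\int[@mu R]_x f (- x)%R = \int[@mu R]_x f x)%E.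
Proof.
move=> mf f0.
have mp : measurable_fun setT (-%R : _ -> measurableTypeR R) by exact: oppr_measurable.
have := @ge0_integral_pushforward _ _ (measurableTypeR R) (measurableTypeR R) R _ mp
  (@mu R) setT f.
rewrite preimage_setT => <-//.
by apply: eq_measure_integral => A mA _; exact: lebesgue_measureN.
Qed.

End AffineChange.

(** * Integrability of power decay *)

Section PowerTail.
Context {R : realType}.

Lemma powR_cvg_pinfty0 (p : R) : 0 < p -> x `^ (- p) @[x --> +oo] --> (0 : R).
Proof.
move=> p0; apply/cvgr0Pnorm_lt => e e0.
exists ((e^-1) `^ (p^-1)); split; first exact: num_real.
move=> x ex; have x0 : 0 < x by apply: le_lt_trans ex; exact: powR_ge0.
rewrite ger0_norm ?powR_ge0// powRN invf_plt ?posrE ?powR_gt0//.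
have -> : e^-1 = (e^-1 `^ p^-1) `^ p.
  by rewrite -powRrM mulVf ?gt_eqF// powRr1// invr_ge0 ltW.
by apply: gt0_ltr_powR => //; rewrite nnegrE ?powR_ge0// ltW.
Qed.

Lemma powR_tail_integrable (p : R) : 1 < p ->
  (@mu R).-integrable `[1, +oo[ (EFin \o (fun x => x `^ (- p))).
Proof.
move=> p1; have p1' : 1 - p != 0 by rewrite subr_eq0 lt_eqF.
have mf : measurable_fun setT (fun x : R => x `^ (- p)) by exact: measurable_powR.
apply/integrableP; split; first by apply/measurable_EFinP; exact: measurable_funTS.
(* The antiderivative of x^(-p) that vanishes at infinity, as p > 1. *)
pose F (x : R) := (1 - p)^-1 * x `^ (1 - p).
have dF (x : R) : 1 <= x -> is_derive x 1 F (x `^ (- p)).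
  move=> x1; have x0 : 0 < x by rewrite (lt_le_trans _ x1).
  have := is_deriveZ (1 - p)^-1 (is_derive1_powR (1 - p) x0).
  by move=> h; apply: (is_derive_eq h); rewrite /GRing.scale /= mulrA mulVf// mul1r;
    congr (_ `^ _); ring.
have cf (x : R) : 1 <= x -> {for x, continuous (fun x : R => x `^ (- p))}.
  move=> x1; have x0 : 0 < x by rewrite (lt_le_trans _ x1).
  by apply/differentiable_continuous/derivable1_diffP; case: (is_derive1_powR (- p) x0).
under eq_integral do rewrite /= ger0_norm ?powR_ge0//.
rewrite (@ge0_continuous_FTC2y _ _ F 1 0); first exact: ltry.
- by move=> x _; exact: powR_ge0.
- apply: continuous_in_subspaceT => x; rewrite inE/= in_itv/= andbT; exact: cf.
- rewrite -(mulr0 (1 - p)^-1); apply: cvgMr.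
  have -> : 1 - p = - (p - 1) by ring.
  by apply: powR_cvg_pinfty0; rewrite subr_gt0.
- by move=> x /ltW /dF [].
- apply: cvg_at_right_filter; apply/differentiable_continuous/derivable1_diffP.
  by case: (dF 1 (lexx _)).
- move=> x; rewrite in_itv/= andbT => /ltW /dF h.
  by rewrite derive1E; exact: derive_val.
Qed.

Lemma intg_reflect (f : R -> R) : (forall x, 0 <= f x) -> intg f ->
  intg (fun x => f (- x)).
Proof.
move=> f0 /[dup] fi /intg_measurable mf.
apply: RI_ge0_lty => //; first exact: (measurableT_comp mf).
rewrite (ge0_integral_reflect (f := EFin \o f)) /=; last 2 first.
- exact/measurable_EFinP.
- by move=> x; rewrite lee_fin.
exact: (integrable_lty _ fi).
Qed.

(** For p > 0 this is 1 when |x| < 1 and |x|^(-p) when |x| > 1; the overlap at |x| = 1 is a null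
    set. *)
Definition power_tail (p x : R) : R :=
  \1_`[-1, 1] x + (\1_`[1, +oo[ x * x `^ (- p) + \1_`[1, +oo[ (- x) * (- x) `^ (- p)).

Lemma intg_power_tail p : 1 < p -> intg (power_tail p).
Proof.
move=> p1; have h : intg (fun x : R => \1_`[1, +oo[ x * x `^ (- p)).
  have := powR_tail_integrable p1.
  rewrite integrable_mkcond//; apply: eq_integrable => // x _.
  rewrite patchE /= indicE; case: ifPn; by rewrite ?mul1r ?mul0r.
apply: intgD; first exact: integrable_indic_itv.
apply: intgD => //; apply: (@intg_reflect (fun x => \1_`[1, +oo[ x * x `^ (- p))) => //.
by move=> x; rewrite mulr_ge0// powR_ge0.
Qed.

Lemma japanese_ge (x : R) : 1 <= japanese x /\ `|x| <= japanese x.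
Proof.
split; first by rewrite -{1}sqrtr1 ler_wsqrtr// lerDl sqr_ge0.
by rewrite -sqrtr_sqr ler_wsqrtr// lerDr.
Qed.

(** For |x| <= 1 the bound <x/r> >= 1 suffices. For |x| > 1 the bound <x/r> >= |x|/r costs the
    factor r^p; the sum 1 + r^p covers both cases. *)
Lemma japanese_powR_le (p r x : R) : 0 < p -> 0 < r ->
  japanese (x / r) `^ (- p) <= (1 + r `^ p) * power_tail p x.
Proof.
move=> p0 r0; have [j1 jx] := japanese_ge (x / r).
have j0 : 0 < japanese (x / r) by rewrite (lt_le_trans _ j1).
have J1 : japanese (x / r) `^ (- p) <= 1.
  rewrite powRN invf_le1 ?powR_gt0//.
  have -> : 1 = 1 `^ p :> R by rewrite powR1.
  by apply: ge0_ler_powR => //; [exact: ltW|rewrite nnegrE|rewrite nnegrE ltW].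
have rp : 0 < r `^ p by exact: powR_gt0.
have key y : 1 <= y -> `|x| = y -> japanese (x / r) `^ (- p) <= (1 + r `^ p) * y `^ (- p).
  move=> y1 xy; have y0 : 0 < y by rewrite (lt_le_trans _ y1).
  have : y / r <= japanese (x / r).
    by move: jx; rewrite normrM xy normfV (gtr0_norm r0).
  move=> h; have : (y / r) `^ p <= japanese (x / r) `^ p.
    by apply: ge0_ler_powR => //; [exact: ltW|rewrite nnegrE divr_ge0// ltW|rewrite nnegrE ltW].
  have E : (y / r) `^ p * r `^ p = y `^ p.
    rewrite -powRM; [|by rewrite divr_ge0// ltW|exact: ltW].
    by congr (_ `^ _); field; rewrite gt_eqF.
  rewrite -(ler_pM2r rp) E => h2.
  apply: (@le_trans _ _ (r `^ p * y `^ (- p))).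
    rewrite !powRN ler_pdivlMr ?powR_gt0// mulrC ler_pdivrMr ?powR_gt0//.
    by rewrite [leRHS]mulrC.
  by rewrite ler_wpM2r ?powR_ge0// lerDr.
have itvE (y : R) : \1_`[1, +oo[ y = (1 <= y)%R%:R :> R.
  by rewrite indicE mem_setE in_itv /= andbT.
have c0 : 0 <= 1 + r `^ p by rewrite addr_ge0// ltW.
rewrite /power_tail !itvE indicE mem_setE in_itv /= -ler_norml.
have [x1|x1] := leP `|x| 1.
  set Q := (_ * x `^ _ + _).
  have Q0 : 0 <= Q by rewrite addr_ge0// mulr_ge0// powR_ge0.
  apply: (le_trans J1); rewrite /= -[leLHS]mulr1.
  by apply: ler_pM => //; [rewrite lerDl ltW|rewrite lerDl].
rewrite mulr0n add0r; move: x1; rewrite lter_normr => /orP[x1|x1].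
  rewrite (ltW x1) mul1r (le_trans (key x (ltW x1) _))//.
    by rewrite gtr0_norm// (lt_trans _ x1).
  by apply: ler_wpM2l => //; rewrite lerDl mulr_ge0// powR_ge0.
rewrite (ltW x1) mul1r (le_trans (key (- x) (ltW x1) _))//.
  by rewrite -normrN gtr0_norm// (lt_trans _ x1).
by apply: ler_wpM2l => //; rewrite lerDr mulr_ge0// powR_ge0.
Qed.

End PowerTail.

(** * Limits and exchange of integrals *)

Section DominatedConvergence.
Context {R : realType}.
Local Notation mfun f := (measurable_fun [set: R] f).

Lemma RI_dominated (f_ : nat -> R -> R) (f h : R -> R) :
  (forall n, mfun (f_ n)) -> mfun f ->
  (forall x, f_ n x @[n --> \oo] --> f x) -> intg h ->
  (forall n x, `|f_ n x| <= h x) ->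
  \int[mu]_x f_ n x @[n --> \oo] --> \int[mu]_x f x.
Proof.
move=> mf_ mf cf hi fh.
have [] := @dominated_convergence _ _ _ (@mu R) setT measurableT
  (fun n => EFin \o f_ n) (EFin \o f) (EFin \o h).
- by move=> n; apply/measurable_EFinP; exact: mf_.
- exact/measurable_EFinP.
- by apply: ae_all => x _ /=; apply: cvg_EFin; [exact: nearW|exact: cf].
- exact: hi.
- by apply: ae_all => x n _ /=; rewrite lee_fin.
move=> fi _ cvI; apply: fine_cvg.
by rewrite /Rintegral /= fineK ?(integrable_fin_num measurableT fi).
Qed.

(** Dilated profiles g(k/r) are controlled only for r > 0. Replacing r by max(r, 1) changes nothing
    near infinity and makes every test sequence positive. *)
Lemma cvg_pinfty_pos_seq (f : R -> R) (l : R) :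
  (forall u : nat -> R, (forall n, 0 < u n) -> u n @[n --> \oo] --> +oo ->
     f (u n) @[n --> \oo] --> l) ->
  f r @[r --> +oo] --> l.
Proof.
move=> hf; pose f' r := f (Num.max r 1).
have : f' r @[r --> +oo] --> l.
  apply/cvg_pinftyP => u uoo; apply: (hf (fun n => Num.max (u n) 1)).
    by move=> n; rewrite lt_max ltr01 orbT.
  apply/cvgryPge => A; move/cvgryPge : uoo => /(_ A).
  by apply: filterS => n Au; rewrite le_max Au.
apply: cvg_trans; apply: near_eq_cvg; exists 1; split; first exact: num_real.
by move=> r r1; rewrite /f' max_l// ltW.
Qed.

Lemma RI_dominated_pinfty (f_ : R -> R -> R) (f h : R -> R) :
  (forall r, 0 < r -> mfun (f_ r)) -> mfun f ->
  (forall x, f_ r x @[r --> +oo] --> f x) -> intg h ->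
  (forall r x, 0 < r -> `|f_ r x| <= h x) ->
  \int[mu]_x f_ r x @[r --> +oo] --> \int[mu]_x f x.
Proof.
move=> mf_ mf cf hi fh.
apply: (@cvg_pinfty_pos_seq (fun r => \int[mu]_x f_ r x)) => u u0 uoo.
apply: (RI_dominated _ mf _ hi) => [n|x|n x]; [exact: mf_| |exact: fh].
by move/cvg_pinftyP : (cf x); exact.
Qed.

(** A real-valued integral is 0 by default when the extended one is infinite, so every slice has to
    be integrable. The majorant [h] makes one iterated integral finite, and Tonelli passes this on
    to the other. *)
Lemma RI_tonelli (f : R -> R -> R) (h : R -> R) :
  measurable_fun setT (fun p : R * R => f p.1 p.2) ->
  (forall x y, 0 <= f x y) -> (forall x, intg (f x)) -> (forall y, intg (f^~ y)) ->
  intg h -> (forall y, \int[mu]_x f x y <= h y) ->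
  [/\ intg (fun x => \int[mu]_y f x y), intg (fun y => \int[mu]_x f x y) &
      \int[mu]_x \int[mu]_y f x y = \int[mu]_y \int[mu]_x f x y].
Proof.
move=> mf f0 fx fy hi fh.
pose F (p : R * R) := (f p.1 p.2)%:E.
have mF : measurable_fun setT F by exact/measurable_EFinP.
have F0 p : (0 <= F p)%E by rewrite lee_fin.
have Ex x : ((\int[mu]_y f x y)%:E = \int[mu]_y F (x, y))%E.
  by rewrite fineK// (integrable_fin_num measurableT (fx x)).
have Ey y : ((\int[mu]_x f x y)%:E = \int[mu]_x F (x, y))%E.
  by rewrite fineK// (integrable_fin_num measurableT (fy y)).
have iy : intg (fun y => \int[mu]_x f x y).
  apply: (intg_le _ _ hi) => [|y]; last by rewrite ger0_norm// Rintegral_ge0.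
  apply/measurable_EFinP; rewrite (_ : _ \o _ = fun y => (\int[mu]_x F (x, y))%E).
    exact: (@measurable_fun_fubini_tonelli_G _ _ (measurableTypeR R)
      (measurableTypeR R) R (@mu R) F mF F0).
  by apply/funext => y /=; rewrite Ey.
have T := @fubini_tonelli _ _ (measurableTypeR R) (measurableTypeR R) _ (@mu R) (@mu R) F mF F0.
have E : (\int[mu]_x (\int[mu]_y f x y)%:E = \int[mu]_y (\int[mu]_x f x y)%:E)%E.
  by under eq_integral do rewrite Ex; rewrite T; under [RHS]eq_integral do rewrite Ey.
split; [|exact: iy|by rewrite [LHS]/Rintegral E].
apply: RI_ge0_lty.
- apply/measurable_EFinP; rewrite (_ : _ \o _ = fun x => (\int[mu]_y F (x, y))%E).
    exact: (@measurable_fun_fubini_tonelli_F _ _ (measurableTypeR R)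
      (measurableTypeR R) R (@mu R) F mF F0).
  by apply/funext => x /=; rewrite Ex.
- by move=> x; rewrite Rintegral_ge0.
- by rewrite E; exact: (integrable_lty measurableT iy).
Qed.

Lemma intg_flip (c : R) (f : R -> R) : (forall x, 0 <= f x) -> intg f ->
  intg (fun x => f (c - x)) /\ \int[mu]_x f (c - x) = \int[mu]_x f x.
Proof.
move=> f0 /[dup] fi /intg_measurable mf.
have E : (\int[@mu R]_x (f (c - x)%R)%:E = \int[@mu R]_x (f x)%:E)%E.
  have := @ge0_integral_reflect R (fun x => (f (c + x))%:E); rewrite /= => ->.
  - under eq_integral do rewrite addrC.
    rewrite (@ge0_integral_translate R c (EFin \o f))//; exact/measurable_EFinP.
  - by apply/measurable_EFinP; apply: (measurableT_comp mf); exact: measurable_funD.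
  - by move=> x; rewrite lee_fin.
split; last by rewrite /Rintegral E.
apply: RI_ge0_lty => //; last by rewrite E (integrable_lty _ fi).
by apply: (measurableT_comp mf); exact: measurable_funB.
Qed.

End DominatedConvergence.

(** * Free motion: dilated averages over positive times *)

Section FreeTime.
Context {R : realType}.
Local Notation mfun f := (measurable_fun [set: R] f).
Variables (g : R -> R) (M d : R).
Hypotheses (g_meas : mfun g) (g_ge0 : forall x, 0 <= g x) (g_le : forall x, g x <= M).
Hypothesis g_int : forall r : R, 0 < r -> intg (fun x : R => g (x / r)).
Hypotheses (d_gt0 : 0 < d) (g1 : forall x, `|x| < d -> g x = 1).

Let M_ge0 : 0 <= M. Proof. exact: le_trans (g_ge0 0) (g_le 0). Qed.

Lemma intg_mul_bounded (h f : R -> R) (B : R) : mfun h -> (forall x, 0 <= h x <= B) ->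
  intg f -> intg (fun x => h x * f x).
Proof.
move=> mh hB /[dup] fi /intg_measurable mf.
apply: (intg_le _ _ (intgZ B (intg_abs fi))); first exact: measurable_funM.
by move=> x; rewrite normrM ler_wpM2r// ger0_norm; case/andP: (hB x).
Qed.

Lemma measurable_fun_scaled r : mfun (fun x => g (x / r)).
Proof. by apply: (measurableT_comp g_meas); exact: measurable_funM. Qed.

(** The substitution x = k - t gives \int g((k - t)/r) dt = \int g(x/r) dx, which is independent of
    k; this constant times [a] majorizes the integral over t. The cutoff [chi] covers both the
    half-line and the whole line. *)
Lemma free_time_tonelli (chi a : R -> R) (r : R) : 0 < r -> mfun chi ->
  (forall t, 0 <= chi t <= 1) -> (forall k, 0 <= a k) -> intg a ->
  [/\ intg (fun t => \int[mu]_k (chi t * (g ((k - t) / r) * a k))),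
      intg (fun k => \int[mu]_t (chi t * (g ((k - t) / r) * a k))) &
   \int[mu]_t \int[mu]_k (chi t * (g ((k - t) / r) * a k)) =
   \int[mu]_k \int[mu]_t (chi t * (g ((k - t) / r) * a k)) ].
Proof.
move=> r0 mchi chi01 a0 ia; have ma := intg_measurable ia.
have ig k : intg (fun t => g ((k - t) / r)) /\
    \int[mu]_t g ((k - t) / r) = \int[mu]_x g (x / r).
  by apply: (@intg_flip _ k (fun x => g (x / r))) => //; exact: g_int.
have mchiga t : mfun (fun k => g ((k - t) / r)).
  by apply: (measurableT_comp (measurable_fun_scaled r)); exact: measurable_funB.
have c0 t : 0 <= chi t by case/andP: (chi01 t).
have iy k : intg (fun t => chi t * (g ((k - t) / r) * a k)).
  apply: (@intg_mul_bounded _ _ 1) => //.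
  by under eq_fun do rewrite mulrC; apply: intgZ; case: (ig k).
apply: (@RI_tonelli _ _ (fun k => a k * \int[mu]_x g (x / r))).
- apply: measurable_funM; first exact: (measurableT_comp mchi).
  apply: measurable_funM; last exact: (measurableT_comp ma).
  apply: (measurableT_comp (measurable_fun_scaled r)).
  by apply: measurable_funB.
- by move=> t k; rewrite !mulr_ge0.
- move=> t; apply: intgZ; apply: (@intg_mul_bounded _ _ M) => //.
  by move=> k; rewrite g_ge0 g_le.
- exact: iy.
- by under eq_fun do rewrite mulrC; exact: intgZ.
- move=> k; case: (ig k) => igk <-; rewrite -RIZ//; apply: RI_le => //.
    exact: intgZ.
  move=> t; rewrite [leRHS]mulrC; apply: ler_piMl; first by rewrite mulr_ge0.
  by case/andP: (chi01 t).
Qed.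

(** Under u = k - t the condition t >= 0 becomes u <= k. The difference [step k - step 0] is plus or
    minus the indicator of the interval between 0 and k, with integral k and L^1 norm |k|. *)
Let step (k u : R) : R := \1_`]-oo, k] u.

Let stepE k u : step k u = (u <= k)%R%:R.
Proof. by rewrite /step indicE mem_setE in_itv. Qed.

Let measurable_step k : mfun (step k).
Proof. exact: measurable_indic. Qed.

Let step_diff k : intg (fun u => step k u - step 0 u) /\
  \int[mu]_u (step k u - step 0 u) = k /\
  \int[mu]_u `|step k u - step 0 u| = `|k|.
Proof.
have I (a b : R) : a <= b -> intg \1_`]a, b] /\ \int[mu]_u \1_`]a, b] u = b - a.
  by move=> ab; split; [exact: integrable_indic_itv|exact: RI_indic_itv].
have [k0|k0] := leP 0 k.
  have E : (fun u => step k u - step 0 u) = \1_`]0, k].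
    apply/funext => u; rewrite !stepE indicE mem_setE in_itv /=.
    case: (leP u 0) => u0; last by rewrite subr0.
    by rewrite (le_trans u0 k0) subrr.
  have [i1 i2] := I _ _ k0; rewrite E; split=> //; rewrite i2 subr0; split=> //.
  rewrite -[RHS](_ : \int[mu]_u \1_`]0, k] u = _); last by rewrite i2 subr0 ger0_norm.
  apply: RI_ext => u; rewrite -[step k u - step 0 u]/((fun u => step k u - step 0 u) u) E.
  by rewrite ger0_norm.
have E : (fun u => step k u - step 0 u) = (fun u => - \1_`]k, 0] u).
  apply/funext => u; rewrite !stepE indicE mem_setE in_itv /=.
  case: (leP u k) => uk; last by rewrite sub0r.
  by rewrite (le_trans uk (ltW k0)) subrr oppr0.
have [i1 i2] := I _ _ (ltW k0); rewrite E; split; first exact: intgN.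
split; first by rewrite RIN// i2 sub0r opprK.
rewrite ltr0_norm// -[RHS]sub0r -i2.
apply: RI_ext => u; rewrite -[step k u - step 0 u]/((fun u => step k u - step 0 u) u) E.
by rewrite normrN ger0_norm.
Qed.

(** This is G_r(k) - G_r(0), as one integral between 0 and k from which the bound M |k| can be read
    off. *)
Let drift (r k : R) := \int[mu]_u ((step k u - step 0 u) * g (u / r)).

Let drift_int r k : intg (fun u => (step k u - step 0 u) * g (u / r)).
Proof.
have [i _] := step_diff k; under eq_fun do rewrite mulrC.
apply: (@intg_mul_bounded _ _ M) => //; first exact: measurable_fun_scaled.
by move=> x; rewrite g_ge0 g_le.
Qed.

Let drift_le r k : `|drift r k| <= M * `|k|.
Proof.
have [i [_ <-]] := step_diff k; apply: le_trans (RI_abs (drift_int r k)) _.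
rewrite -RIZ; last exact: intg_abs.
apply: RI_le; [exact: intg_abs|by apply: intgZ; exact: intg_abs|].
by move=> u; rewrite normrM mulrC ler_wpM2r// ger0_norm.
Qed.

(** Between 0 and k one has |u| < d r, hence g(u/r) = 1. *)
Let drift_eq r k : 0 < r -> `|k| < d * r -> drift r k = k.
Proof.
move=> r0 kr; have [i [h _]] := step_diff k; rewrite -[RHS]h; apply: RI_ext => u.
have [ur|ur] := ltP `|u| (d * r).
  by rewrite g1 ?mulr1// normrM normfV (gtr0_norm r0) ltr_pdivrMr.
suff -> : step k u - step 0 u = 0 by rewrite mul0r.
have dr : 0 <= d * r by rewrite mulr_ge0// ltW.
move: ur; rewrite !stepE ler_normr => /orP[ur|ur].
  rewrite !leNgt (lt_le_trans _ ur) ?(le_lt_trans (ler_norm _) kr)//=.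
  have [u0|u0] := ltP 0 u; first by rewrite subrr.
  by move: kr; rewrite ltNge (le_trans (le_trans ur u0)).
have ku : u <= k.
  rewrite -lerN2; apply: (le_trans _ ur); rewrite (le_trans _ (ltW kr))//.
  by rewrite -normrN ler_norm.
have u0 : u <= 0 by rewrite -oppr_ge0 (le_trans dr).
by rewrite ku u0 subrr.
Qed.

Lemma free_half_time_limit (a b : R -> R) :
  (forall k, 0 <= a k) -> (forall k, 0 <= b k) -> intg a -> intg b ->
  intg (fun k => k * a k) -> intg (fun k => k * b k) ->
  \int[mu]_k a k = \int[mu]_k b k ->
  (\int[mu]_t (\int[mu]_k (\1_`[0, +oo[ t * (g ((k - t) / r) * b k))) -
   \int[mu]_t (\int[mu]_k (\1_`[0, +oo[ t * (g ((k - t) / r) * a k))))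
     @[r --> +oo] --> \int[mu]_k (k * b k) - \int[mu]_k (k * a k).
Proof.
move=> a0 b0 ia ib ika ikb ab; rewrite -RIB//.
have E (r : R) : 0 < r ->
  \int[mu]_t (\int[mu]_k (\1_`[0, +oo[ t * (g ((k - t) / r) * b k))) -
  \int[mu]_t (\int[mu]_k (\1_`[0, +oo[ t * (g ((k - t) / r) * a k))) =
  \int[mu]_k (drift r k * (b k - a k)) /\ mfun (drift r).
  move=> r0; pose G k := \int[mu]_u (step k u * g (u / r)).
  have step01 k u : 0 <= step k u <= 1 by rewrite stepE ler0n lern1 leq_b1.
  have Gi k : intg (fun u => step k u * g (u / r)).
    by apply: (@intg_mul_bounded _ _ 1) => //; exact: g_int.
  have GD k : G k = drift r k + G 0.
    rewrite /G -RID//; apply: RI_ext => u; ring.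
  (* Monotonicity is the source of the measurability of [drift r]. *)
  have Gmono : {homo G : x y / x <= y}.
    move=> x y xy; apply: RI_le => // u; rewrite ler_wpM2r// !stepE ler_nat.
    by case: (leP u x) => // ux; rewrite (le_trans ux xy).
  have mG : mfun G by exact: nondecreasing_measurable.
  have mdrift : mfun (drift r).
    rewrite (_ : drift r = fun k => G k - G 0); first exact: measurable_funB.
    by apply/funext => k; rewrite GD addrK.
  split=> //.
  have inner (c : R -> R) k :
      \int[mu]_t (\1_`[0, +oo[ t * (g ((k - t) / r) * c k)) = G k * c k.
    have phi0 u : 0 <= step k u * g (u / r) by rewrite mulr_ge0//; case/andP: (step01 k u).
    have [fi fE] := intg_flip k phi0 (Gi k).
    rewrite mulrC /G -fE -RIZ//; apply: RI_ext => t.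
    rewrite stepE indicE mem_setE in_itv /= andbT lerBlDr lerDl; ring.
  have chi01 (t : R) : 0 <= (\1_`[0, +oo[ t : R) <= 1 by rewrite indicE ler0n lern1 leq_b1.
  have mchi : mfun (\1_`[0, +oo[ : R -> R) by exact: measurable_indic.
  have [_ ib1 ->] := free_time_tonelli r0 mchi chi01 b0 ib.
  have [_ ia1 ->] := free_time_tonelli r0 mchi chi01 a0 ia.
  move: ib1 ia1; under eq_fun do rewrite inner; move=> ib1.
  under eq_fun do rewrite inner; move=> ia1.
  rewrite -RIB//.
  (* As [a] and [b] have the same mass, this function has integral 0 and can be subtracted. *)
  have iba : intg (fun k => G 0 * (b k - a k)) by apply: intgZ; exact: intgB.
  have -> : \int[mu]_k (drift r k * (b k - a k)) =
     \int[mu]_k ((G k * b k - G k * a k) - G 0 * (b k - a k)).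
    by apply: RI_ext => k; rewrite GD; ring.
  rewrite [RHS]RIB//; last exact: intgB.
  by rewrite RIZ ?RIB ?ab ?subrr ?mulr0 ?subr0//; exact: intgB.
have F : \int[mu]_k (drift r k * (b k - a k)) @[r --> +oo] -->
    \int[mu]_k (k * b k - k * a k).
  apply: (@RI_dominated_pinfty _ _ _ (fun k => M * (`|k * b k| + `|k * a k|))).
  - move=> r r0; apply: measurable_funM; first by case: (E r r0).
    by apply: measurable_funB; exact: intg_measurable.
  - by apply: measurable_funB; exact: intg_measurable.
  - move=> k; rewrite -mulrBr; apply: cvgMl.
    (* For fixed k the drift is exactly k as soon as r > |k| / d. *)
    apply: cvg_near_cst; exists (`|k| / d); split; first exact: num_real.
    move=> r; rewrite ltr_pdivrMr// => kr; apply: drift_eq; last by rewrite mulrC.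
    by rewrite -(pmulr_lgt0 _ d_gt0) (le_lt_trans _ kr).
  - by apply: intgZ; apply: intgD; exact: intg_abs.
  - move=> r k r0; rewrite normrM.
    apply: (@le_trans _ _ (M * `|k| * `|b k - a k|)).
      by rewrite ler_wpM2r.
    rewrite -mulrA ler_wpM2l// -normrM mulrBr.
    by rewrite (le_trans (ler_normB _ _)).
apply: cvg_trans F; apply: near_eq_cvg; exists 0; split; first exact: num_real.
by move=> r r0; case: (E r r0).
Qed.

End FreeTime.

(** * The momentum operator *)

Section LebesgueDerivative.
Context {R : realType}.
Implicit Types (f W : R -> R).
Local Notation mfun f := (measurable_fun [set: R] f).

(** Half-open intervals are those over which [momentum] integrates increments. *)
Definition loc_intg f := mfun f /\
  forall a b : R, (@mu R).-integrable `]a, b] (EFin \o f).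

Lemma compact_sub_itv (K : set R) : compact K -> exists N : R, K `<=` `]- N, N].
Proof.
move=> /compact_bounded[M [_ MK]]; exists (`|M| + 2) => x Kx.
have M1 : M < `|M| + 1 by rewrite (le_lt_trans (ler_norm _))// ltrDl.
have := MK _ M1 x Kx; rewrite /= in_itv /= ler_norml => /andP[h1 h2].
by apply/andP; split; lra.
Qed.

Lemma loc_intg_locally f : loc_intg f -> locally_integrable setT f.
Proof.
move=> [mf fi]; split => //; first exact: openT.
move=> K _ cK; have [N KN] := compact_sub_itv cK.
have mK : measurable K by exact: compact_measurable.
suff /integrableP[] : (@mu R).-integrable K (EFin \o f) by [].
by apply: (@integrableS _ (measurableTypeR R) _ _ _ _ _ _ _ KN (fi (- N) N)).
Qed.

Lemma loc_intg_sqint f : sqint f -> loc_intg f.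
Proof.
move=> [mf fi]; split => // a b; apply/integrable_mkcond => //.
apply: (@le_integrable _ (measurableTypeR R) _ _ _ _ _
  (EFin \o (fun x => f x ^+ 2 + \1_`]a, b] x))) => //.
- by apply/(measurable_restrictT _ _).1 => //; exact/measurable_EFinP/measurable_funTS.
- move=> x _ /=; rewrite patchE indicE; case: ifPn => _ /=; last by rewrite normr0 lee_fin.
  rewrite lee_fin [leRHS]ger0_norm ?addr_ge0 ?sqr_ge0//.
  rewrite -[f x ^+ 2]real_normK ?num_real//.
  by have := sqr_ge0 (`|f x| - 1); have := normr_ge0 (f x); nra.
- by apply: intgD => //; exact: integrable_indic_itv.
Qed.

Lemma loc_intg_bounded f (B : R) : mfun f -> (forall x, `|f x| <= B) -> loc_intg f.
Proof.
move=> mf fB; split => // a b; apply: measurable_bounded_integrable => //.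
- change (@mu R `]a, b]%classic < +oo)%E; rewrite lebesgue_measure_itv /=.
  by case: ifP => // _; rewrite -EFinB ltry.
- exact: measurable_funTS.
- by exists B; split; [exact: num_real|move=> M BM x _ /=; rewrite (le_trans (fB x))// ltW].
Qed.

Lemma loc_intgB (f g : R -> R) : loc_intg f -> loc_intg g ->
  loc_intg (fun x => f x - g x).
Proof.
move=> [mf fi] [mg gi]; split=> [|a b]; first exact: measurable_funB.
exact: (@integrableB _ (measurableTypeR R) _ _ _ _ _ _ (fi a b) (gi a b)).
Qed.

(** The integral from a fixed lower end -n is differentiated at almost every x > -n; the countable
    intersection over n then covers almost every real x. *)
Lemma lebesgue_derivative f W : loc_intg f ->
  (forall a b, a <= b -> W b - W a = \int[mu]_(x in `]a, b]) f x) ->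
  {ae (@mu R), forall x : R, is_derive x 1 W (f x)}.
Proof.
move=> [mf fi] HW; have lf := loc_intg_locally (conj mf fi).
have key (n : nat) : {ae (@mu R), forall x : R, (- n%:R < x) -> is_derive x 1 W (f x)}.
  have := @FTC1 R f (BRight (- n%:R)) (fun y => fi _ y) lf.
  apply: ae_mono => x h nx; have [d1 d2] := h nx.
  pose F (y : R) := \int[mu]_(t in [set` Interval (BRight (- n%:R)) (BRight y)]) f t.
  have dF : is_derive x 1 F (f x) by split; [exact: d1|rewrite -derive1E; exact: d2].
  have dF' : is_derive x 1 (fun y => F y + W (- n%:R)) (f x).
    by have := is_deriveD dF (is_derive_cst (W (- n%:R)) x 1); rewrite addr0.
  apply: (near_eq_is_derive _ dF') => //.
  have nn : \forall y \near x, - n%:R < y.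
    exists (x - - n%:R); first by rewrite /= subr_gt0.
    by move=> y /=; rewrite ltr_norml => /andP[_]; lra.
  by apply: filterS nn => y ny; rewrite /F -HW ?subrK// ltW.
have /ae_foralln := key.
apply: ae_mono => x h.
have [n nx] : exists n : nat, - n%:R < x.
  exists (Num.truncn `|x|).+1; rewrite ltrNl (le_lt_trans (ler_norm _))// normrN.
  exact: truncnS_gt.
exact: (h n nx).
Qed.

(** The zero function is a primitive of [f], so its derivative equals [f] almost everywhere. *)
Lemma loc_intg_eq0 f : loc_intg f ->
  (forall a b : R, a <= b -> \int[mu]_(x in `]a, b]) f x = 0) ->
  {ae (@mu R), forall x, f x = 0}.
Proof.
move=> lf f0; have := @lebesgue_derivative f (fun=> 0) lf.
move=> /(_ _)/wrap[].
  by move=> a b ab; rewrite f0// subrr.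
apply: ae_mono => x [_ <-]; exact: derive_cst.
Qed.

End LebesgueDerivative.

(** * Fubini for complex integrands, and exponentials on intervals *)

Section ComplexFubini.
Context {R : realType}.
Local Notation mfun f := (measurable_fun [set: R] f).

(** A majorant in product form gives integrability on the plane and on every slice, not only on
    almost every one. *)
Lemma RI_fubini (f : R -> R -> R) (h l : R -> R) :
  measurable_fun setT (fun p : R * R => f p.1 p.2) ->
  (forall x y, `|f x y| <= h x * l y) -> intg h -> intg l ->
  intg (fun x => \int[mu]_y f x y) /\
  \int[mu]_x \int[mu]_y f x y = \int[mu]_y \int[mu]_x f x y.
Proof.
move=> mf fhl hi li.
pose F (p : R * R) := (f p.1 p.2)%:E.
have mF : measurable_fun setT F by exact/measurable_EFinP.
have m1 x : mfun (f x) by exact: (measurableT_comp mf (pair1_measurable x)).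
have m2 y : mfun (f^~ y) by exact: (measurableT_comp mf (pair2_measurable y)).
have fx x : intg (f x) by apply: (intg_le (m1 x) (fhl x)); exact: intgZ.
have fy y : intg (f^~ y).
  apply: (intg_le (m2 y) (fhl^~ y)); under eq_fun do rewrite mulrC; exact: intgZ.
have Ex x : ((\int[mu]_y f x y)%:E = \int[mu]_y F (x, y))%E.
  by rewrite fineK// (integrable_fin_num measurableT (fx x)).
have Ey y : ((\int[mu]_x f x y)%:E = \int[mu]_x F (x, y))%E.
  by rewrite fineK// (integrable_fin_num measurableT (fy y)).
have iF : (@mu R \x @mu R)%E.-integrable setT F.
  apply/(@integrable12ltyP _ _ (measurableTypeR R) (measurableTypeR R) R (@mu R) (@mu R) F mF).
  apply: (@le_lt_trans _ _ (\int[mu]_x (h x * \int[mu]_y l y)%:E)%E).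
    apply: ge0_le_integral => //.
    - by move=> x _; exact: integral_ge0.
    - apply: (@measurable_fun_fubini_tonelli_F _ _ (measurableTypeR R)
        (measurableTypeR R) R (@mu R) (abse \o F)) => //.
        exact: measurableT_comp.
      by move=> p; exact: abse_ge0.
    - by apply/measurable_EFinP; apply: measurable_funM => //; exact: (intg_measurable hi).
    - move=> x _; have fxa := intg_abs (fx x).
      have -> : (\int[mu]_y `|F (x, y)| = (\int[mu]_y `|f x y|)%:E)%E.
        by rewrite fineK// (integrable_fin_num measurableT fxa).
      by rewrite lee_fin -RIZ//; apply: RI_le => //; exact: intgZ.
  by apply: (integrable_lty measurableT); under eq_fun do rewrite mulrC; exact: intgZ.
have T := @Fubini _ _ (measurableTypeR R) (measurableTypeR R) _ (@mu R) (@mu R) F iF.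
split.
  by apply: eq_integrable (integrable_fubini_F iF) => // x _; exact/esym/Ex.
rewrite /Rintegral; congr fine.
by under eq_integral do rewrite Ex; rewrite T; under [RHS]eq_integral do rewrite Ey.
Qed.

Lemma RI_itv_derive (F f : R -> R) a b : a <= b -> continuous f ->
  (forall x : R, is_derive x 1 F (f x)) ->
  \int[mu]_(x in `]a, b]) f x = F b - F a.
Proof.
rewrite le_eqVlt => /orP[/eqP ->|ab] cf dF.
  by rewrite set_itv_ge ?Rintegral_set0 ?subrr// bnd_simp ltxx.
have cF x : {for x, continuous F}.
  by apply/differentiable_continuous/derivable1_diffP; case: (dF x).
have iab : (@mu R).-integrable `]a, b] (EFin \o f).
  have : (@mu R).-integrable `[a, b] (EFin \o f).
    apply: continuous_compact_integrable; first exact: segment_compact.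
    exact: continuous_subspaceT.
  by apply: (@integrableS _ (measurableTypeR R)) => //; exact: subset_itv_oc_cc.
rewrite Rintegral_itv_obnd_cbnd// /Rintegral (@continuous_FTC2 _ f F)//.
- exact: continuous_subspaceT.
- split; [by move=> x _; case: (dF x)| |].
  + by apply: cvg_at_right_filter; exact: cF.
  + by apply: cvg_at_left_filter; exact: cF.
- by move=> x _; rewrite derive1E; exact: derive_val.
Qed.

Let derive_scale (k x : R) : is_derive x 1 (fun x : R => k * x) k.
Proof. by have := is_deriveZ k (is_derive_id x 1); rewrite /GRing.scale /= mulr1. Qed.

Lemma is_derive_sin_scaled (k x : R) :
  is_derive x 1 (fun x : R => sin (k * x)) (k * cos (k * x)).
Proof.
by have := is_derive1_comp (is_derive_sin (k * x)) (derive_scale k x); rewrite mulrC.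
Qed.

Lemma is_derive_cos_scaled (k x : R) :
  is_derive x 1 (fun x : R => - cos (k * x)) (k * sin (k * x)).
Proof.
have := is_derive1_comp (is_derive_cos (k * x)) (derive_scale k x).
by move/is_deriveN; rewrite mulNr opprK mulrC.
Qed.

Lemma continuous_expi (k : R) :
  continuous (fun x => Re (expi (k * x))) /\ continuous (fun x => Im (expi (k * x))).
Proof.
split => x.
  apply: (@continuous_comp _ _ _ (fun x => k * x) cos); last exact: continuous_cos.
  by apply: cvgMr; exact: cvg_id.
apply: (@continuous_comp _ _ _ (fun x => k * x) sin); last exact: continuous_sin.
by apply: cvgMr; exact: cvg_id.
Qed.

(** The factor k stays on the left so that k = 0 is included without a division. *)
Lemma RI_itv_expi (k a b : R) : a <= b ->
  k * \int[mu]_(x in `]a, b]) Re (expi (k * x)) = sin (k * b) - sin (k * a) /\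
  k * \int[mu]_(x in `]a, b]) Im (expi (k * x)) = cos (k * a) - cos (k * b).
Proof.
move=> ab; have [c1 c2] := continuous_expi k.
have I (f : R -> R) : continuous f -> (@mu R).-integrable `]a, b] (EFin \o f).
  move=> cf; have : (@mu R).-integrable `[a, b] (EFin \o f).
    apply: continuous_compact_integrable; first exact: segment_compact.
    exact: continuous_subspaceT.
  by apply: (@integrableS _ (measurableTypeR R)) => //; exact: subset_itv_oc_cc.
split; rewrite -RintegralZl//; try exact: I.
  rewrite (RI_itv_derive ab _ (is_derive_sin_scaled k))// => x.
  by apply: cvgMr; exact: c1.
rewrite (RI_itv_derive ab _ (is_derive_cos_scaled k)); first by rewrite opprK addrC.
by move=> x; apply: cvgMr; exact: c2.
Qed.

Lemma integral_cplx_fubini (f : R -> R -> R[i]) (h l : R -> R) :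
  measurable_fun setT (fun p : R * R => Re (f p.1 p.2)) ->
  measurable_fun setT (fun p : R * R => Im (f p.1 p.2)) ->
  (forall x y, normc (f x y) <= h x * l y) -> intg h -> intg l ->
  integrable_cplx (fun x => integral_cplx setT (f x)) /\
  integral_cplx setT (fun x => integral_cplx setT (f x)) =
  integral_cplx setT (fun y => integral_cplx setT (f^~ y)).
Proof.
move=> m1 m2 fhl hi li.
have [|r1 r3] := @RI_fubini (fun x y => Re (f x y)) h l m1 _ hi li.
  by move=> x y; apply: le_trans (Re_le_normc _) _.
have [|i1 i3] := @RI_fubini (fun x y => Im (f x y)) h l m2 _ hi li.
  by move=> x y; apply: le_trans (Im_le_normc _) _.
by split=> //; apply: complex_ext.
Qed.

End ComplexFubini.

Section ComplexAuxiliary.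
Context {R : realType}.

(** A test vector: pairing with it integrates over ]a, b], and such integrals determine a locally
    integrable function up to a null set. *)
Definition box (a b : R) : fn R := fun x => (\1_`]a, b] x)%:C.

Lemma normc_box a b x : normc (box a b x) = \1_`]a, b] x.
Proof. by rewrite normc_real ger0_norm. Qed.

Lemma box_measurable a b : measurable_cplx (box a b).
Proof. by apply: measurable_cplx_real; exact: measurable_indic. Qed.
#[local] Hint Resolve box_measurable : core.

Lemma box_L2 a b : L2 (box a b).
Proof.
apply: L2_of_intg => //.
have -> : (fun x => normc (box a b x) ^+ 2) = \1_`]a, b].
  apply/funext => x; rewrite normc_box indicE.
  by case: (_ \in _); rewrite ?expr1n ?expr0n.
exact: integrable_indic_itv.
Qed.
#[local] Hint Resolve box_L2 : core.

Lemma box_integrable a b : integrable_cplx (box a b).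
Proof.
apply: (integrable_cplx_le _ (g := \1_`]a, b])) => //.
  by move=> x; rewrite normc_box.
exact: integrable_indic_itv.
Qed.
#[local] Hint Resolve box_integrable : core.

Lemma norm2_box a b : a <= b -> norm2 (box a b) = Num.sqrt (b - a).
Proof.
move=> ab; rewrite /norm2; congr Num.sqrt.
have -> : \int[mu]_x normc (box a b x) ^+ 2 = \int[mu]_x \1_`]a, b] x.
  apply: RI_ext => x; rewrite normc_box indicE.
  by case: (_ \in _); rewrite ?expr1n ?expr0n.
exact: RI_indic_itv.
Qed.

Lemma inner_box a b u : inner_prod (box a b) u = integral_cplx `]a, b] u.
Proof.
apply: complex_ext => /=; rewrite [RHS]Rintegral_mkcond; apply: RI_ext => x;
  rewrite patchE reimE !reimE /= oppr0 mul0r ?subr0 ?addr0 indicE;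
  by case: ifP => _; rewrite ?mul1r ?mul0r.
Qed.

End ComplexAuxiliary.

(** * The momentum operator on the Fourier side *)

Section Momentum.
Context {R : realType}.
Variable F : op R.
Hypothesis hF : fourier_transform F.
Implicit Types (u v w : fn R).

#[local] Hint Resolve box_measurable box_L2 box_integrable : core.

Let uF : unitary_op F. Proof. by case: hF. Qed.
Let isoF : isometric_op F. Proof. exact: unitary_isometric. Qed.
Let c0 : R := (Num.sqrt (2 * pi))^-1.

Let boxhat (a b k : R) : R[i] :=
  c0%:C * integral_cplx setT (fun x => expi (- (k * x)) * box a b x).

Let F_box (a b : R) : aeq (F (box a b)) (boxhat a b).
Proof. by case: hF => _; apply. Qed.

Let expi_box_integrable (a b k : R) : integrable_cplx (fun x => expi (k * x) * box a b x).
Proof.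
apply: (integrable_cplx_le _ (g := \1_`]a, b])).
- by apply: measurable_cplx_mul => //; apply: measurable_expi; exact: measurable_funM.
- by move=> x; rewrite ComplexField.Normc.normcM normc_expi mul1r normc_box.
- exact: integrable_indic_itv.
Qed.

Let conj_boxhat (a b k : R) : (boxhat a b k)^*%R =
  c0%:C * integral_cplx setT (fun x => expi (k * x) * box a b x).
Proof.
have i : integrable_cplx (fun x => expi (- (k * x)) * box a b x).
  by have := expi_box_integrable a b (- k); under eq_fun do rewrite mulNr.
rewrite /boxhat conj_mul; congr (_ * _); first by apply: complex_ext; rewrite !reimE ?oppr0.
rewrite integral_cplx_conj//.
congr integral_cplx; apply/funext => x; rewrite conj_mul; congr (_ * _).
  by apply: complex_ext; rewrite !reimE /= ?cosN ?sinN ?opprK.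
by apply: complex_ext; rewrite !reimE ?oppr0.
Qed.

(** Integration of e^(ikx) over ]a, b]: multiplication by ik on the Fourier side becomes an
    increment between a and b. *)
Let mul_conj_boxhat (a b k : R) : a <= b ->
  'i%R * (k%:C * (boxhat a b k)^*%R) = c0%:C * (expi (k * b) - expi (k * a)).
Proof.
move=> ab; have [h1 h2] := RI_itv_expi k ab.
have h u : integral_cplx setT (fun x => u x * box a b x) = integral_cplx `]a, b] u.
  rewrite -inner_box; congr integral_cplx; apply/funext => x.
  by rewrite mulrC; congr (_ * _); apply: complex_ext; rewrite !reimE ?oppr0.
rewrite conj_boxhat h.
rewrite /integral_cplx; set I1 := Rintegral _ _ _ in h1 *; set I2 := Rintegral _ _ _ in h2 *.
move: I1 I2 h1 h2 => I1 I2 h1 h2.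
have Re_mk (x y : R) : Re (x +i* y) = x by [].
have Im_mk (x y : R) : Im (x +i* y) = y by [].
have Re_expi (x : R) : Re (expi x) = cos x by [].
have Im_expi (x : R) : Im (expi x) = sin x by [].
apply: complex_ext; rewrite !(reimE, Re_i, Im_i, Re_expi, Im_expi, Re_mk, Im_mk).
  by transitivity (- c0 * (k * I2)); [ring|rewrite h2; ring].
by transitivity (c0 * (k * I1)); [ring|rewrite h1; ring].
Qed.

Variable u : fn R.
Hypotheses (lu : L2 u).
Let uh := F u.
Hypothesis lkuh : L2 (fun k => k%:C * uh k).
Hypothesis iuh : integrable_cplx uh.

Let luh : L2 uh. Proof. by apply: bounded_L2 => //; case: isoF. Qed.

(** Candidate for the continuous representative of [u], given by the inversion integral. That it
    equals [u] is deduced from the unitarity of [F] by comparing integrals over intervals. *)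
Let inverse_fourier : fn R := fun x =>
  c0%:C * integral_cplx setT (fun k => expi (k * x) * uh k).

Let exp_uh_integrable x : integrable_cplx (fun k => expi (k * x) * uh k).
Proof.
apply: (integrable_cplx_le _ (g := fun k => normc (uh k))).
- apply: measurable_cplx_mul; last exact: L2_measurable.
  by apply: measurable_expi; exact: measurable_funM.
- by move=> k; rewrite ComplexField.Normc.normcM normc_expi mul1r.
- exact: intg_normc.
Qed.

Variable v : fn R.
Hypotheses (lv : L2 v) (Fv : aeq (F v) (fun k => k%:C * uh k)).

Let w := inverse_fourier.

Let c0_ge0 : 0 <= c0. Proof. by rewrite invr_ge0 sqrtr_ge0. Qed.

(** Parseval against the indicator of ]a, b]: its pairing with i v is \int i k conj(boxhat) uh = c0
    \int (e^(ikb) - e^(ika)) uh. *)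
Let w_increment (a b : R) : a <= b ->
  w b - w a = integral_cplx `]a, b] (fun x => 'i%R * v x).
Proof.
move=> ab; rewrite -inner_box.
have -> : inner_prod (box a b) (fun x => 'i%R * v x) = 'i%R * inner_prod (box a b) v.
  rewrite /inner_prod -integral_cplxZ; last exact: inner_integrable.
  by congr integral_cplx; apply/funext => x; ring.
rewrite -(isometric_inner isoF (box_L2 a b) lv) /inner_prod.
have lFb : L2 (F (box a b)) by apply: bounded_L2 => //; case: isoF.
have lFv : L2 (F v) by apply: bounded_L2 => //; case: isoF.
rewrite -integral_cplxZ; last exact: inner_integrable.
rewrite -mulrBr -integral_cplxB// -integral_cplxZ; last exact: integrable_cplxB.
apply/esym/integral_cplx_ae.
- apply: measurable_cplx_mul; first exact: measurable_cplx_cst.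
  by apply: inner_measurable; exact: L2_measurable.
- apply: integrable_cplx_measurable; apply: integrable_cplxZ; exact: integrable_cplxB.
- move: (F_box a b) Fv; apply: ae_mono2 => k -> ->.
  transitivity ('i%R * (k%:C * (boxhat a b k)^*%R) * uh k); first by ring.
  by rewrite mul_conj_boxhat//; ring.
Qed.

Let w_bounded x : normc (w x) <= c0 * ((\int[mu]_k normc (uh k)) *+ 2).
Proof.
rewrite /w /inverse_fourier ComplexField.Normc.normcM normc_real (ger0_norm c0_ge0).
rewrite ler_wpM2l//; apply: le_trans (normc_le_add _) _; rewrite mulr2n.
have [i1 i2] := exp_uh_integrable x.
have nn k : normc (expi (k * x) * uh k) = normc (uh k).
  by rewrite ComplexField.Normc.normcM normc_expi mul1r.
have iN := intg_normc iuh.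
apply: lerD; apply: (le_trans (RI_abs _)) => //; apply: RI_le => //; try exact: intg_abs.
- by move=> k; rewrite -nn; exact: Re_le_normc.
- by move=> k; rewrite -nn; exact: Im_le_normc.
Qed.

(** Cauchy-Schwarz for the increment, the indicator of ]x, y] having norm sqrt(y - x). The resulting
    continuity gives the measurability of [w]. *)
Let w_hoelder x y : normc (w y - w x) <= Num.sqrt `|y - x| * norm2 v.
Proof.
wlog xy : x y / x <= y => [H|].
  have [/H//|/ltW yx] := leP x y.
  by rewrite -opprB normc_opp distrC; exact: H.
rewrite w_increment// -inner_box ger0_norm ?subr_ge0// -norm2_box//.
have liv : L2 (fun x => 'i%R * v x) by exact: L2Z.
apply: le_trans (cauchy_schwarz (box_L2 x y) liv) _.
rewrite ler_wpM2l ?norm2_ge0// /norm2 ler_wsqrtr// le_eqVlt; apply/orP; left; apply/eqP.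
apply: RI_ext => z; rewrite ComplexField.Normc.normcM.
have -> : normc ('i : R[i])%R = 1.
  by apply/eqP; rewrite -(@eqrXn2 _ 2%N)// ?normc_ge0// normc_sq Re_i Im_i expr0n add0r expr1n.
by rewrite mul1r.
Qed.

Let w_continuous (g : R[i] -> R) : (forall z z', `|g z - g z'| <= normc (z - z')) ->
  continuous (fun x => g (w x)).
Proof.
move=> hg x; apply/cvgrPdist_lt => e e0.
have h : Num.sqrt `|y - x| * norm2 v @[y --> x] --> 0.
  have hy : `|y - x| @[y --> x] --> (0 : R).
    by apply/cvgr0Pnorm_lt => d d0; exists d => // y /=; rewrite normr_id distrC.
  rewrite -(mul0r (norm2 v)) -(sqrtr0 R); apply: cvgMl.
  exact: (cvg_comp _ _ hy (@sqrt_continuous R 0)).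
move/cvgr0Pnorm_lt : h => /(_ e e0); apply: filterS => y hy.
apply: le_lt_trans (hg _ _) _; apply: le_lt_trans hy.
by rewrite ger0_norm ?mulr_ge0 ?sqrtr_ge0 ?norm2_ge0// distrC; exact: w_hoelder.
Qed.

(** Parseval with the indicator, then Fubini: |uh(k)| times c0 on ]a, b] is a majorant in product
    form. *)
Let w_box (a b : R) : a <= b -> integral_cplx `]a, b] u = integral_cplx `]a, b] w.
Proof.
move=> ab; rewrite -!inner_box -(isometric_inner isoF (box_L2 a b) lu) -/uh.
pose f (k x : R) : R[i] := (c0%:C * uh k) * (expi (k * x) * box a b x).
have lFb : L2 (F (box a b)) by apply: bounded_L2 => //; case: isoF.
have [mu1 mu2] := L2_measurable luh.
have m12 (g h : R -> R) : measurable_fun setT g -> measurable_fun setT h ->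
    measurable_fun setT (fun p : R * R => g p.1 * h p.2).
  by move=> mg mh; apply: measurable_funM; exact: measurableT_comp.
have mkx (g : R -> R) : continuous g -> measurable_fun setT (fun p : R * R => g (p.1 * p.2)).
  move=> cg; apply: (measurableT_comp (continuous_measurable_fun cg)).
  exact: measurable_funM.
have mbox : measurable_fun setT (fun p : R * R => \1_`]a, b] p.2 : R).
  apply: (measurableT_comp (f := \1_`]a, b] : R -> R)) => //; exact: measurable_indic.
have mre : measurable_fun setT (fun p : R * R => Re (uh p.1)) by exact: (measurableT_comp mu1).
have mim : measurable_fun setT (fun p : R * R => Im (uh p.1)) by exact: (measurableT_comp mu2).
have mcos := mkx _ (@continuous_cos R).
have msin := mkx _ (@continuous_sin R).
have [] := @integral_cplx_fubini R f (fun k => normc (uh k)) (fun x => c0 * \1_`]a, b] x).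
- rewrite (_ : (fun p => _) = fun p : R * R => c0 * \1_`]a, b] p.2 *
     (Re (uh p.1) * cos (p.1 * p.2) - Im (uh p.1) * sin (p.1 * p.2))); last first.
    by apply/funext => p; rewrite /f !reimE /=; ring.
  by apply: measurable_funM; [exact: measurable_funM|
    apply: measurable_funB; exact: measurable_funM].
- rewrite (_ : (fun p => _) = fun p : R * R => c0 * \1_`]a, b] p.2 *
     (Re (uh p.1) * sin (p.1 * p.2) + Im (uh p.1) * cos (p.1 * p.2))); last first.
    by apply/funext => p; rewrite /f !reimE /=; ring.
  by apply: measurable_funM; [exact: measurable_funM|
    apply: measurable_funD; exact: measurable_funM].
- move=> k x; rewrite /f !ComplexField.Normc.normcM normc_expi mul1r normc_box.
  by rewrite normc_real (ger0_norm c0_ge0) le_eqVlt; apply/orP; left; apply/eqP; ring.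
- exact: intg_normc.
- by apply: intgZ; exact: integrable_indic_itv.
have E1 k : integral_cplx setT (f k) = (boxhat a b k)^*%R * uh k.
  by rewrite /f integral_cplxZ ?conj_boxhat//; ring.
have E2 x : integral_cplx setT (f^~ x) = (box a b x)^*%R * w x.
  have -> : f^~ x = fun k => (c0%:C * box a b x) * (expi (k * x) * uh k).
    by apply/funext => k; rewrite /f; ring.
  rewrite integral_cplxZ// /w /inverse_fourier.
  have -> : (box a b x)^*%R = box a b x by apply: complex_ext; rewrite !reimE ?oppr0.
  by ring.
under [X in integrable_cplx X]eq_fun do rewrite E1.
move=> /integrable_cplx_measurable mE.
under [in LHS]eq_fun do rewrite E1; move=> E.
transitivity (integral_cplx setT (fun k => (boxhat a b k)^*%R * uh k)).
  apply: integral_cplx_ae => //.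
    by apply: inner_measurable; exact: L2_measurable.
  by move: (F_box a b); apply: ae_mono => k ->.
by rewrite E; congr integral_cplx; apply/funext => x; rewrite E2.
Qed.

Let w_meas : measurable_cplx w.
Proof.
split; apply: continuous_measurable_fun; apply: w_continuous => z z'.
  by rewrite -Re_opp -Re_add; exact: Re_le_normc.
by rewrite -Im_opp -Im_add; exact: Im_le_normc.
Qed.

(** The integrals over all intervals agree; [w] is locally integrable because it is bounded, [u]
    because it is square-integrable. *)
Let w_ae : aeq w u.
Proof.
have [su1 su2] := (L2_sqint u).1 lu; have [wm1 wm2] := w_meas.
have lw1 := loc_intg_bounded wm1 (fun x => le_trans (Re_le_normc _) (w_bounded x)).
have lw2 := loc_intg_bounded wm2 (fun x => le_trans (Im_le_normc _) (w_bounded x)).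
have [lu1 lu2] := (loc_intg_sqint su1, loc_intg_sqint su2).
have h1 : {ae (@mu R), forall x, Re (w x) - Re (u x) = 0}.
  apply: loc_intg_eq0; first exact: loc_intgB.
  move=> a b ab; rewrite RintegralB ?lw1.2 ?lu1.2//.
  by have [-> _] := w_box ab; rewrite subrr.
have h2 : {ae (@mu R), forall x, Im (w x) - Im (u x) = 0}.
  apply: loc_intg_eq0; first exact: loc_intgB.
  move=> a b ab; rewrite RintegralB ?lw2.2 ?lu2.2//.
  by have [_ ->] := w_box ab; rewrite subrr.
move: h1 h2; apply: ae_mono2 => x /eqP + /eqP; rewrite !subr_eq0 => /eqP r /eqP i.
exact: complex_ext.
Qed.

(** [w] is the absolutely continuous representative of [u], and the expectation is Parseval with F v
    = k F u. *)
Lemma momentum_of_fourier : momentum u v /\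
  inner_prod u v = (\int[mu]_k (k * normc (uh k) ^+ 2))%:C.
Proof.
split; first by split=> //; exists w.
rewrite -(isometric_inner isoF lu lv) -/uh.
rewrite (inner_ae (L2_measurable luh) (L2_measurable luh) _
  (L2_measurable lkuh) (aeq_refl _) Fv); last first.
  by apply: L2_measurable; apply: bounded_L2 => //; case: isoF.
have E k : (uh k)^*%R * (k%:C * uh k) = (k * normc (uh k) ^+ 2)%:C.
  by rewrite mulrCA mulc_conj; apply: complex_ext; rewrite !reimE; ring.
by rewrite /inner_prod; under eq_fun do rewrite E; exact: integral_cplx_real.
Qed.

End Momentum.

(** * The Eisenbud-Wigner formula *)

Section EisenbudWigner.
Context {R : realType}.
Implicit Types (u w z : fn R).

(** A null set cannot contain ]x, x + e[, of measure e. Limits at x can therefore be taken along a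
    set of full measure. *)
Lemma ae_right_dense (P : R -> Prop) (x e : R) : 0 < e ->
  {ae (@mu R), forall y, P y} -> exists y, [/\ x < y, y < x + e & P y].
Proof.
move=> e0 [A [mA A0 PA]]; apply: contrapT => /forallNP h.
have sub : `]x, x + e[%classic `<=` A.
  move=> y; rewrite /= in_itv /= => /andP[xy ye]; apply: PA => Py.
  by apply: (h y).
have : (@mu R (`]x, (x + e)%R[%classic) <= @mu R A)%E.
  by apply: le_measure => //; rewrite inE.
rewrite [leRHS]A0 lebesgue_measure_itv /= lte_fin ltrDl e0 -EFinB lee_fin.
by rewrite addrAC subrr add0r leNgt e0.
Qed.

(** Testing on the indicator of ]a, b] shows that |sm|^2 - 1 has integral 0 over every interval. *)
Lemma unimodular_ae (sm : fn R) : measurable_cplx sm ->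
  (forall u, L2 u -> L2 (fun x => sm x * u x) /\
     norm2 (fun x => sm x * u x) = norm2 u) ->
  {ae (@mu R), forall x, normc (sm x) = 1}.
Proof.
move=> msm hsm; pose h x := normc (sm x) ^+ 2 - 1.
have mh : measurable_fun setT h by apply: measurable_funB => //; exact: measurable_normc2.
have E a b : (fun x => normc (sm x * box a b x) ^+ 2) =
    ((fun x => normc (sm x) ^+ 2) \_ `]a, b]).
  apply/funext => x; rewrite ComplexField.Normc.normcM normc_box patchE indicE.
  by case: ifP; rewrite ?mulr1 ?mulr0 ?expr0n.
have i1 a b : (@mu R).-integrable `]a, b] (EFin \o (fun x => normc (sm x) ^+ 2)).
  have [l _] := hsm _ (box_L2 a b); apply/integrable_mkcond => //.
  have := L2_normc2 l; rewrite E; apply: eq_integrable => // x _.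
  by rewrite /= restrict_EFin.
have i2 (a b : R) : (@mu R).-integrable `]a, b] (EFin \o (fun _ => 1)).
  by case: (@loc_intg_bounded R (fun=> 1) 1) => // x; rewrite normr1.
have lh : loc_intg h.
  split=> // a b.
  exact: (@integrableB _ (measurableTypeR R) _ _ _ _ _ _ (i1 a b) (i2 a b)).
suff : {ae (@mu R), forall x, h x = 0}.
  apply: ae_mono => x /eqP; rewrite subr_eq0 -{1}(expr1n _ 2) eqrXn2// ?normc_ge0//.
  by move/eqP.
apply: (loc_intg_eq0 lh) => a b ab.
rewrite RintegralB ?i1 ?i2//.
have [l n] := hsm _ (box_L2 a b).
have := norm2_sq (fun x => sm x * box a b x); rewrite n norm2_sq E.
rewrite [X in X - _]Rintegral_mkcond [X in _ - X]Rintegral_mkcond => <-.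
apply/eqP; rewrite subr_eq0; apply/eqP; apply: RI_ext => x.
by rewrite patchE normc_box indicE; case: ifP; rewrite ?expr1n ?expr0n.
Qed.

Lemma cplx_difference_quotient w (x : R) (d : R[i]) :
  is_derive x 1 (fun y => Re (w y)) (Re d) ->
  is_derive x 1 (fun y => Im (w y)) (Im d) ->
  normc ((w y - w x) / (y - x)%:C - d) @[y --> x^'] --> (0 : R).
Proof.
have key (g : R -> R) (c : R) : is_derive x 1 g c ->
    (g y - g x) / (y - x) - c @[y --> x^'] --> (0 : R).
  move=> [dg <-]; apply/cvgr0Pnorm_lt => e e0.
  move/cvgrPdist_lt : (dg : _ --> _) => /(_ e e0) [r /= r0 hr].
  exists r => //= y yx yNx; have := hr (y - x); rewrite /ball_ /= sub0r normrN.
  move=> /(_ _ _)/wrap[||]; first by rewrite distrC.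
    by rewrite subr_eq0.
  rewrite distrC; congr (`| _ - _ | < _).
  by rewrite /GRing.scale /= mulr1 subrK mulrC.
move=> /key h1 /key h2.
have h : `|(Re (w y) - Re (w x)) / (y - x) - Re d| +
   `|(Im (w y) - Im (w x)) / (y - x) - Im d| @[y --> x^'] --> (0 : R).
  by apply: cvg0D; apply/cvgr0Pnorm_lt => e e0;
   [move/cvgr0Pnorm_lt : h1|move/cvgr0Pnorm_lt : h2] => /(_ e e0);
   apply: filterS => y; rewrite normr_id.
apply: cvg0_squeeze h => y; rewrite ger0_norm ?normc_ge0//.
apply: le_trans (normc_le_add _) _.
have -> : (y - x)%:C^-1 = ((y - x)^-1)%:C by rewrite fmorphV.
by rewrite !reimE !(mulr0, subr0, addr0, add0r).
Qed.

Lemma normc_sub_cvg0 w (x : R) (d : R[i]) :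
  normc ((w y - w x) / (y - x)%:C - d) @[y --> x^'] --> (0 : R) ->
  normc (w y - w x) @[y --> x^'] --> (0 : R).
Proof.
move=> h; have hx : `|y - x| @[y --> x^'] --> (0 : R).
  by apply/cvgr0Pnorm_lt => e e0; exists e => // y /=; rewrite normr_id distrC.
have hp : (normc ((w y - w x) / (y - x)%:C - d) + normc d) * `|y - x| @[y --> x^'] --> (0 : R).
  by rewrite -[0](mulr0 (0 + normc d)); apply: cvgM => //; apply: cvgD => //; exact: cvg_cst.
apply/cvgr0Pnorm_lt => e e0; move/cvgr0Pnorm_lt : hp => /(_ e e0) [r /= r0 hr].
exists r => //= y yx yNx; apply: le_lt_trans (hr y yx yNx).
rewrite [leLHS]ger0_norm ?normc_ge0//; apply: (le_trans _ (ler_norm _)).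
have yx0 : (y - x)%:C != 0 :> R[i].
  by apply/eqP => /complexI/eqP; rewrite subr_eq0 (negbTE yNx).
rewrite -{1}[w y - w x](divfK yx0) ComplexField.Normc.normcM normc_real ler_wpM2r//.
by rewrite -{1}[_ / _](subrK d) normc_triangle.
Qed.

(* A difference quotient of sm is only controlled inside the support, and
   z = sm * u holds only almost everywhere; such points still accumulate at x. *)
Lemma derivative_product (u z : fn R) (wu wz sm sm' : fn R) (x : R) (du dz : R[i]) :
  aeq wu u -> aeq wz z -> aeq z (fun x => sm x * u x) ->
  C1_on (ess_supp u) sm sm' ->
  normc ((wu y - wu x) / (y - x)%:C - du) @[y --> x^'] --> (0 : R) ->
  normc ((wz y - wz x) / (y - x)%:C - dz) @[y --> x^'] --> (0 : R) ->
  wz x = sm x * wu x -> wu x != 0 ->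
  dz = sm' x * wu x + sm x * du.
Proof.
move=> Eu Ez Es hC hu hz zx ux0.
pose good y := [/\ wu y = u y, wz y = z y & z y = sm y * u y].
have gae : {ae (@mu R), forall y, good y}.
  by move: Eu Ez Es; apply: ae_mono3.
(* [wu] is continuous at x, hence nonzero in a neighbourhood of x. *)
have [r r0 hr] : exists2 r : R, 0 < r & forall y, `|x - y| < r -> wu y != 0.
  have nx : 0 < normc (wu x).
    rewrite lt_neqAle normc_ge0 andbT eq_sym; apply: contra ux0 => /eqP.
    by move/ComplexField.Normc.eq0_normc => ->.
  have /cvgr0Pnorm_lt/(_ _ nx) [r /= r0 hr] := normc_sub_cvg0 hu.
  exists r => // y yr; have [->//|yNx] := eqVneq y x.
  have := hr y yr yNx; apply: contraTneq => ->.
  by rewrite sub0r normc_opp ger0_norm ?normc_ge0// ltxx.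
(* If y were outside the support, u would vanish almost everywhere near y; but at good points just
   to the right of y it equals [wu], which is nonzero. *)
have ess y : `|x - y| < r -> ess_supp u y.
  move=> yr [V [e /= e0 hV] uV].
  have re0 : 0 < Num.min e (r - `|x - y|) by rewrite lt_min e0 subr_gt0.
  have [y' [yy' y'e [gy' uy']]] : exists y', [/\ y < y',
      y' < y + Num.min e (r - `|x - y|) & good y' /\ (V y' -> u y' = 0)].
    by apply: ae_right_dense => //; move: gae uV; apply: ae_mono2.
  move: y'e; rewrite -ltrBlDl lt_min => /andP[y'e y'r].
  have dy : `|y - y'| = y' - y by rewrite distrC gtr0_norm// subr_gt0.
  have Vy' : V y' by apply: hV; rewrite /ball_ /= dy.
  have xy' : `|x - y'| < r.
    apply: le_lt_trans (ler_distD y x y') _.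
    by rewrite dy addrC -ltrBrDr.
  by have := hr _ xy'; case: gy' => -> _ _; rewrite uy'// eqxx.
(* Punctured neighbourhoods of x cut down to the points where all the almost-everywhere identities
   hold. *)
pose G := within good (x^').
have PG : ProperFilter G.
  apply: Build_ProperFilter_ex => P [e /= e0 hP].
  have [y [xy ye gy]] := ae_right_dense x e0 gae.
  exists y; apply: hP => //=; last by rewrite gt_eqF.
  by rewrite distrC gtr0_norm ?subr_gt0// ltrBlDl.
have Gx : G --> x^' by apply: cvg_within.
have hs : normc ((sm y - sm x) / (y - x)%:C - sm' x) @[y --> G] --> (0 : R).
  have xx : `|x - x| < r by rewrite subrr normr0.
  have [hs _] := hC x (ess x xx).
  apply: cvg_trans hs; move=> P [e /= e0 hP].
  exists (Num.min e r); first by rewrite /= lt_min e0 r0.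
  move=> y /= + yNx gy; rewrite lt_min => /andP[ye yr].
  by apply: hP => //; exact: ess.
have toG (g : R -> R) : g y @[y --> x^'] --> (0 : R) -> g y @[y --> G] --> (0 : R).
  by move=> hg P hP; exact: (Gx _ (hg P hP)).
have hu' := toG _ hu; have hz' := toG _ hz; have hd' := toG _ (normc_sub_cvg0 hu).
apply/eqP; rewrite -subr_eq0; apply/eqP/ComplexField.Normc.eq0_normc/eqP.
rewrite eq_le normc_ge0 andbT.
(* Bounds the distance between the two sides of the goal: the product rule for difference quotients,
   in which the increment of [sm] multiplies wu y = (wu y - wu x) + wu x. *)
pose q y := normc ((wz y - wz x) / (y - x)%:C - dz) +
  (normc ((sm y - sm x) / (y - x)%:C - sm' x) * (normc (wu y - wu x) + normc (wu x)) +
   (normc (sm' x) * normc (wu y - wu x) +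
    normc (sm x) * normc ((wu y - wu x) / (y - x)%:C - du))).
have hq : q y @[y --> G] --> (0 : R).
  apply: cvg0D => //; apply: cvg0D.
    rewrite -[0](mul0r (0 + normc (wu x))); apply: cvgM => //.
    by apply: cvgD => //; exact: cvg_cst.
  apply: cvg0D; first by rewrite -[0](mulr0 (normc (sm' x))); apply: cvgMr.
  by rewrite -[0](mulr0 (normc (sm x))); apply: cvgMr.
apply: (@near_le0_of_cvg0 _ _ _ PG _ q) => //.
exists 1 => //= y _ yNx [Euy Ezy Esy].
have yx0 : (y - x)%:C != 0 :> R[i].
  by apply/eqP => /complexI/eqP; rewrite subr_eq0 (negbTE yNx).
have -> : dz - (sm' x * wu x + sm x * du) =
   - ((wz y - wz x) / (y - x)%:C - dz) +
   (((sm y - sm x) / (y - x)%:C - sm' x) * ((wu y - wu x) + wu x) +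
    (sm' x * (wu y - wu x) + sm x * ((wu y - wu x) / (y - x)%:C - du))).
  by rewrite zx Ezy Esy -Euy; move: ((y - x)%:C) yx0 => h h0; field.
rewrite /q -(normc_opp (_ - dz)).
apply: le_trans (normc_triangle _ _) _; rewrite lerD2l.
apply: le_trans (normc_triangle _ _) _; apply: lerD.
  by rewrite ComplexField.Normc.normcM ler_wpM2l ?normc_ge0// normc_triangle.
by apply: le_trans (normc_triangle _ _) _; rewrite !ComplexField.Normc.normcM.
Qed.

Lemma increment_derivative (w v : fn R) : L2 v ->
  (forall a b : R, a <= b -> w b - w a = integral_cplx `]a, b] v) ->
  {ae (@mu R), forall x : R, normc ((w y - w x) / (y - x)%:C - v x) @[y --> x^'] --> (0 : R)}.
Proof.
move=> /L2_sqint[/loc_intg_sqint l1 /loc_intg_sqint l2] hw.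
have h1 := @lebesgue_derivative R _ (fun x => Re (w x)) l1.
have h2 := @lebesgue_derivative R _ (fun x => Im (w x)) l2.
have {}h1 : {ae (@mu R), forall x : R, is_derive x 1 (fun x => Re (w x)) (Re (v x))}.
  by apply: h1 => a b ab; rewrite -Re_opp -Re_add hw.
have {}h2 : {ae (@mu R), forall x : R, is_derive x 1 (fun x => Im (w x)) (Im (v x))}.
  by apply: h2 => a b ab; rewrite -Im_opp -Im_add hw.
by move: h1 h2; apply: ae_mono2 => x; exact: cplx_difference_quotient.
Qed.

(** The identity already holds between integrands: z' = S' u + S u' and |S| = 1 give conj(z) z' -
    conj(u) u' = |u|^2 conj(S) S' almost everywhere, with u' = i P u and z' = i P z. Integrability
    of the right side is inherited from the left. *)
Lemma eisenbud_wigner_momentum (u z pu pz sm sm' : fn R) :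
  momentum u pu -> momentum z pz -> measurable_cplx sm -> measurable_cplx sm' ->
  aeq z (fun x => sm x * u x) -> {ae (@mu R), forall x, normc (sm x) = 1} ->
  C1_on (ess_supp u) sm sm' ->
  integrable_cplx (fun x => (normc (u x) ^+ 2)%:C * (sm x)^* * sm' x) /\
  inner_prod z pz - inner_prod u pu = eisenbud_wigner u sm sm'.
Proof.
move=> [lu lpu [wu Eu hwu]] [lz lpz [wz Ez hwz]] msm msm' Es sm1 hC.
pose T x := (normc (u x) ^+ 2)%:C * (sm x)^* * sm' x.
have mT : measurable_cplx T.
  apply: measurable_cplx_mul => //; apply: measurable_cplx_mul; last exact: measurable_cplx_conj.
  by apply: measurable_cplx_real; apply: measurable_normc2; exact: L2_measurable.
have du := increment_derivative (L2Z _ lpu) hwu.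
have dz := increment_derivative (L2Z _ lpz) hwz.
have key : aeq T (fun x => 'i%R * ((z x)^*%R * pz x - (u x)^*%R * pu x)).
  have A : {ae (@mu R), forall x, (wu x = u x /\ wz x = z x) /\
      (z x = sm x * u x /\ normc (sm x) = 1)}.
    have A1 : {ae (@mu R), forall x, wu x = u x /\ wz x = z x} by move: Eu Ez; apply: ae_mono2.
    have A2 : {ae (@mu R), forall x, z x = sm x * u x /\ normc (sm x) = 1}.
      by move: Es sm1; apply: ae_mono2.
    by move: A1 A2; apply: ae_mono2.
  move: A du dz; apply: ae_mono3 => x [[Eux Ezx] [Esx s1]] dux dzx; rewrite /T.
  (* Where u vanishes so does z, and both integrands are 0; elsewhere the product rule applies. *)
  have [u0|u0] := eqVneq (u x) 0.
    rewrite Esx u0 mulr0 (_ : (0 : R[i])^*%R = 0); last first.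
      by apply: complex_ext; rewrite !reimE ?oppr0.
    by rewrite ComplexField.Normc.normc0 expr0n /= !mul0r subrr mulr0.
  have E : 'i%R * pz x = sm' x * wu x + sm x * ('i%R * pu x).
    have zx : wz x = sm x * wu x by rewrite Ezx Eux.
    have ux0 : wu x != 0 by rewrite Eux.
    exact: (derivative_product Eu Ez Es hC dux dzx zx ux0).
  have s2 : (sm x)^*%R * sm x = 1 by rewrite mulc_conj s1 expr1n.
  rewrite Eux in E.
  transitivity ((z x)^*%R * ('i%R * pz x) - (u x)^*%R * ('i%R * pu x)); last by ring.
  rewrite E Esx conj_mul -mulc_conj.
  transitivity ((u x)^*%R * u x * (sm x)^*%R * sm' x +
    ((sm x)^*%R * sm x - 1) * (u x)^*%R * ('i%R * pu x)); last by ring.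
  by rewrite s2 subrr !mul0r addr0.
have iB := integrable_cplxB (inner_integrable lz lpz) (inner_integrable lu lpu).
have iT : integrable_cplx T by apply: (integrable_cplx_ae mT key); exact: integrable_cplxZ.
split=> //.
have -> : inner_prod z pz - inner_prod u pu =
    integral_cplx setT (fun x => (z x)^*%R * pz x - (u x)^*%R * pu x).
  by rewrite integral_cplxB//; exact: inner_integrable.
rewrite /eisenbud_wigner -/T (integral_cplx_ae mT _ key); last first.
  by apply: integrable_cplx_measurable; exact: integrable_cplxZ.
rewrite integral_cplxZ// mulrA mulNr -expr2 sqrCi opprK mul1r//.
Qed.

End EisenbudWigner.

(** * Time delay *)

Section MomentumForm.
Context {R : realType}.
Implicit Types (u v w : fn R).
Local Notation mfun f := (measurable_fun [set: R] f).

(** Pairing with the indicator of a bounded interval containing J. Integrability is what makes the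
    integral formula for F available. *)
Lemma compact_support_integrable u (J : set R) : L2 u -> compact J ->
  aeq (fun x => (\1_J x)%:C * u x) u -> integrable_cplx u.
Proof.
move=> lu /compact_sub_itv[N JN] uJ.
have := inner_integrable (box_L2 (- N) N) lu.
apply: integrable_cplx_ae; first exact: L2_measurable.
apply: ae_mono uJ => x; rewrite !indicE /box.
have -> : ((\1_`]- N, N] x : R)%:C)^*%R = (\1_`]- N, N] x)%:C :> R[i].
  by apply: complex_ext; rewrite !reimE ?oppr0.
rewrite indicE; have [xN|xN] := boolP (x \in `]- N, N]%classic); first by rewrite mul1r.
by rewrite memNset ?mul0r// => /JN; rewrite -inE (negbTE xN).
Qed.

Variable F : op R.
Hypothesis hF : fourier_transform F.
Let isoF : isometric_op F. Proof. by case: hF => /unitary_isometric. Qed.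
Let F_L2 u : L2 u -> L2 (F u). Proof. by apply: bounded_L2; case: isoF. Qed.

(** Both sides are given by the integral formula, where the factor e^(-itx) adds t to the
    frequency. *)
Lemma fourier_shift t u : L2 u -> integrable_cplx u ->
  aeq (F (free_evolution t u)) (fun k => F u (k + t)).
Proof.
move=> lu iu; have [_ h] := hF.
have lf := L2_free_evolution t lu.
have if_ : integrable_cplx (free_evolution t u).
  apply: (integrable_cplx_le (L2_measurable lf) _ (intg_normc iu)) => x.
  by rewrite ComplexField.Normc.normcM normc_expi mul1r.
move: (h _ lf if_) (ae_translate t (h _ lu iu)); apply: ae_mono2 => k -> ->.
congr (_ * integral_cplx _ _); apply/funext => x.
by rewrite /free_evolution mulrA -expiD; congr (expi _ * _); ring.
Qed.

Variables (g : R -> R) (M d : R).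
Hypotheses (g_meas : mfun g) (g_ge0 : forall x, 0 <= g x) (g_le : forall x, g x <= M).
Hypotheses (d_gt0 : 0 < d) (g1 : forall x, `|x| < d -> g x = 1).

Let M_ge0 : 0 <= M. Proof. exact: le_trans (g_ge0 0) (g_le 0). Qed.

(** The expectation <u, g(P/r) u> on the Fourier side: a real number that does not involve the
    choice in [op_inverse]. *)
Definition momentum_form (r : R) u : R := \int[mu]_k (g (k / r) * normc (F u k) ^+ 2).

Let form_int r u : L2 u -> intg (fun k => g (k / r) * normc (F u k) ^+ 2).
Proof.
move=> lu; apply: (@intg_mul_bounded _ _ _ M).
- exact: measurable_fun_scaled.
- by move=> x; rewrite g_ge0 g_le.
- exact: L2_normc2 (F_L2 lu).
Qed.

Lemma momentum_form_ae r u v : L2 u -> L2 v -> aeq u v ->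
  momentum_form r u = momentum_form r v.
Proof.
move=> lu lv uv; apply: RI_ae; try exact: intg_measurable (form_int r _).
have := bounded_aeq isoF.1 lu lv uv; apply: ae_mono => x -> //.
Qed.

Lemma fun_momentum_form r u : L2 u ->
  let w := fun_momentum F (fun k => (g k)%:C) r u in
  [/\ L2 w, aeq (F w) (fun k => (g (k / r))%:C * F u k) &
      inner_prod u w = (momentum_form r u)%:C].
Proof.
move=> lu w; have lFu := F_L2 lu.
have lh : L2 (fun k => (g (k / r))%:C * F u k).
  apply: L2_le (L2Z M%:C lFu).
    apply: measurable_cplx_mul; last exact: L2_measurable.
    by apply: measurable_cplx_real; exact: measurable_fun_scaled.
  move=> k; rewrite !ComplexField.Normc.normcM !normc_real ler_wpM2r ?normc_ge0//.
  by rewrite !ger0_norm.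
have [lw Fw] := @fun_momentum_spec _ _ hF.1 (fun k => (g k)%:C) r u _ (aeq_refl _) lh.
split=> //; rewrite -(isometric_inner isoF lu lw).
rewrite (inner_ae _ _ _ _ (aeq_refl _) Fw); try (exact: L2_measurable); last 1 first.
  by apply: L2_measurable; exact: F_L2.
rewrite /inner_prod -integral_cplx_real; congr integral_cplx; apply/funext => k.
by rewrite mulrCA mulc_conj; apply: complex_ext; rewrite !reimE; ring.
Qed.

(** The difference of |a|^2 and |b|^2 is at most |a - b| (|a| + |b|); Cauchy-Schwarz does the rest.
    The bound is independent of r, as domination for large r requires. *)
Lemma momentum_form_dist r u v : L2 u -> L2 v ->
  `|momentum_form r u - momentum_form r v| <=
  M * (norm2 (fun x => u x - v x) * (norm2 u + norm2 v)).
Proof.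
move=> lu lv; have [lFu lFv] := (F_L2 lu, F_L2 lv).
have absL2 w : L2 w -> L2 (fun x => (normc (w x))%:C) /\
    norm2 (fun x => (normc (w x))%:C) = norm2 w.
  move=> lw; split.
    apply: (L2_le _ _ lw).
      by apply: measurable_cplx_real; apply: measurable_normc; exact: L2_measurable.
    by move=> x; rewrite normc_real ger0_norm ?normc_ge0.
  by rewrite /norm2; congr Num.sqrt; apply: RI_ext => x; rewrite normc_real ger0_norm ?normc_ge0.
(* Cauchy-Schwarz for the vectors |w| and |w'|, which have the norms of w and w'. *)
have CS (w w' : fn R) : L2 w -> L2 w' -> intg (fun x => normc (w x) * normc (w' x)) /\
    \int[mu]_x (normc (w x) * normc (w' x)) <= norm2 w * norm2 w'.
  move=> lw lw'; have [[l n] [l' n']] := (absL2 _ lw, absL2 _ lw').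
  have E : inner_prod (fun x => (normc (w x))%:C) (fun x => (normc (w' x))%:C) =
     (\int[mu]_x (normc (w x) * normc (w' x)))%:C.
    rewrite -integral_cplx_real; congr integral_cplx; apply/funext => x.
    by apply: complex_ext; rewrite !reimE; ring.
  split; last first.
    by have := cauchy_schwarz l l'; rewrite E normc_real n n'; apply: le_trans; exact: ler_norm.
  have [i _] := inner_integrable l l'; move: i; congr (_.-integrable _ _).
  by apply/funext => x; rewrite [RHS]/=; congr EFin; rewrite !reimE; ring.
have [i1 c1] := CS _ _ (L2B lFu lFv) lFu.
have [i2 c2] := CS _ _ (L2B lFu lFv) lFv.
rewrite /momentum_form -RIB; try exact: form_int.
apply: (le_trans (RI_abs _)); first by apply: intgB; exact: form_int.
apply: (@le_trans _ _ (\int[mu]_x (M * (normc (F u x - F v x) * normc (F u x) +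
    normc (F u x - F v x) * normc (F v x))))).
  apply: RI_le; [by apply: intg_abs; apply: intgB; exact: form_int|by apply: intgZ; exact: intgD|].
  move=> x; rewrite -mulrBr normrM ger0_norm// ler_pM//.
  rewrite -mulrDr subr_sqr normrM ler_pM//; last first.
    by rewrite ger0_norm ?addr_ge0 ?normc_ge0.
  rewrite ler_norml; apply/andP; split.
    rewrite lerNl opprB lerBlDr -(normc_opp (F u x - _)) opprB.
    by apply: le_trans (normc_triangle _ _); rewrite subrK.
  by rewrite lerBlDr; apply: le_trans (normc_triangle _ _); rewrite subrK.
rewrite RIZ; last exact: intgD.
rewrite RID// ler_wpM2l// mulrDr -(isometric_dist isoF lu lv).
by case: isoF => _ iF; rewrite -(iF _ lu) -(iF _ lv) lerD.
Qed.

(** For each k, g(k/r) = 1 once r > |k| / d, and M |F u|^2 dominates. *)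
Lemma momentum_form_limit u : L2 u ->
  momentum_form r u @[r --> +oo] --> norm2 u ^+ 2.
Proof.
move=> lu; have lFu := F_L2 lu; have iF := L2_normc2 lFu.
case: isoF => _ /(_ _ lu) <-; rewrite norm2_sq.
apply: (@RI_dominated_pinfty _ _ _ (fun k => M * normc (F u k) ^+ 2)).
- by move=> r _; exact: intg_measurable (form_int r lu).
- exact: intg_measurable.
- move=> k; apply: cvg_near_cst; exists (`|k| / d); split; first exact: num_real.
  move=> r; rewrite ltr_pdivrMr// => kr.
  have r0 : 0 < r by rewrite -(pmulr_lgt0 _ d_gt0) (le_lt_trans _ kr).
  by rewrite g1 ?mul1r// normrM normfV (gtr0_norm r0) ltr_pdivrMr// mulrC.
- exact: intgZ.
- by move=> r k _; rewrite normrM (ger0_norm (g_ge0 _)) (ger0_norm (sqr_ge0 _)) ler_wpM2r// sqr_ge0.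
Qed.

Lemma momentum_form_free r t u : L2 u -> integrable_cplx u ->
  momentum_form r (free_evolution t u) =
  \int[mu]_k (g ((k - t) / r) * normc (F u k) ^+ 2).
Proof.
move=> lu iu; have mFu := measurable_normc2 (L2_measurable (F_L2 lu)).
pose h k := g ((k - t) / r) * normc (F u k) ^+ 2.
have mh : mfun h.
  apply: measurable_funM => //; apply: (measurableT_comp (measurable_fun_scaled g_meas r)).
  exact: measurable_funB.
transitivity (\int[mu]_k h (k + t)).
  apply: RI_ae.
  - exact: intg_measurable (form_int _ (L2_free_evolution _ lu)).
  - by apply: (measurableT_comp mh); exact: measurable_funD.
  - by have := fourier_shift t lu iu; apply: ae_mono => k ->; rewrite /h addrK.
rewrite /Rintegral; congr fine.
apply: (@ge0_integral_translate _ t (EFin \o h)); first exact/measurable_EFinP.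
by move=> k; rewrite lee_fin mulr_ge0// sqr_ge0.
Qed.

End MomentumForm.

(** * Full evolution against free evolution *)

Section TimeDelay.
Context {R : realType}.
Implicit Types (u v w : fn R).
Local Notation mfun f := (measurable_fun [set: R] f).
Variable F : op R.
Hypothesis hF : fourier_transform F.
Variables (D : set (fn R)) (H : op R) (U : R -> op R).
Hypothesis hU : evolution_group D H U.
Variables (g : R -> R) (M d : R).
Hypotheses (g_meas : mfun g) (g_ge0 : forall x, 0 <= g x) (g_le : forall x, g x <= M).
Hypothesis g_int : forall r : R, 0 < r -> intg (fun x : R => g (x / r)).
Hypotheses (d_gt0 : 0 < d) (g1 : forall x, `|x| < d -> g x = 1).
Local Notation q := (momentum_form F g).

Let isoU t : isometric_op (U t).
Proof. by apply: unitary_isometric; case: hU. Qed.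

Let U_L2 t u : L2 u -> L2 (U t u). Proof. by apply: bounded_L2; case: (isoU t). Qed.

Let M_ge0 : 0 <= M. Proof. exact: le_trans (g_ge0 0) (g_le 0). Qed.

Lemma continuous_squeeze (f : R -> R) (h : R -> R -> R) :
  (forall s t, `|f s - f t| <= h s t) -> (forall t, h s t @[s --> t] --> (0 : R)) ->
  continuous f.
Proof.
move=> fh h0 t; apply/cvgrPdist_lt => e e0.
move/cvgr0Pnorm_lt : (h0 t) => /(_ e e0) [r /= r0 hr].
exists r => // s sr; rewrite distrC; apply: le_lt_trans (fh s t) _.
exact: le_lt_trans (ler_norm _) (hr s sr).
Qed.

(** Measurability in time comes from continuity: the form is Lipschitz on vectors of norm N, and the
    orbit is norm-continuous. *)
Lemma momentum_form_measurable (x : R -> fn R) (N r : R) :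
  (forall t, L2 (x t)) -> (forall t, norm2 (x t) = N) ->
  (forall t, norm2 (fun y => x s y - x t y) @[s --> t] --> (0 : R)) ->
  mfun (fun t => q r (x t)).
Proof.
move=> lx nx cx; apply: continuous_measurable_fun.
apply: (@continuous_squeeze _ (fun s t => M * (norm2 (fun y => x s y - x t y) * (N + N)))).
  by move=> s t; rewrite -{1}(nx s) -(nx t); apply: (momentum_form_dist hF).
move=> t; rewrite -(mulr0 M) -(mul0r (N + N)).
by apply: cvgMr; apply: cvgMl.
Qed.

(** * An orbit and its free asymptote, for either half-line *)

Section Half.
Variables (v phi : fn R) (W : op R).
Hypotheses (lv : L2 v) (lphi : L2 phi) (isoW : isometric_op W).
Hypothesis intertwine : forall t, aeq (U t v) (W (free_evolution t phi)).

Let e t := free_evolution t phi.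
Let e_L2 t : L2 (e t). Proof. exact: L2_free_evolution. Qed.
Let W_L2 u : L2 u -> L2 (W u). Proof. by apply: bounded_L2; case: isoW. Qed.
Let defect t := norm2 (fun x => W (e t) x - e t x).

(** The isometry [W] carries the free orbit to U t v, so the free orbit inherits strong continuity
    from [U]. *)
Let e_dist s t : norm2 (fun x => e s x - e t x) = norm2 (fun x => U s v x - U t v x).
Proof.
rewrite -(isometric_dist isoW (e_L2 s) (e_L2 t)); apply: norm2_ae.
- by apply/L2_measurable/L2B; exact: W_L2.
- by apply/L2_measurable/L2B; exact: U_L2.
- by move: (intertwine s) (intertwine t); apply: ae_mono2 => x -> ->.
Qed.

Let e_continuous t : norm2 (fun x => e s x - e t x) @[s --> t] --> (0 : R).
Proof. by under eq_fun do rewrite e_dist; exact: (strongly_continuous hU lv). Qed.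

Lemma defect_measurable : mfun defect.
Proof.
apply: continuous_measurable_fun.
apply: (@continuous_squeeze _ (fun s t =>
  norm2 (fun y => e s y - e t y) + norm2 (fun y => e s y - e t y))).
  move=> s t; apply: le_trans (norm2_dist _ _) _; try (by apply: L2B => //; exact: W_L2).
  have -> : (fun x => W (e s) x - e s x - (W (e t) x - e t x)) =
     (fun x => (W (e s) x - W (e t) x) + (e t x - e s x)).
    by apply/funext => x; ring.
  apply: le_trans (norm2_triangle _ _) _; try (by apply: L2B => //; exact: W_L2).
  by rewrite (norm2_sym (e t)) isometric_dist.
by move=> t; exact: cvg0D.
Qed.

Variable chi : R -> R.
Hypotheses (chi_meas : mfun chi) (chi01 : forall t, 0 <= chi t <= 1).
Hypothesis chi_defect : intg (fun t => chi t * defect t).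

Let norm_Uv t : norm2 (U t v) = norm2 phi.
Proof.
rewrite -(norm2_free_evolution t phi) -(isoW.2 _ (e_L2 t)); apply: norm2_ae.
- exact/L2_measurable/U_L2.
- exact/L2_measurable/W_L2.
- exact: intertwine.
Qed.

Let gap r t := chi t * (q r (U t v) - q r (e t)).

Let gap_measurable r : mfun (gap r).
Proof.
apply: measurable_funM => //; apply: measurable_funB.
  apply: (@momentum_form_measurable _ (norm2 phi)) => //.
    by move=> t; exact: U_L2.
  exact: (strongly_continuous hU lv).
by apply: (@momentum_form_measurable _ (norm2 phi)) => // t; exact: norm2_free_evolution.
Qed.

(** U t v is W e^(-itQ) phi, which has the norm of phi and lies at distance [defect t] from e^(-itQ)
    phi. The majorant is free of r. *)
Let gap_le r t : `|gap r t| <= (M * (norm2 phi + norm2 phi)) * (chi t * defect t).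
Proof.
have /andP[c0 _] := chi01 t; rewrite normrM (ger0_norm c0).
rewrite [leRHS]mulrCA ler_wpM2l//.
rewrite (momentum_form_ae hF g_meas g_ge0 g_le r (U_L2 t lv) (W_L2 (e_L2 t)) (intertwine t)).
have := momentum_form_dist hF g_meas g_ge0 g_le r (W_L2 (e_L2 t)) (e_L2 t).
rewrite (isoW.2 _ (e_L2 t)) norm2_free_evolution => h; apply: (le_trans h).
by rewrite -mulrA ler_wpM2l// mulrC.
Qed.

Lemma half_gap_integrable r : intg (fun t => chi t * (q r (U t v) - q r (free_evolution t phi))).
Proof. exact: (intg_le (gap_measurable r) (gap_le r) (intgZ _ chi_defect)). Qed.

(** At each fixed t both forms tend to ||phi||^2, the squared norm of U t v and of e^(-itQ) phi. *)
Lemma half_gap_limit :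
  \int[mu]_t (chi t * (q r (U t v) - q r (free_evolution t phi))) @[r --> +oo] --> (0 : R).
Proof.
have -> : (0 : R) = \int[@mu R]_t (0 : R) by rewrite Rintegral_cst ?mul0r.
apply: (@RI_dominated_pinfty _ _ _ (fun t => (M * (norm2 phi + norm2 phi)) * (chi t * defect t))).
- by move=> r _; exact: gap_measurable.
- exact: measurable_cst.
- move=> t; rewrite -(mulr0 (chi t)) -(subrr (norm2 phi ^+ 2)); apply: cvgMr.
  apply: cvgB.
    by rewrite -(norm_Uv t); exact: (momentum_form_limit hF g_meas g_ge0 g_le d_gt0 g1 (U_L2 t lv)).
  rewrite -(norm2_free_evolution t phi).
  exact: (momentum_form_limit hF g_meas g_ge0 g_le d_gt0 g1 (e_L2 t)).
- exact: intgZ.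
- by move=> r t _; exact: gap_le.
Qed.

End Half.

Variables (v phi psi : fn R) (Wm Wp : op R).
Hypotheses (lv : L2 v) (lphi : L2 phi) (lpsi : L2 psi).
Hypotheses (iphi : integrable_cplx phi) (ipsi : integrable_cplx psi).
Hypotheses (isoWm : isometric_op Wm) (isoWp : isometric_op Wp).
Hypothesis intertwine_m : forall t, aeq (U t v) (Wm (free_evolution t phi)).
Hypothesis intertwine_p : forall t, aeq (U t v) (Wp (free_evolution t psi)).
Hypothesis norm_psi : norm2 psi = norm2 phi.
Hypothesis phi_in : (\int[@mu R]_(t in `]-oo, 0%R])
     (norm2 (fun x => Wm (free_evolution t phi) x - free_evolution t phi x))%:E
       < +oo)%E.
Hypothesis psi_out : (\int[@mu R]_(t in `[0%R, +oo[)
     (norm2 (fun x => Wp (free_evolution t psi) x - free_evolution t psi x))%:E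
       < +oo)%E.
Hypotheses (kphi : intg (fun k => k * normc (F phi k) ^+ 2))
  (kpsi : intg (fun k => k * normc (F psi k) ^+ 2)).

(** [chip] and [chim] add up to 1 at every t; the point 0 goes to [chip]. *)
Let chip : R -> R := \1_`[0, +oo[.
Let chim t := 1 - chip t.

Let chip01 t : 0 <= chip t <= 1. Proof. by rewrite /chip indicE ler0n lern1 leq_b1. Qed.
Let chim01 t : 0 <= chim t <= 1.
Proof. by have /andP[? ?] := chip01 t; apply/andP; split; rewrite /chim; lra. Qed.
Let mchip : mfun chip. Proof. exact: measurable_indic. Qed.
Let mchim : mfun chim. Proof. exact: measurable_funB. Qed.

Let restrict_intg (A : set R) (chi n : R -> R) : measurable A -> mfun chi -> mfun n ->
  (forall t, 0 <= n t) -> (forall t, 0 <= chi t <= \1_A t) ->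
  (\int[@mu R]_(t in A) (n t)%:E < +oo)%E -> intg (fun t => chi t * n t).
Proof.
move=> mA mchi mn n0 cA nA; apply: RI_ge0_lty; first exact: measurable_funM.
  by move=> t; rewrite mulr_ge0//; case/andP: (cA t).
apply: le_lt_trans nA; rewrite [leRHS]integral_mkcond.
apply: ge0_le_integral => //.
- by move=> t _; rewrite lee_fin mulr_ge0//; case/andP: (cA t).
- by apply/measurable_EFinP; exact: measurable_funM.
- by apply/(measurable_restrictT _ _).1 => //; exact/measurable_EFinP/measurable_funTS.
- move=> t _; rewrite patchE; have /andP[c0] := cA t; rewrite indicE.
  case: ifP => _ c1; rewrite lee_fin; first by apply: ler_piMl.
  by rewrite (@le_anti _ _ (chi t) 0) ?c0 ?c1// mul0r.
Qed.

Let free r u t := q r (free_evolution t u).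

Let free_E r u t : L2 u -> integrable_cplx u ->
  free r u t = \int[mu]_k (g ((k - t) / r) * normc (F u k) ^+ 2).
Proof. by move=> lu iu; exact: momentum_form_free. Qed.

Let F2 u : L2 u -> intg (fun k => normc (F u k) ^+ 2).
Proof.
move=> lu; apply: L2_normc2; apply: bounded_L2 => //.
by case: hF => /unitary_isometric[].
Qed.

Let free_chi r u (chi : R -> R) t : 0 < r -> L2 u -> integrable_cplx u ->
  chi t * free r u t = \int[mu]_k (chi t * (g ((k - t) / r) * normc (F u k) ^+ 2)).
Proof.
move=> r0 lu iu; rewrite free_E// RIZ//; apply: (@intg_mul_bounded _ _ _ M).
- by apply: (measurableT_comp (measurable_fun_scaled g_meas r)); exact: measurable_funB.
- by move=> k; rewrite g_ge0 g_le.
- exact: F2.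
Qed.

Let free_chi_intg r u (chi : R -> R) : 0 < r -> L2 u -> integrable_cplx u ->
  mfun chi -> (forall t, 0 <= chi t <= 1) -> intg (fun t => chi t * free r u t).
Proof.
move=> r0 lu iu mchi c01; under eq_fun do rewrite free_chi//.
have sq0 k : 0 <= normc (F u k) ^+ 2 by exact: sqr_ge0.
by have [] := free_time_tonelli g_meas g_ge0 g_le g_int r0 mchi c01 sq0 (F2 lu).
Qed.

Lemma free_time_integrable r : 0 < r -> intg (fun t => q r (free_evolution t phi)).
Proof.
move=> r0; have := @free_chi_intg r phi (fun=> 1) r0 lphi iphi (measurable_cst _).
move=> /(_ (fun _ => _))/wrap[|]; first by rewrite ler01 lexx.
by under eq_fun do rewrite mul1r.
Qed.

Let gapm r t := chim t * (q r (U t v) - free r phi t).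
Let gapp r t := chip t * (q r (U t v) - free r psi t).

Let gapm_spec : (forall r, intg (gapm r)) /\ \int[mu]_t gapm r t @[r --> +oo] --> (0 : R).
Proof.
have h : intg (fun t => chim t *
    norm2 (fun x => Wm (free_evolution t phi) x - free_evolution t phi x)).
  apply: (restrict_intg (measurable_itv _) mchim _ _ _ phi_in).
  - exact: defect_measurable lv lphi isoWm intertwine_m.
  - by move=> t; exact: norm2_ge0.
  - move=> t; have /andP[-> _] := chim01 t; rewrite /chim /chip !indicE !mem_setE !in_itv /= andbT.
    by case: (ltgtP t 0) => //= _; lra.
split; first by move=> r; exact: (half_gap_integrable lv lphi isoWm intertwine_m mchim chim01 h).
exact: (half_gap_limit lv lphi isoWm intertwine_m mchim chim01 h).
Qed.

Let gapp_spec : (forall r, intg (gapp r)) /\ \int[mu]_t gapp r t @[r --> +oo] --> (0 : R).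
Proof.
have h : intg (fun t => chip t *
    norm2 (fun x => Wp (free_evolution t psi) x - free_evolution t psi x)).
  apply: (restrict_intg (measurable_itv _) mchip _ _ _ psi_out).
  - exact: defect_measurable lv lpsi isoWp intertwine_p.
  - by move=> t; exact: norm2_ge0.
  - by move=> t; have /andP[-> _] := chip01 t; rewrite lexx.
split; first by move=> r; exact: (half_gap_integrable lv lpsi isoWp intertwine_p mchip chip01 h).
exact: (half_gap_limit lv lpsi isoWp intertwine_p mchip chip01 h).
Qed.

(** The orbit is compared with phi for t < 0 and with psi for t >= 0. The free term of phi is then
    completed to all times, so that it is exactly the integrand of T^0_r. *)
Let full_split r t : q r (U t v) = gapm r t + (gapp r t +
  (chip t * free r psi t - chip t * free r phi t)) + free r phi t.
Proof. by rewrite /gapm /gapp /chim; ring. Qed.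

Let diff_intg r : 0 < r -> intg (fun t => gapm r t + (gapp r t +
  (chip t * free r psi t - chip t * free r phi t))).
Proof.
move=> r0; apply: intgD; first by case: gapm_spec.
by apply: intgD; [case: gapp_spec|apply: intgB; exact: free_chi_intg].
Qed.

Lemma full_time_integrable r : 0 < r -> intg (fun t => q r (U t v)).
Proof.
move=> r0; under eq_fun do rewrite full_split.
by apply: intgD; [exact: diff_intg|exact: free_time_integrable].
Qed.

Lemma time_delay_limit :
  \int[mu]_t q r (U t v) - \int[mu]_t q r (free_evolution t phi) @[r --> +oo] -->
  \int[mu]_k (k * normc (F psi k) ^+ 2) - \int[mu]_k (k * normc (F phi k) ^+ 2).
Proof.
have sq0 u k : 0 <= normc (F u k) ^+ 2 by exact: sqr_ge0.
have nn : \int[mu]_k (normc (F phi k) ^+ 2) = \int[mu]_k (normc (F psi k) ^+ 2).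
  case: hF => /unitary_isometric[_ iF] _.
  by rewrite -!norm2_sq !iF// norm_psi.
have L := free_half_time_limit g_meas g_ge0 g_le g_int d_gt0 g1 (sq0 phi) (sq0 psi)
  (F2 lphi) (F2 lpsi) kphi kpsi nn.
rewrite -[X in _ --> X]add0r -[X in _ --> 0 + X]add0r.
pose halves r := \int[mu]_t gapm r t + (\int[mu]_t gapp r t +
  (\int[mu]_t \int[mu]_k (\1_`[0, +oo[ t * (g ((k - t) / r) * normc (F psi k) ^+ 2)) -
   \int[mu]_t \int[mu]_k (\1_`[0, +oo[ t * (g ((k - t) / r) * normc (F phi k) ^+ 2)))).
apply: (@cvg_trans _ (halves r @[r --> +oo])); last first.
  by apply: cvgD; [case: gapm_spec|apply: cvgD; [case: gapp_spec|exact: L]].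
apply: near_eq_cvg; exists 0; split; first exact: num_real.
move=> r r0; rewrite /halves.
under [in RHS]RI_ext do rewrite full_split.
rewrite [in RHS]RID; [|exact: diff_intg|exact: free_time_integrable].
(* The free time of phi cancels here, at finite r. *)
rewrite addrK RID; last 2 first.
- by case: gapm_spec.
- by apply: intgD; [case: gapp_spec|apply: intgB; exact: free_chi_intg].
rewrite RID; last 2 first.
- by case: gapp_spec.
- by apply: intgB; exact: free_chi_intg.
rewrite RIB; try exact: free_chi_intg.
by congr (_ + (_ + (_ - _))); apply: RI_ext => t; rewrite free_chi.
Qed.

End TimeDelay.

(** * Sobolev regularity and the pointwise profile *)

Section Profile.
Context {R : realType}.
Implicit Types (u v w : fn R).
Local Notation mfun f := (measurable_fun [set: R] f).

Lemma japanese_measurable : mfun (@japanese R).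
Proof.
have m : mfun (fun x => 1 + x ^+ 2) by apply: measurable_funD => //; exact: measurable_funX.
exact: (measurableT_comp (continuous_measurable_fun (@sqrt_continuous R)) m).
Qed.

Lemma japanese_powR_measurable (p : R) : mfun (fun x => japanese x `^ p).
Proof. exact: (measurableT_comp (measurable_powR p) japanese_measurable). Qed.

Lemma japanese_gt0 (x : R) : 0 < japanese x.
Proof. by rewrite (lt_le_trans _ (japanese_ge x).1). Qed.

(** As s >= 1, both |k| |u| and <k> |u| are at most <k>^s |u|. Integrability comes from writing |u|
    as the product of <k>^(-1) and <k> |u|, two square-integrable factors. *)
Lemma sobolev_moment (s : R) u : 1 <= s -> measurable_cplx u -> sobolev s u ->
  L2 (fun k => k%:C * u k) /\ integrable_cplx u.
Proof.
move=> s1 mu_ su.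
have jn k : normc (sobolev_weight s u k) = japanese k `^ s * normc (u k).
  by rewrite ComplexField.Normc.normcM normc_real ger0_norm ?powR_ge0.
have js k : japanese k * normc (u k) <= normc (sobolev_weight s u k).
  rewrite jn ler_wpM2r ?normc_ge0// -[leLHS](powRr1 (ltW (japanese_gt0 k))).
  by rewrite ler_powR// (japanese_ge k).1.
split.
  apply: (L2_le _ _ su).
    by apply: measurable_cplx_mul => //; apply: measurable_cplx_real.
  move=> k; apply: le_trans (js k).
  rewrite ComplexField.Normc.normcM normc_real ler_wpM2r ?normc_ge0//.
  by case: (japanese_ge k).
(* A product is at most the sum of the squares; the coefficient of [power_tail] is that of
   [japanese_powR_le] with p = 2 and r = 1. *)
apply: (integrable_cplx_le mu_ (g := fun k => (1 + 1 `^ 2) * power_tail 2 k +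
   normc (sobolev_weight s u k) ^+ 2)).
  move=> k; have := @japanese_powR_le _ 2 1 k (ltr0n _ 2) ltr01.
  rewrite divr1 => h; apply: (le_trans _ (lerD h (lexx _))).
  have j0 := japanese_gt0 k.
  have -> : japanese k `^ (- 2) = (japanese k)^-1 ^+ 2.
    by rewrite powRN (powR_mulrn 2 (ltW j0)) exprVn.
  have jk := js k; have n0 := normc_ge0 (u k).
  have -> : normc (u k) = (japanese k)^-1 * (japanese k * normc (u k)).
    by rewrite mulrA mulVf ?mul1r// gt_eqF.
  apply: (@le_trans _ _ ((japanese k)^-1 * normc (sobolev_weight s u k))).
    by rewrite ler_wpM2l// invr_ge0 ltW.
  have : 0 <= (japanese k)^-1 by rewrite invr_ge0 ltW.
  have := normc_ge0 (sobolev_weight s u k).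
  by move: (_^-1) (normc (sobolev_weight _ _ _)) => a b; nra.
apply: intgD; last exact: L2_normc2.
by apply: intgZ; apply: intg_power_tail; rewrite ltr1n.
Qed.

(** [F] is onto, and the preimage of k F u is P u. *)
Lemma momentum_spec (F : op R) (s : R) u : fourier_transform F -> 1 <= s -> L2 u ->
  sobolev s (F u) ->
  exists pu, [/\ momentum u pu,
    inner_prod u pu = (\int[mu]_k (k * normc (F u k) ^+ 2))%:C &
    intg (fun k => k * normc (F u k) ^+ 2)].
Proof.
move=> hF s1 lu su; have lFu : L2 (F u) by apply: bounded_L2 => //; case: hF => -[].
have [lk iu] := sobolev_moment s1 (L2_measurable lFu) su.
have [_ _ /(_ _ lk) [pu lpu Fpu]] := hF.1.
have [m1 m2] := momentum_of_fourier hF lu lk iu lpu Fpu.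
exists pu; split=> //.
have [i _] := inner_integrable lFu lk; move: i; congr (_.-integrable _ _).
by apply/funext => k; rewrite [RHS]/=; congr EFin; rewrite mulrCA mulc_conj !reimE; ring.
Qed.

(* A representative of f satisfying its bounds at every point. *)
Lemma regular_profile (f : R -> R[i]) : measurable_cplx f ->
  {ae (@mu R), forall x, 0 <= f x} ->
  (exists rho C : R, [/\ 1 < rho, 0 < C &
     {ae (@mu R), forall x, normc (f x) <= C * japanese x `^ (- rho)}]) ->
  (exists2 delta : R, 0 < delta &
     {ae (@mu R), forall x, - delta < x < delta -> f x = 1}) ->
  exists (g : R -> R) (M d : R), [/\ mfun g, forall x, 0 <= g x <= M,
    forall r : R, 0 < r -> intg (fun x : R => g (x / r)),
    0 < d /\ (forall x, `|x| < d -> g x = 1) &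
    {ae (@mu R), forall x, f x = (g x)%:C}].
Proof.
move=> [mf1 mf2] f0 [rho [C [rho1 C0 fC]]] [d d0 f1].
have rho0 : 0 < rho by rewrite (lt_trans _ rho1).
(* [g] is 1 on ]-d, d[ and elsewhere the real part of f clipped between 0 and the decay bound; by
   the hypotheses this changes f on a null set only. *)
pose bump : R -> R := \1_`]- d, d[.
pose tail x := Num.min (Num.max 0 (Re (f x))) (C * japanese x `^ (- rho)).
pose g x := bump x + (1 - bump x) * tail x.
have bE x : bump x = (`|x| < d)%R%:R.
  by rewrite /bump indicE mem_setE in_itv /= ltr_norml.
have t0 x : 0 <= tail x by rewrite le_min le_max lexx mulr_ge0 ?powR_ge0// ltW.
have tC x : tail x <= C * japanese x `^ (- rho) by rewrite ge_min lexx orbT.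
have mbump : mfun bump by exact: measurable_indic.
have mtail : mfun tail.
  apply: measurable_minr; first by apply: measurable_maxr.
  by apply: measurable_funM => //; exact: japanese_powR_measurable.
have mg : mfun g.
  by apply: measurable_funD => //; apply: measurable_funM => //; exact: measurable_funB.
have g0 x : 0 <= g x.
  by rewrite /g bE; case: (`|x| < d) => /=; rewrite ?subrr ?mul0r ?addr0// add0r subr0 mul1r.
have gle x : g x <= bump x + tail x.
  by rewrite lerD2l bE; case: (`|x| < d) => /=; rewrite ?subrr ?mul0r ?t0// subr0 mul1r.
exists g, (1 + C), d; split => //.
- move=> x; rewrite g0 (le_trans (gle x))// lerD//; first by rewrite bE lern1 leq_b1.
  have J1 : japanese x `^ (- rho) <= 1.
    rewrite powRN invf_le1; last by rewrite powR_gt0// japanese_gt0.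
    have -> : 1 = 1 `^ rho :> R by rewrite powR1.
    have [j1 _] := japanese_ge x; have j0 := ltW (japanese_gt0 x).
    by apply: ge0_ler_powR => //; exact: ltW.
  by apply: (le_trans (tC x)); rewrite -[leRHS]mulr1; apply: ler_wpM2l => //; exact: ltW.
- move=> r r0; apply: (@intg_le _ _ (fun x => \1_`]- (d * r), d * r[ x +
     C * ((1 + r `^ rho) * power_tail rho x))).
  + exact: measurable_fun_scaled.
  + move=> x; rewrite ger0_norm//; apply: (le_trans (gle _)); apply: lerD.
      by rewrite bE normrM normfV (gtr0_norm r0) ltr_pdivrMr// indicE mem_setE in_itv /= ltr_norml.
    by apply: (le_trans (tC _)); apply: ler_wpM2l; [exact: ltW|exact: japanese_powR_le].
  + apply: intgD; first exact: integrable_indic_itv.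
    by apply: intgZ; apply: intgZ; exact: intg_power_tail.
- by split=> // x xd; rewrite /g bE xd subrr mul0r addr0.
- move: f0 fC f1; apply: ae_mono3 => x fx0 fxC fx1.
  rewrite /g bE; have [xd|xd] := boolP (`|x| < d).
    by rewrite subrr mul0r addr0 fx1// -ltr_norml.
  rewrite add0r subr0 mul1r /tail.
  move: fx0; rewrite lecE => /andP[/eqP /= i0 r0].
  rewrite max_r// min_l; first by apply: complex_ext.
  by apply: le_trans fxC; apply: le_trans (ler_norm _) (Re_le_normc _).
Qed.

End Profile.

(** * Projections and complex limits *)

Section FinalSteps.
Context {R : realType}.
Implicit Types (u v w : fn R).

(** An idempotent profile makes g(P/r) an orthogonal projection, whose expectation is a squared
    norm. *)
Lemma norm2_fun_momentum (F : op R) (g : R -> R) (M r : R) u : fourier_transform F ->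
  measurable_fun setT g -> (forall x, 0 <= g x) -> (forall x, g x <= M) ->
  {ae (@mu R), forall k, g (k / r) ^+ 2 = g (k / r)} -> L2 u ->
  norm2 (fun_momentum F (fun k => (g k)%:C) r u) ^+ 2 = momentum_form F g r u.
Proof.
move=> hF mg g0 gM gg lu; have isoF := unitary_isometric hF.1.
have [lw Fw _] := fun_momentum_form hF mg g0 gM r lu.
have lFu : L2 (F u) by apply: bounded_L2 => //; case: isoF.
have mgr : measurable_fun setT (fun k : R => g (k / r)) by exact: measurable_fun_scaled.
rewrite -(isoF.2 _ lw) norm2_sq; apply: RI_ae.
- by apply: measurable_normc2; apply: L2_measurable; apply: bounded_L2 => //; case: isoF.
- by apply: measurable_funM => //; apply: measurable_normc2; exact: L2_measurable.
- move: Fw gg; apply: ae_mono2 => k -> gk.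
  by rewrite ComplexField.Normc.normcM exprMn normc_real (ger0_norm (g0 _)) gk.
Qed.

Lemma cvg_cplx_near (a b : R -> R[i]) (l : R[i]) : (forall r, 0 < r -> a r = b r) ->
  cvg_cplx b +oo l -> cvg_cplx a +oo l.
Proof.
move=> ab; apply: cvg_trans; apply: near_eq_cvg; exists 0; split; first exact: num_real.
by move=> r r0; rewrite ab.
Qed.

Lemma cvg_cplx_real (a : R -> R) (l : R) : a r @[r --> +oo] --> l ->
  cvg_cplx (fun r => (a r)%:C) +oo l%:C.
Proof.
move=> al; rewrite /cvg_cplx; under eq_fun do rewrite -rmorphB normc_real.
rewrite -(normr0 R) -(subrr l); apply: cvg_norm; apply: cvgB => //; exact: cvg_cst.
Qed.

End FinalSteps.

Theorem mainTheorem3 (R : realType)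
  (* the Fourier transform, used for functions of P and Sobolev spaces *)
  (F : op R) (hF : fourier_transform F)
  (* the localization function f *)
  (f : R -> R[i])
  (f_meas : measurable_cplx f)
  (f_bounded : exists M : R,
     {ae @lebesgue_measure R, forall x, ComplexField.Normc.normc (f x) <= M})
  (f_ge0 : {ae @lebesgue_measure R, forall x, 0 <= f x})
  (f_even : {ae @lebesgue_measure R, forall x, f x = f `|x|})
  (f_decay : exists rho C : R, [/\ 1 < rho, 0 < C &
     {ae @lebesgue_measure R, forall x,
        ComplexField.Normc.normc (f x) <= C * japanese x `^ (- rho)}])
  (f_one : exists2 delta : R, 0 < delta &
     {ae @lebesgue_measure R, forall x, - delta < x < delta -> f x = 1})
  (* the selfadjoint operator H, its evolution group and spectral measure *)
  (D : set (fn R)) (H : op R) (hH : self_adjoint D H)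
  (U : R -> op R) (hU : evolution_group D H U)
  (E : set R -> op R) (hE : spectral_measure D H E)
  (* the wave operators *)
  (Wp Wm : op R)
  (hWp : wave_operator U +oo Wp) (hWm : wave_operator U -oo Wm)
  (Wp_complete : complete_wave_operator E Wp)
  (Wm_complete : complete_wave_operator E Wm)
  (smoothness : forall (s' : R) (T : op R), 1 / 2 < s' ->
     bounded_from (sobolev (- s')) (sobolev_norm (- s')) T ->
     locally_smooth F U E (~` eigenvalues D H) T)
  (* the state phi *)
  (s : R) (hs : 1 < s) (phi : fn R)
  (phi_reg : regular_vectors F (eigenvalues D H) s phi)
  (Sphi_reg : regular_vectors F (eigenvalues D H) s
                (scattering_operator Wp Wm phi))
  (phi_in : (\int[@lebesgue_measure R]_(t in `]-oo, 0%R])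
     (norm2 (fun x => Wm (free_evolution t phi) x - free_evolution t phi x))%:E
       < +oo)%E)
  (phi_out : (\int[@lebesgue_measure R]_(t in `[0%R, +oo[)
     (norm2 (fun x =>
        Wp (free_evolution t (scattering_operator Wp Wm phi)) x -
        free_evolution t (scattering_operator Wp Wm phi) x))%:E
       < +oo)%E)
  (* the scattering matrix and its derivative on the support of phi *)
  (sm sm' : R -> R[i])
  (hsm : scattering_matrix (scattering_operator Wp Wm) sm)
  (sm'_meas : measurable_cplx sm')
  (sm_C1 : C1_on (ess_supp phi) sm sm') :
  [/\ (* the integrals converge *)
      forall r : R, 0 < r ->
        integrable_cplx (free_time F f phi r) /\
        integrable_cplx (full_time F f U Wm phi r),
      integrable_cplx (fun x => (ComplexField.Normc.normc (phi x) ^+ 2)%:C *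
                            (sm x)^* * sm' x),
      (* lim tau = <S phi, P S phi> - <phi, P phi>
                 = -i \int |phi|^2 (S x)^* S'(x) dx *)
      exists Pphi PSphi : fn R,
        [/\ momentum phi Pphi,
            momentum (scattering_operator Wp Wm phi) PSphi,
            cvg_cplx (tau_in F f U Wm phi) +oo
              (inner_prod (scattering_operator Wp Wm phi) PSphi - inner_prod phi Pphi) &
            inner_prod (scattering_operator Wp Wm phi) PSphi - inner_prod phi Pphi =
              eisenbud_wigner phi sm sm'],
      cvg_cplx (tau_in F f U Wm phi) +oo (eisenbud_wigner phi sm sm') &
      (* T^0_r and T_r as sojourn times, and equality of time delays *)
      forall J : set R, norm2 phi = 1 -> bounded_set J ->
        J = [set - x | x in J] ->
        (exists2 delta : R, 0 < delta & `]- delta, delta[ `<=` J) ->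
        {ae @lebesgue_measure R, forall x, f x = (\1_J x)%:C} ->
        [/\ forall r : R, 0 < r -> T_free F f phi r =
              (sojourn_time F J (fun t => free_evolution t phi) r)%:C,
            forall r : R, 0 < r -> T_full F f U Wm phi r =
              (sojourn_time F J (fun t => U t (Wm phi)) r)%:C &
            cvg_cplx (fun r => (sojourn_time F J (fun t => U t (Wm phi)) r -
                            sojourn_time F J (fun t => free_evolution t phi) r)%:C)
              +oo (eisenbud_wigner phi sm sm')]].
Proof.
(* From here on [f] acts through the real profile [g], whose bounds hold at every point. *)
have [g [M [d [mg gM g_int [d0 g1] fg]]]] := regular_profile f_meas f_ge0 f_decay f_one.
have g0 x : 0 <= g x by case/andP: (gM x).
have gle x : g x <= M by case/andP: (gM x).
have unU t : unitary_op (U t) by case: hU.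
have UL2 t u : L2 u -> L2 (U t u) by apply: bounded_L2; case: (unU t).
have isoWp : isometric_op Wp by exact: (wave_isometric hU hWp).
have isoWm : isometric_op Wm by exact: (wave_isometric hU hWm).
have spec u (lu : L2 u) := scattering_spec isoWp isoWm Wp_complete Wm_complete lu.
have [lphi sphi [J0 [cJ0 _ phiJ]]] := phi_reg.
have [lpsi spsi [J1 [cJ1 _ psiJ]]] := Sphi_reg.
set psi := scattering_operator Wp Wm phi in lpsi spsi psiJ phi_out *.
have [_ Wpsi npsi] := spec phi lphi; rewrite -/psi in Wpsi npsi.
have iphi := compact_support_integrable lphi cJ0 phiJ.
have ipsi := compact_support_integrable lpsi cJ1 psiJ.
have [pphi [mphi ephi kphi]] := momentum_spec hF (ltW hs) lphi sphi.
have [ppsi [mpsi epsi kpsi]] := momentum_spec hF (ltW hs) lpsi spsi.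
pose v := Wm phi; have lv : L2 v by apply: bounded_L2 => //; case: isoWm.
have inter_m t : aeq (U t v) (Wm (free_evolution t phi)).
  exact: (wave_intertwine hU t (@ninfty_shift R) hWm lphi).
(* W- phi = W+ S phi, followed by the intertwining relation of W+. *)
have inter_p t : aeq (U t v) (Wp (free_evolution t psi)).
  apply: aeq_trans (wave_intertwine hU t (@pinfty_shift R) hWp lpsi).
  apply: (bounded_aeq _ lv _ (aeq_sym Wpsi)); first by case: (unU t).
  by apply: (bounded_L2 _ lpsi); case: isoWp.
pose q := momentum_form F g.
have free_int r : 0 < r -> intg (fun t => q r (free_evolution t phi)).
  exact: (free_time_integrable hF mg g0 gle g_int lphi iphi).
have full_int r : 0 < r -> intg (fun t => q r (U t v)).
  by apply: (full_time_integrable hF hU mg g0 gle g_int d0 g1 lv lphi lpsi iphi ipsi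
    isoWm isoWp inter_m inter_p).
have delay := time_delay_limit hF hU mg g0 gle g_int d0 g1 lv lphi lpsi iphi ipsi
  isoWm isoWp inter_m inter_p npsi phi_in phi_out kphi kpsi.
(* Dilation by r > 0 preserves null sets, so the two profiles define the same function. *)
have fm_g r u : 0 < r -> fun_momentum F f r u = fun_momentum F (fun k => (g k)%:C) r u.
  by move=> r0; apply: fun_momentum_ext; exact: (ae_scale r0 fg).
have freeE r : 0 < r -> free_time F f phi r = (fun t => (q r (free_evolution t phi))%:C).
  move=> r0; apply/funext => t; rewrite /free_time fm_g//.
  by have [] := fun_momentum_form hF mg g0 gle r (L2_free_evolution t lphi).
have fullE r : 0 < r -> full_time F f U Wm phi r = (fun t => (q r (U t v))%:C).
  move=> r0; apply/funext => t; rewrite /full_time fm_g//.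
  by have [] := fun_momentum_form hF mg g0 gle r (UL2 t _ lv).
have TfreeE r : 0 < r -> T_free F f phi r = (\int[mu]_t q r (free_evolution t phi))%:C.
  by move=> r0; rewrite /T_free freeE// integral_cplx_real.
have TfullE r : 0 < r -> T_full F f U Wm phi r = (\int[mu]_t q r (U t v))%:C.
  by move=> r0; rewrite /T_full fullE// integral_cplx_real.
have limE : inner_prod psi ppsi - inner_prod phi pphi =
   (\int[mu]_k (k * normc (F psi k) ^+ 2) - \int[mu]_k (k * normc (F phi k) ^+ 2))%:C.
  by rewrite epsi ephi rmorphB.
have tau_lim : cvg_cplx (tau_in F f U Wm phi) +oo (inner_prod psi ppsi - inner_prod phi pphi).
  rewrite limE; apply: cvg_cplx_near (cvg_cplx_real delay) => r r0.
  by rewrite /tau_in TfullE// TfreeE// rmorphB.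
have [msm hS] := hsm.
(* Multiplication by [sm] represents S, which is isometric. *)
have sm1 : {ae (@mu R), forall x, normc (sm x) = 1}.
  apply: (unimodular_ae msm) => u lu; have [lS _ nS] := spec u lu.
  have ml : measurable_cplx (fun x => sm x * u x).
    by apply: measurable_cplx_mul => //; exact: L2_measurable.
  split; first exact: (L2_ae ml (aeq_sym (hS u lu)) lS).
  by rewrite -nS; exact: (norm2_ae ml (L2_measurable lS) (aeq_sym (hS u lu))).
have [ew_int ewE] := eisenbud_wigner_momentum mphi mpsi msm sm'_meas (hS phi lphi) sm1 sm_C1.
split; [|exact: ew_int| | |].
- by move=> r r0; rewrite (freeE r r0) (fullE r r0); split; apply: integrable_cplx_real;
    [exact: free_int|exact: full_int].
- by exists pphi, ppsi.
- by rewrite -ewE.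
move=> J _ _ _ _ fJ.
have gJ : {ae (@mu R), forall x, (g x)%:C = (\1_J x)%:C :> R[i]}.
  by move: fg fJ; apply: ae_mono2 => x -> ->.
(* An indicator is idempotent: f(P/r) is the projection onto |P| in r J, which turns expectations
   into sojourn probabilities. *)
have gg r : 0 < r -> {ae (@mu R), forall k, g (k / r) ^+ 2 = g (k / r)}.
  move=> r0; have := ae_scale r0 gJ; apply: ae_mono => k /complexI ->.
  by rewrite indicE; case: (_ \in _); rewrite ?expr1n ?expr0n.
have fmJ r u : 0 < r -> fun_momentum F (fun k => (\1_J k)%:C) r u =
    fun_momentum F (fun k => (g k)%:C) r u.
  move=> r0; apply: fun_momentum_ext; have := ae_scale r0 gJ.
  by apply: ae_mono => k ->.
have sojE (x : R -> fn R) r : 0 < r -> (forall t, L2 (x t)) ->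
    sojourn_time F J x r = \int[mu]_t q r (x t).
  move=> r0 lx; apply: RI_ext => t; rewrite fmJ//.
  exact: (norm2_fun_momentum hF mg g0 gle (gg r r0) (lx t)).
have soj_free r : 0 < r -> T_free F f phi r =
    (sojourn_time F J (fun t => free_evolution t phi) r)%:C.
  by move=> r0; rewrite sojE ?TfreeE// => t; exact: L2_free_evolution.
have soj_full r : 0 < r -> T_full F f U Wm phi r =
    (sojourn_time F J (fun t => U t (Wm phi)) r)%:C.
  by move=> r0; rewrite sojE ?TfullE// => t; exact: UL2.
split; [exact: soj_free|exact: soj_full|rewrite -ewE; apply: cvg_cplx_near tau_lim] => r r0.
by rewrite /tau_in (soj_full r r0) (soj_free r r0) rmorphB.
Qed.
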